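(* Let $\alpha\in(0,2)$, $d\ge1$, $m>0$ and assume that $d<2\alpha$. Let $V\in\overline{\mathcal{R}}^m_{d,\alpha}$. Denote by $V_-$ its negative part and by $N_m(V)$ the number of eigenvalues of $H=L_{m,\alpha}+V$, counting multiplicity, that are less than $-m$. For each $\lambda>m$ let $C_{d,\alpha,\lambda,m}>0$ be a constant for which $R^m_\lambda(x)\le C_{d,\alpha,\lambda,m}H^m_{d,\alpha}(|x|)$ for all $x\in\mathbb{R}^d\setminus\{0\}$ (such constants exist). Then there exists $\lambda_0>m$ such that $$N_m(V)\le C_{d,\alpha,\lambda_0,m}^2\,[V_-]^2_{\overline{\mathcal{R}}^m_{d,\alpha}} .$$
   Context: For $\alpha\in(0,2)$, $m>0$, $L_{m,\alpha}=(-\Delta+m^{2/\alpha})^{\alpha/2}-m$ on $L^2(\mathbb{R}^d)$ is the non-negative self-adjoint operator with Fourier multiplier $(|y|^2+m^{2/\alpha})^{\alpha/2}-m$. $e^{-tL_{m,\alpha}}$ has integral kernel $p^m_t(x-y)$, and $R^m_\lambda(x)=\int_0^\infty e^{-\lambda t}p^m_t(x)\,dt$ is the resolvent kernel. $H=L_{m,\alpha}+V$ is understood in the form sense: it is the self-adjoint operator associated with the closed, bounded below quadratic form $\phi\mapsto\|L_{m,\alpha}^{1/2}\phi\|_2^2+\int V|\phi|^2dx$ on $\mathrm{Dom}(L_{m,\alpha}^{1/2})$; its essential spectrum is $[0,\infty)$. $V_-=\max\{-V,0\}$. For $d<2\alpha$ and $m>0$, the extended fractional Rollnik-class $\overline{\mathcal{R}}^m_{d,\alpha}$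 is the set of measurable $V:\mathbb{R}^d\to\mathbb{R}$ with $$[V]^2_{\overline{\mathcal{R}}^m_{d,\alpha}}=\int_{\mathbb{R}^d}\int_{\mathbb{R}^d}H^m_{d,\alpha}(|x-y|)^2|V(x)||V(y)|\,dx\,dy<\infty ,$$ where $H^m_{d,\alpha}(r)=h(r)\mathbf{1}_{\{r\le1\}}+r^{-\frac{d+\alpha}{2}}\kappa_m(r)\mathbf{1}_{\{r>1\}}$ for $r>0$, with $h(r)=r^{-(d-\alpha)}$ if $\alpha<d$, $h(r)=\log(1+\frac1r)$ if $\alpha=d=1$, $h(r)=1$ if $\alpha>d=1$, $\kappa_m(r)=m^{(d+\alpha)/(2\alpha)}K_{(d+\alpha)/2}(m^{1/\alpha}r)$, and $K_\rho(z)=\frac12(\frac z2)^\rho\int_0^\infty t^{-\rho-1}e^{-t-\frac{z^2}{4t}}dt$ the modified Bessel function of the second kind. *)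

(* Defs.v *)
From HB Require Import structures.
From mathcomp Require Import all_boot all_order all_algebra.
From mathcomp Require Import all_classical all_reals all_analysis.
From mathcomp.real_closed Require Import complex.

Set Implicit Arguments.
Unset Strict Implicit.
Unset Printing Implicit Defensive.

Import Order.TTheory GRing.Theory Num.Theory.
Import numFieldNormedType.Exports.

Local Open Scope classical_set_scope.
Local Open Scope ring_scope.

(* sigma-algebra on R^d generated by the coordinates *)
Section rV_measurable.
Context (R : realType) (d : nat).

Definition rV_coord (i : 'I_d) (x : 'rV[R]_d) : R := x ord0 i.

Let rV_set0 : g_sigma_preimage rV_coord set0.
Proof. exact: sigma_algebra0. Qed.

Let rV_setC A : g_sigma_preimage rV_coord A -> g_sigma_preimage rV_coord (~` A).
Proof. exact: sigma_algebraC. Qed.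

Let rV_bigcup (F : (set 'rV[R]_d)^nat) :
  (forall i, g_sigma_preimage rV_coord (F i)) ->
  g_sigma_preimage rV_coord (\bigcup_i (F i)).
Proof. exact: sigma_algebra_bigcup. Qed.

HB.instance Definition _ := @isMeasurable.Build default_measure_display
  'rV[R]_d (g_sigma_preimage rV_coord) rV_set0 rV_setC rV_bigcup.

Lemma measurable_rV_coord i : measurable_fun [set: 'rV[R]_d] (rV_coord i).
Proof.
move=> _ Y mY; rewrite setTI; apply: sub_sigma_algebra.
rewrite -bigcup_seq/=; exists i => /=; first by rewrite mem_index_enum.
by exists Y => //; rewrite setTI.
Qed.

Lemma measurable_fun_rV d' (T : measurableType d') (f : T -> 'rV[R]_d) :
  (forall i, measurable_fun [set: T] (fun t => f t ord0 i)) ->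
  measurable_fun [set: T] f.
Proof.
move=> mf.
suff prefS : g_sigma_preimage (fun i => rV_coord i \o f) `<=` measurable.
  move=> _ A mA; apply: prefS; rewrite g_sigma_preimage_comp.
  by exists A.
apply: smallest_sub; first exact: sigma_algebra_measurable.
rewrite -bigcup_seq/= => A [i _ [B mB <-]].
exact: (mf i measurableT).
Qed.

End rV_measurable.

Section rV_cons.
Context (R : realType) (d : nat).

Definition rV_cons (p : R * 'rV[R]_d) : 'rV[R]_d.+1 :=
  \row_i oapp (fun j => p.2 ord0 j) p.1 (unlift ord0 i).

Definition rV_behead (x : 'rV[R]_d.+1) : 'rV[R]_d := \row_i x ord0 (lift ord0 i).

Lemma rV_consK p : rV_behead (rV_cons p) = p.2.
Proof. by apply/rowP => i; rewrite !mxE liftK. Qed.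

Lemma rV_cons0 p : rV_cons p ord0 ord0 = p.1.
Proof. by rewrite mxE unlift_none. Qed.

Lemma measurable_rV_cons : measurable_fun [set: R * 'rV[R]_d] rV_cons.
Proof.
apply: measurable_fun_rV => i.
case: (unliftP ord0 i) => [j|] ->.
  under eq_fun do rewrite mxE liftK/=.
  exact: (measurableT_comp (measurable_rV_coord j) measurable_snd).
by under eq_fun do rewrite mxE unlift_none/=; exact: measurable_fst.
Qed.

Lemma measurable_rV_behead : measurable_fun [set: 'rV[R]_d.+1] rV_behead.
Proof.
apply: measurable_fun_rV => i; under eq_fun do rewrite mxE.
exact: (measurable_rV_coord (lift ord0 i)).
Qed.

End rV_cons.

Section lebesgue_rV.
Local Open Scope ereal_scope.
Context (R : realType).

Section step.
Context (d : nat) (m : {sigma_finite_measure set 'rV[R]_d -> \bar R}).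

Definition rV_cons_measure : set 'rV[R]_d.+1 -> \bar R :=
  pushforward (@lebesgue_measure R \x m) (@rV_cons R d).

HB.instance Definition _ := Measure.copy rV_cons_measure
  (measure_function_pushforward__canonical__measure_function_Measure
     (@lebesgue_measure R \x m) (@measurable_rV_cons R d)).

Let rV_cons_measure_sigma_finite : sigma_finite setT rV_cons_measure.
Proof.
have /sigma_finiteP[F [FT Fnd Foo]] := sigma_finiteT (@lebesgue_measure R).
have /sigma_finiteP[G [GT Gnd Goo]] := sigma_finiteT m.
pose g (x : 'rV[R]_d.+1) := (rV_coord ord0 x, rV_behead x).
have mg : measurable_fun [set: 'rV[R]_d.+1] g.
  apply/measurable_fun_pair => /=.
    exact: measurable_rV_coord.
  exact: measurable_rV_behead.
have gK p : g (rV_cons p) = p.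
  by rewrite /g rV_consK /rV_coord rV_cons0 -surjective_pairing.
exists (fun n => g @^-1` (F n `*` G n)).
  rewrite -preimage_bigcup (_ : \bigcup_n _ = setT) ?preimage_setT//.
  rewrite -setXTT FT GT predeqE => -[x y]; split.
    by move=> [n _ []/= ? ?]; split; exists n.
  move=> [/= [n _ Fnx] [k _ Gky]]; exists (maxn n k) => //; split.
    by move: x Fnx; exact/subsetPset/Fnd/leq_maxl.
  by move: y Gky; exact/subsetPset/Gnd/leq_maxr.
move=> k; have [mFk Fkoo] := Foo k; have [mGk Gkoo] := Goo k.
have mFG : measurable (F k `*` G k) by exact: measurableX.
split; first by rewrite -[X in measurable X]setTI; exact: mg.
rewrite /rV_cons_measure /pushforward/= -comp_preimage.
rewrite (_ : g \o _ = id) ?preimage_id; last by rewrite funeqE => p /=; exact: gK.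
by rewrite product_measure1E// lte_mul_pinfty// ge0_fin_numE.
Qed.

HB.instance Definition _ :=
  Measure_isSigmaFinite.Build _ _ _ rV_cons_measure rV_cons_measure_sigma_finite.

End step.

Fixpoint lebesgue_rV (d : nat) : {sigma_finite_measure set 'rV[R]_d -> \bar R} :=
  if d is d'.+1 then rV_cons_measure (lebesgue_rV d') else \d_(0%R : 'rV[R]_0).

Lemma lebesgue_rV_box (d : nat) (A : 'I_d -> set R) :
  (forall i, measurable (A i)) ->
  lebesgue_rV d [set x : 'rV[R]_d | forall i, A i (x ord0 i)] =
  \prod_(i < d) lebesgue_measure (A i).
Proof.
elim: d A => [|d IH] A mA.
  rewrite big_ord0/= diracE mem_set//; first by case.
rewrite big_ord_recl -IH//= /rV_cons_measure /pushforward/=.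
have mB : measurable
    [set x : 'rV[R]_d | forall i, A (lift ord0 i) (x ord0 i)].
  rewrite (_ : [set _ | _] = \bigcap_(i in [set: 'I_d])
      (@rV_coord R d i @^-1` A (lift ord0 i))).
    apply: fin_bigcap_measurable => // i _.
    by rewrite -[X in measurable X]setTI; exact: measurable_rV_coord.
  by apply/seteqP; split=> [x Ax i _|x Ax i]; exact: Ax.
have := product_measure1E (@lebesgue_measure R) (lebesgue_rV d) (mA ord0) mB.
move=> <-.
apply: congr1; apply/seteqP; split=> -[x y] /=.
  move=> Axy; split; first by have := Axy ord0; rewrite rV_cons0.
  by move=> i; have := Axy (lift ord0 i); rewrite mxE liftK.
move=> [Ax Ay] i; case: (unliftP ord0 i) => [j|] ->.
  by rewrite mxE liftK.
by rewrite rV_cons0.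
Qed.

End lebesgue_rV.

Local Notation Re := complex.Re.
Local Notation Im := complex.Im.

Section euclidean.
Context (R : realType) (d : nat).
Implicit Types x y : 'rV[R]_d.

Definition dotv x y : R := \sum_i x ord0 i * y ord0 i.

(* The norm `|x| of 'rV[R]_d is the sup norm, hence this definition. *)
Definition enorm x : R := Num.sqrt (dotv x x).

End euclidean.

Section complex_L2.
Context (R : realType) (d : nat).
Implicit Types (f g : 'rV[R]_d -> R[i]) (D : set 'rV[R]_d).

Let mu := lebesgue_rV R d.

Definition sqmod (z : R[i]) : R := Re z ^+ 2 + Im z ^+ 2.

Definition expi (theta : R) : R[i] := (cos theta +i* sin theta)%C.

Definition cmeasurable f :=
  measurable_fun [set: 'rV[R]_d] (fun x => Re (f x)) /\
  measurable_fun [set: 'rV[R]_d] (fun x => Im (f x)).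

Definition cintegrable D f :=
  mu.-integrable D (fun x => (Re (f x))%:E) /\
  mu.-integrable D (fun x => (Im (f x))%:E).

Definition cintegral D f : R[i] :=
  ((\int[mu]_(x in D) Re (f x)) +i* (\int[mu]_(x in D) Im (f x)))%C.

Definition sqL2norm f : \bar R := (\int[mu]_x (sqmod (f x))%:E)%E.

Definition L2 f := cmeasurable f /\ (sqL2norm f < +oo)%E.

(* antilinear in the first argument *)
Definition L2inner f g : R[i] :=
  cintegral [set: 'rV[R]_d] (fun x => conjc (f x) * g x).

Definition fourier_trunc f (n : nat) (y : 'rV[R]_d) : R[i] :=
  ((2 * pi) `^ (- (d%:R / 2)))%:C%C *
  cintegral [set x | enorm x <= n%:R] (fun x => expi (- dotv x y) * f x).

(* [is_fourier f g]: g is the unitary (Plancherel) Fourier transform of f *)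
Definition is_fourier f g :=
  [/\ L2 f, L2 g &
      sqL2norm (fun y => g y - fourier_trunc f n y) @[n --> \oo] --> 0%E].

(* graph of the operator on L^2 with Fourier multiplier a, on its maximal
   domain; elements of L^2 are represented by functions, up to equality almost
   everywhere *)
Definition fourier_multiplier (a : 'rV[R]_d -> R) f g :=
  exists hf hg, [/\ is_fourier f hf, is_fourier g hg &
    {ae mu, forall y, hg y = (a y)%:C%C * hf y}].

End complex_L2.

Section relativistic_operator.
Context (R : realType) (d : nat) (alpha m : R).
Implicit Types (f g phi psi eta : 'rV[R]_d -> R[i]) (V : 'rV[R]_d -> R).

Let mu := lebesgue_rV R d.

Definition symbolL (y : 'rV[R]_d) : R :=
  (enorm y ^+ 2 + m `^ (2 / alpha)) `^ (alpha / 2) - m.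

(* [sqrtL f g]: f is in Dom(L^{1/2}) and L^{1/2} f = g *)
Definition sqrtL f g := fourier_multiplier (fun y => Num.sqrt (symbolL y)) f g.

(* [semigroupL t f g]: e^{-tL} f = g *)
Definition semigroupL (t : R) f g :=
  fourier_multiplier (fun y => expR (- t * symbolL y)) f g.

(* p t (x - y) is the integral kernel of e^{-tL}; continuity selects the
   representative for which pointwise statements make sense *)
Definition heat_kernel (p : R -> 'rV[R]_d -> R) :=
  forall t, 0 < t ->
    continuous (p t) /\
    forall f g, semigroupL t f g ->
      {ae mu, forall x,
        let K := fun y => (p t (x - y))%:C%C * f y in
        cintegrable [set: 'rV[R]_d] K /\
        g x = cintegral [set: 'rV[R]_d] K}.

Definition resolvent_kernel (p : R -> 'rV[R]_d -> R) (lambda : R)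
    (x : 'rV[R]_d) : \bar R :=
  (\int[lebesgue_measure]_(t in `]0%R, +oo[)
     (expR (- lambda * t) * p t x)%:E)%E.

(* [formH V psi phi q]: psi, phi are in the form domain Dom(L^{1/2}) and q is
   the value at (psi, phi) of the polarization of
   phi |-> ||L^{1/2} phi||^2 + \int V |phi|^2 *)
Definition formH V psi phi (q : R[i]) :=
  exists gpsi gphi, [/\ sqrtL psi gpsi, sqrtL phi gphi &
    q = L2inner gpsi gphi +
        cintegral [set: 'rV[R]_d]
          (fun x => (V x)%:C%C * (conjc (psi x) * phi x))].

(* graph of the self-adjoint operator H = L + V associated with this form *)
Definition opH V phi eta :=
  [/\ exists g, sqrtL phi g, L2 eta &
      forall psi q, formH V psi phi q -> q = L2inner psi eta].

Definition ae_free (n : nat) (phi : 'I_n -> 'rV[R]_d -> R[i]) :=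
  forall c : 'I_n -> R[i],
    {ae mu, forall x, \sum_i c i * phi i x = 0} -> forall i, c i = 0.

(* dimension of ker (H - E), possibly infinite *)
Definition multiplicityH V (E : R) : \bar R :=
  ereal_sup [set n%:R%:E | n in [set n : nat |
    exists phi : 'I_n -> 'rV[R]_d -> R[i],
      ae_free phi /\
      forall i, opH V (phi i) (fun x => E%:C%C * phi i x)]].

Definition nb_eigenvalues_below V (a : R) : \bar R :=
  \esum_(E in [set E | E < a]) multiplicityH V E.

End relativistic_operator.

Section rollnik.
Context (R : realType) (d : nat) (alpha m : R).

Definition besselK (rho z : R) : R :=
  2^-1 * (z / 2) `^ rho *
  \int[lebesgue_measure]_(t in `]0, +oo[)
    (t `^ (- rho - 1) * expR (- t - z ^+ 2 / (4 * t))).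

Definition rollnik_kappa (r : R) : R :=
  m `^ ((d%:R + alpha) / (2 * alpha)) *
  besselK ((d%:R + alpha) / 2) (m `^ alpha^-1 * r).

Definition rollnik_h (r : R) : R :=
  if alpha < d%:R then r `^ (- (d%:R - alpha))
  else if alpha == d%:R then ln (1 + r^-1)
  else 1.

Definition rollnik_H (r : R) : R :=
  if r <= 1 then rollnik_h r
  else r `^ (- ((d%:R + alpha) / 2)) * rollnik_kappa r.

(* the square [V]^2 of the Rollnik norm *)
Definition rollnik_sq (V : 'rV[R]_d -> R) : \bar R :=
  (\int[lebesgue_rV R d]_x \int[lebesgue_rV R d]_y
     (rollnik_H (enorm (x - y)) ^+ 2 * `|V x| * `|V y|)%:E)%E.

Definition ext_rollnik (V : 'rV[R]_d -> R) :=
  measurable_fun [set: 'rV[R]_d] V /\ (rollnik_sq V < +oo)%E.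

End rollnik.

(* Main.v *)
(* Birman-Schwinger counting with a Hilbert-Schmidt bound. Let W = V_- and let r be the
   resolvent kernel at lambda. If phi is in the span of eigenfunctions with eigenvalues at
   most -a, where 0 < a <= lambda, then
     int W |phi|^2 >= <phi, (L + a) phi> >= (a / lambda) <phi, (L + lambda) phi>.
   On the other hand, (L + lambda)^{-1} has the kernel r, so if phi_1, ..., phi_n are
   orthonormal for the weight W, the Cauchy-Schwarz inequality for the Hilbert-Schmidt
   inner product bounds the sum of <W phi_i, (L + lambda)^{-1} W phi_i> by
   (n int int r^2 W W)^{1/2}. Together these give n <= (lambda / a)^2 int int r^2 W W.

   With lambda = m + 1 and a = m, only finitely many eigenvalues are below -m, hence all
   of them are at most -lambda0 for some lambda0 > m; then lambda = a = lambda0 gives the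
   claim.

   The kernel p_t is nonnegative because e^{-t L} has a multiplier that is a limit of
   positive combinations of Gaussians: s |-> s^(alpha/2) is a limit of nonnegative
   combinations of the functions 1 - e^{-c s}. *)

From HB Require Import structures.
Require Import Defs.
From mathcomp Require Import all_boot all_order all_algebra.
From mathcomp Require Import all_classical all_reals all_analysis.
From mathcomp.real_closed Require Import complex.
From mathcomp Require Import measurable_realfun lebesgue_integral_under ring lra.

Set Implicit Arguments.
Unset Strict Implicit.
Unset Printing Implicit Defensive.

Import Order.TTheory GRing.Theory Num.Theory.
Import numFieldNormedType.Exports.

Local Open Scope classical_set_scope.
Local Open Scope ring_scope.

(** No resolvent operator and no spectral theorem enter. The quadratic form of (L + lambda)^{-1} is
    evaluated only on bounded functions of bounded support, where Fubini in t and Parseval identify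
    it with the double integral of the resolvent kernel; the rest follows by truncation and limits.
    Two points are hidden behind the formulas. The kernel [p] is known only through its action
    almost everywhere, and its resolvent is bounded only from above: positivity of [p] is what
    permits integrating in t and squaring the bound. Also, [Rintegral] returns a default value on
    infinite integrals, so the term with V in the eigenvalue equation carries information only once
    V |phi|^2 is integrable on the whole form domain; a bootstrap on truncations provides this.
    Inner products are replaced by their real parts, so the counting is over R: a complex
    eigenfunction phi yields two real directions, phi and i phi, and this factor 2 cancels the one
    in [sqr_sum_rdot_le]. Hence the constant is exactly C^2. *)

Local Notation Re := complex.Re.
Local Notation Im := complex.Im.
Local Notation intble mu f := (integrable mu setT (fun x => (f x)%:E)).

(** * Integration of real functions *)

Section real_integrals.
Context d (T : measurableType d) (R : realType) (mu : {measure set T -> \bar R}).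
Implicit Types (f g : T -> R).

Lemma intble_meas f : intble mu f -> measurable_fun setT f.
Proof. by move=> /measurable_int/measurable_EFinP. Qed.

Lemma intble_le g f : measurable_fun setT f -> (forall x, `|f x| <= g x) ->
  intble mu g -> intble mu f.
Proof.
move=> mf fg ig; apply: (le_integrable _ _ _ ig) => //.
  exact/measurable_EFinP.
move=> x _; rewrite lee_fin; exact/(le_trans (fg x))/ler_norm.
Qed.

Lemma intbleD f g : intble mu f -> intble mu g -> intble mu (fun x => f x + g x).
Proof. by move=> ? ?; exact: (@integrableD _ _ _ mu _ _ (EFin \o f) (EFin \o g)). Qed.

Lemma intbleB f g : intble mu f -> intble mu g -> intble mu (fun x => f x - g x).
Proof. by move=> ? ?; exact: (@integrableB _ _ _ mu _ _ (EFin \o f) (EFin \o g)). Qed.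

Lemma intbleN f : intble mu f -> intble mu (fun x => - f x).
Proof. by move=> ?; exact: (@integrableN _ _ _ mu _ (EFin \o f)). Qed.

Lemma intbleZ (c : R) f : intble mu f -> intble mu (fun x => c * f x).
Proof. by move=> ?; exact: (@integrableZl _ _ _ mu _ _ _ (EFin \o f)). Qed.

Lemma intble0 : intble mu (fun=> 0).
Proof. exact: integrable0. Qed.

Lemma intble_sum I (s : seq I) (F : I -> T -> R) :
  (forall i, intble mu (F i)) -> intble mu (fun x => \sum_(i <- s) F i x).
Proof.
move=> iF; elim: s => [|i s IH].
  by under eq_fun do rewrite big_nil; exact: intble0.
by under eq_fun do rewrite big_cons; exact: intbleD.
Qed.

Lemma intble_norm f : intble mu f -> intble mu (fun x => `|f x|).
Proof. exact: integrable_norm. Qed.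

Lemma intble_bdM (K : R) f g : measurable_fun setT f -> (forall x, `|f x| <= K) ->
  intble mu g -> intble mu (fun x => f x * g x).
Proof.
move=> mf fK ig; apply: (@intble_le (fun x => K * `|g x|)).
- by apply: measurable_funM => //; exact: intble_meas.
- by move=> x; rewrite normrM ler_wpM2r.
- exact/intbleZ/intble_norm.
Qed.

Lemma EFin_RI f : intble mu f -> (\int[mu]_x f x)%:E = (\int[mu]_x (f x)%:E)%E.
Proof. by move=> /integrable_fin_num iF; rewrite fineK// iF. Qed.

Lemma intble_lty f : measurable_fun setT f -> (forall x, 0 <= f x) ->
  (\int[mu]_x (f x)%:E < +oo)%E -> intble mu f.
Proof.
move=> mf f0 foo; apply/integrableP; split; first exact/measurable_EFinP.
by under eq_integral do rewrite abse_EFin ger0_norm//.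
Qed.

Lemma RI0 : \int[mu]_x (0 : R) = 0.
Proof. by rewrite /Rintegral integral0. Qed.

Lemma RID f g : intble mu f -> intble mu g ->
  \int[mu]_x (f x + g x) = \int[mu]_x f x + \int[mu]_x g x.
Proof. exact: RintegralD. Qed.

Lemma RIB f g : intble mu f -> intble mu g ->
  \int[mu]_x (f x - g x) = \int[mu]_x f x - \int[mu]_x g x.
Proof. exact: RintegralB. Qed.

Lemma RIZ (c : R) f : intble mu f -> \int[mu]_x (c * f x) = c * \int[mu]_x f x.
Proof. exact: RintegralZl. Qed.

Lemma RI_sum I (s : seq I) (F : I -> T -> R) : (forall i, intble mu (F i)) ->
  \int[mu]_x (\sum_(i <- s) F i x) = \sum_(i <- s) \int[mu]_x F i x.
Proof.
move=> iF; elim: s => [|i s IH].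
  by under eq_Rintegral do rewrite big_nil; rewrite big_nil RI0.
under eq_Rintegral do rewrite big_cons.
by rewrite big_cons RID ?IH//; exact: intble_sum.
Qed.

Lemma RI_le f g : intble mu f -> intble mu g -> (forall x, f x <= g x) ->
  \int[mu]_x f x <= \int[mu]_x g x.
Proof. by move=> fi gi fg; exact: le_Rintegral. Qed.

Lemma RI_norm f : intble mu f -> `|\int[mu]_x f x| <= \int[mu]_x `|f x|.
Proof. exact: le_normr_Rintegral. Qed.

Lemma measurable_abse_EFin f : measurable_fun setT f ->
  measurable_fun setT (fun x => `|(f x)%:E|%E).
Proof. by move=> mf; apply: measurableT_comp => //; exact/measurable_EFinP. Qed.

Lemma RI_ae f g : measurable_fun setT f -> measurable_fun setT g ->
  {ae mu, forall x, f x = g x} -> \int[mu]_x f x = \int[mu]_x g x.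
Proof.
move=> mf mg fg; congr fine; apply: ae_eq_integral => //; try exact/measurable_EFinP.
by apply: filterS fg => x -> .
Qed.

Lemma intble_ae f g : measurable_fun setT g -> {ae mu, forall x, f x = g x} ->
  intble mu f -> intble mu g.
Proof.
move=> mg fg fi; apply/integrableP; split; first exact/measurable_EFinP.
move/integrableP : (fi) => [mf]; apply: le_lt_trans.
rewrite le_eqVlt; apply/orP; left; apply/eqP.
apply: ae_eq_integral => //; try exact: measurable_abse_EFin.
  exact/measurable_abse_EFin/(intble_meas fi).
by apply: filterS fg => x -> .
Qed.

Lemma RI_eq0 f : (forall x, 0 <= f x) -> intble mu f -> \int[mu]_x f x = 0 ->
  {ae mu, forall x, f x = 0}.
Proof.
move=> f0 fi If; have /integrableP[mf _] := fi.
have := (ae_eq_integral_abs mu measurableT mf).1.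
have -> : (\int[mu]_x `|(f x)%:E| = 0)%E.
  under eq_integral do rewrite abse_EFin ger0_norm//.
  by rewrite -EFin_RI// If.
by move=> /(_ erefl); apply: filterS => x /(_ I) [].
Qed.

Lemma RI_dct (F : nat -> T -> R) f g : (forall n, measurable_fun setT (F n)) ->
  measurable_fun setT f -> intble mu g -> (forall n x, `|F n x| <= g x) ->
  {ae mu, forall x, F n x @[n --> \oo] --> f x} ->
  intble mu f /\ \int[mu]_x F n x @[n --> \oo] --> \int[mu]_x f x.
Proof.
move=> mF mf gi Fg Ff.
have [|||||fi _ FF] := @dominated_convergence _ _ _ mu setT measurableT
  (fun n x => (F n x)%:E) (fun x => (f x)%:E) (fun x => (g x)%:E).
- by move=> n; exact/measurable_EFinP.
- exact/measurable_EFinP.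
- by apply: filterS Ff => x Fx _; apply: cvg_EFin => //; near=> n.
- exact: gi.
- by apply: aeW => x n _; rewrite lee_fin.
split => //; apply/fine_cvg; rewrite fineK; last exact: (integrable_fin_num _ fi).
exact: FF.
Unshelve. all: by end_near. Qed.

End real_integrals.

(** * Fubini's theorem for real-valued integrals *)

Section real_fubini.
Context d1 d2 (T1 : measurableType d1) (T2 : measurableType d2) (R : realType).
Variable m1 : {sigma_finite_measure set T1 -> \bar R}.
Variable m2 : {sigma_finite_measure set T2 -> \bar R}.
Implicit Types f : T1 * T2 -> R.

(** The positive and negative parts have measurable partial integrals by Tonelli, and [fine] of the
    difference stays measurable also where a section fails to be integrable. *)
Lemma measurable_RI f : measurable_fun setT f ->
  measurable_fun setT (fun x => \int[m2]_y f (x, y)).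
Proof.
move=> mf; have mf' : measurable_fun setT (EFin \o f) by exact/measurable_EFinP.
rewrite /Rintegral /=.
apply: (@measurableT_comp _ _ _ _ _ _ fine) => //.
under [X in measurable_fun _ X]funext => x do rewrite integralE.
apply: emeasurable_funB.
  apply: (eq_measurable_fun (fubini_F m2 ((EFin \o f)^\+)%E)) => [x _|].
    by apply: eq_integral => y _; rewrite !funeposE.
  by apply: measurable_fun_fubini_tonelli_F => //; exact: measurable_funepos.
apply: (eq_measurable_fun (fubini_F m2 ((EFin \o f)^\-)%E)) => [x _|].
  by apply: eq_integral => y _; rewrite !funenegE.
by apply: measurable_fun_fubini_tonelli_F => //; exact: measurable_funeneg.
Qed.

Let RI_fin f : intble (m1 \x m2)%E f ->
  {ae m1, forall x, (\int[m2]_y f (x, y))%:E = (\int[m2]_y (f (x, y))%:E)%E}.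
Proof.
move=> fi; apply: filterS (ae_integrable1 fi) => x xi.
by rewrite EFin_RI.
Qed.

(** The extended inner integral may be infinite on a null set; off that set it agrees with its real
    version. *)
Lemma intble_RI f : intble (m1 \x m2)%E f -> intble m1 (fun x => \int[m2]_y f (x, y)).
Proof.
move=> fi; have := integrable_fubini_F fi; rewrite /fubini_F => h.
have mf : measurable_fun setT (fun x => \int[m2]_y f (x, y)).
  exact: (measurable_RI (intble_meas fi)).
apply/integrableP; split; first exact/measurable_EFinP.
move/integrableP : h => [mh]; apply: le_lt_trans.
rewrite le_eqVlt; apply/orP; left; apply/eqP.
apply: ae_eq_integral => //.
- exact: measurable_abse_EFin.
- exact: measurableT_comp.
by apply: filterS (RI_fin fi) => x -> .
Qed.

Lemma RI_prod f : intble (m1 \x m2)%E f ->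
  \int[m1]_x \int[m2]_y f (x, y) = \int[(m1 \x m2)%E]_z f z.
Proof.
move=> fi; congr fine; rewrite -(integral12_prod_meas1 fi).
apply: ae_eq_integral => //.
- exact/measurable_int/(intble_RI fi).
- exact/measurable_int/(integrable_fubini_F fi).
by apply: filterS (RI_fin fi) => x ->.
Qed.

End real_fubini.

Section real_fubini2.
Context d1 d2 (T1 : measurableType d1) (T2 : measurableType d2) (R : realType).
Variable m1 : {sigma_finite_measure set T1 -> \bar R}.
Variable m2 : {sigma_finite_measure set T2 -> \bar R}.
Implicit Types f : T1 * T2 -> R.

Lemma measurable_swap_fun f : measurable_fun setT f ->
  measurable_fun setT (fun z : T2 * T1 => f (z.2, z.1)).
Proof.
move=> mf; apply: (measurableT_comp mf).
by apply/measurable_fun_pair; [exact: measurable_snd|exact: measurable_fst].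
Qed.

Lemma intble_swap f : intble (m1 \x m2)%E f ->
  intble (m2 \x m1)%E (fun z => f (z.2, z.1)).
Proof.
move=> fi; have mf := intble_meas fi.
apply/integrable12ltyP; first by apply/measurable_EFinP; exact: (measurable_swap_fun mf).
have mf2 : measurable_fun setT (EFin \o f) by exact/measurable_EFinP.
exact: ((integrable21ltyP m1 m2 mf2).1 fi).
Qed.

Lemma RI_fubini f : intble (m1 \x m2)%E f ->
  \int[m1]_x \int[m2]_y f (x, y) = \int[m2]_y \int[m1]_x f (x, y).
Proof.
move=> fi; rewrite RI_prod// (RI_prod (intble_swap fi)).
congr fine; rewrite -(integral12_prod_meas1 fi) (Fubini fi).
by rewrite -(integral12_prod_meas1 (intble_swap fi)).
Qed.

Lemma intble_prod (f : T1 -> R) (g : T2 -> R) : intble m1 f -> intble m2 g ->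
  intble (m1 \x m2)%E (fun z => f z.1 * g z.2).
Proof.
move=> fi gi; apply/integrable12ltyP.
  apply/measurable_EFinP/measurable_funM.
    exact: measurableT_comp (intble_meas fi) _.
  exact: measurableT_comp (intble_meas gi) _.
under eq_integral => x _.
  under eq_integral do rewrite /= normrM EFinM.
  rewrite ge0_integralZl_EFin//; last first.
    exact/measurable_EFinP/measurableT_comp/(intble_meas gi).
  rewrite -EFin_RI; last exact: intble_norm.
  over.
rewrite ge0_integralZr//; first last.
- by rewrite lee_fin Rintegral_ge0.
- exact/measurable_EFinP/measurableT_comp/(intble_meas fi).
rewrite -EFin_RI; last exact: intble_norm.
by rewrite -EFinM ltry.
Qed.

End real_fubini2.

(* The product measure of the library is only given its sigma-finite structure
   when it is finite; iterated products need the general case. *)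
Section product_sigma_finite.
Context d1 d2 (T1 : measurableType d1) (T2 : measurableType d2) (R : realType).
Variable m1 : {sigma_finite_measure set T1 -> \bar R}.
Variable m2 : {sigma_finite_measure set T2 -> \bar R}.
Local Open Scope ereal_scope.

Definition prod_sf : set (T1 * T2) -> \bar R := (m1 \x m2)%E.

HB.instance Definition _ := Measure.on prod_sf.

Let prod_sf_sigma_finite : sigma_finite setT prod_sf.
Proof.
have /sigma_finiteP[F [FT Fnd Foo]] := sigma_finiteT m1.
have /sigma_finiteP[G [GT Gnd Goo]] := sigma_finiteT m2.
exists (fun n => F n `*` G n).
  rewrite -setXTT FT GT predeqE => -[x y]; split.
    move=> [/= [n _ Fnx] [k _ Gky]]; exists (maxn n k) => //; split.
      by move: x Fnx; exact/subsetPset/Fnd/leq_maxl.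
    by move: y Gky; exact/subsetPset/Gnd/leq_maxr.
  by move=> [n _ []/= ? ?]; split; exists n.
move=> k; have [mFk Fkoo] := Foo k; have [mGk Gkoo] := Goo k.
split; first exact: measurableX.
by rewrite /prod_sf product_measure1E// lte_mul_pinfty// ge0_fin_numE.
Qed.

HB.instance Definition _ :=
  Measure_isSigmaFinite.Build _ _ _ prod_sf prod_sf_sigma_finite.

End product_sigma_finite.

(** * Measure theory on R^d: open sets, product integrals, a generating pi-system *)

Section rV_measure_theory.
Context (R : realType).
Implicit Types d : nat.

Lemma measurable_rV_entry d (i : 'I_d) : measurable_fun [set: 'rV[R]_d] (fun x => x ord0 i).
Proof. exact: measurable_rV_coord. Qed.

Lemma measurable_subv d :
  measurable_fun [set: 'rV[R]_d * 'rV[R]_d] (fun z => z.1 - z.2).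
Proof.
apply: measurable_fun_rV => i; under eq_fun do rewrite !mxE.
apply: measurable_funB.
  exact: measurableT_comp (@measurable_rV_entry d i) measurable_fst.
exact: measurableT_comp (@measurable_rV_entry d i) measurable_snd.
Qed.

Lemma measurable_dotv (d' : measure_display) (T : measurableType d') (d : nat) (f g : T -> 'rV[R]_d) :
  measurable_fun setT f -> measurable_fun setT g ->
  measurable_fun setT (fun x => dotv (f x) (g x)).
Proof.
move=> mf mg; apply: measurable_sum => i; apply: measurable_funM.
  exact: measurableT_comp (@measurable_rV_entry d i) mf.
exact: measurableT_comp (@measurable_rV_entry d i) mg.
Qed.

Lemma measurable_enorm d : measurable_fun setT (@enorm R d).
Proof.
apply: measurableT_comp; last exact: measurable_dotv.
apply: continuous_measurable_fun; exact: sqrt_continuous.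
Qed.

Lemma dotv_ge0 d (x : 'rV[R]_d) : 0 <= dotv x x.
Proof. by apply: sumr_ge0 => i _; rewrite -expr2 sqr_ge0. Qed.

Lemma sqr_enorm d (x : 'rV[R]_d) : enorm x ^+ 2 = dotv x x.
Proof. by rewrite sqr_sqrtr// dotv_ge0. Qed.

Lemma enorm_eq0 d (x : 'rV[R]_d) : enorm x = 0 -> x = 0.
Proof.
move=> x0; have : dotv x x = 0 by rewrite -sqr_enorm x0 expr0n.
move=> /eqP; rewrite psumr_eq0; last by move=> i _; rewrite -expr2 sqr_ge0.
move=> /allP h; apply/rowP => i; rewrite mxE; apply/eqP.
by have := h i; rewrite mem_index_enum mulf_eq0 orbb => /(_ isT).
Qed.

(** A point is a box with a side of length zero. In dimension 0, which the hypothesis excludes, the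
    measure is a unit mass at the only point. *)
Lemma lebesgue_rV_set1 d (x : 'rV[R]_d) : (0 < d)%N -> lebesgue_rV R d [set x] = 0%E.
Proof.
move=> d0; rewrite (_ : [set x] = [set y : 'rV[R]_d | forall i, [set x ord0 i] (y ord0 i)]).
  rewrite (lebesgue_rV_box (A := fun i => [set x ord0 i]))// (bigD1 (Ordinal d0))//=.
  by rewrite lebesgue_measure_set1 mul0e.
by apply/seteqP; split=> [_ -> //|y /= yx]; apply/rowP.
Qed.

Lemma measurable_rV_set d (A : 'I_d -> set R) : (forall i, measurable (A i)) ->
  measurable [set x : 'rV[R]_d | forall i, A i (x ord0 i)].
Proof.
move=> mA; rewrite (_ : [set _ | _] = \bigcap_(i in [set: 'I_d])
      (@rV_coord R d i @^-1` A i)).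
  apply: fin_bigcap_measurable => // i _.
  by rewrite -[X in measurable X]setTI; exact: measurable_rV_coord.
by apply/seteqP; split=> [x Ax i _|x Ax i]; exact: Ax.
Qed.

Lemma measurable_rV_set1 d (x : 'rV[R]_d) : measurable [set x].
Proof.
rewrite (_ : [set x] = [set y : 'rV[R]_d | forall i, [set x ord0 i] (y ord0 i)]).
  exact: (@measurable_rV_set d (fun i => [set x ord0 i])).
by apply/seteqP; split=> [_ -> //|y /= yx]; apply/rowP.
Qed.

Let ball_lin (a b x y e : R) : b < e -> a <= x -> x < a + b -> a <= y -> y < a + b ->
  ball x e y.
Proof.
by move=> ? ? ? ? ?; rewrite -ball_normE/= ltr_norml; apply/andP; split; lra.
Qed.

(** The sigma-algebra is generated by the coordinates, the topology by the sup norm. An open set is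
    the countable union of the half-open grid cubes of side 1/(n+1), n ranging over the naturals,
    that it contains. *)
Lemma open_rV_measurable d (U : set 'rV[R]_d) : open U -> measurable U.
Proof.
move=> oU.
pose box (q : nat * 'rV[int]_d) := [set x : 'rV[R]_d | forall i,
  `[(q.2 ord0 i)%:~R / q.1.+1%:R, (q.2 ord0 i + 1)%:~R / q.1.+1%:R[%classic (x ord0 i)].
rewrite (_ : U = \bigcup_q (if pselect (box q `<=` U) then box q else set0)); last first.
  apply/seteqP; split=> [x Ux|x [q _]]; last by case: pselect => // h /h.
  have /nbhs_ballP[e /= e0 xeU] := open_nbhs_nbhs (conj oU Ux).
  have [n ne] : exists n, n.+1%:R^-1 < e.
    exists (Num.truncn e^-1); rewrite invf_plt ?posrE//.
    by rewrite -truncn_lt_nat// invr_ge0 ltW.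
  have n0 : 0 < n.+1%:R :> R by [].
  pose q := (n, \row_i Num.floor (x ord0 i * n.+1%:R)).
  have bx : box q x.
    move=> i /=; rewrite in_itv/= mxE ler_pdivrMr// ltr_pdivlMr//.
    by rewrite floor_le_tmp floorD1_gt.
  exists q => //; case: pselect => //; case=> y by_; apply: xeU; split => // i j.
  rewrite ord1; move: (bx j) (by_ j); rewrite /= !in_itv/= !mxE rmorphD/= mulrDl mul1r.
  by move=> /andP[h1 h2] /andP[h3 h4]; move: ne h1 h2 h3 h4; exact: ball_lin.
apply: countable_bigcupT_measurable => [|q]; first exact: countableP.
case: ifP => // _.
apply: (@measurable_rV_set d (fun i => `[(q.2 ord0 i)%:~R / q.1.+1%:R,
  (q.2 ord0 i + 1)%:~R / q.1.+1%:R[%classic)) => i.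
exact: measurable_itv.
Qed.

Lemma continuous_rV_measurable d (f : 'rV[R]_d -> R) : continuous f ->
  measurable_fun setT f.
Proof.
move=> /continuousP cf; apply: (measurability _ (RGenOpens.measurableE R)).
move=> _ [_ [a [b ->] <-]]; rewrite setTI; apply: open_rV_measurable.
exact/cf/interval_open.
Qed.

(** The measure in dimension d+1 is a pushforward under [rV_cons]; pulling the integrand back gives
    a tensor product on a product space. *)
Lemma intble_rV_cons d (F : R -> R) (H : 'rV[R]_d -> R) :
  intble (@lebesgue_measure R) F -> intble (lebesgue_rV R d) H ->
  intble (lebesgue_rV R d.+1) (fun x => F (rV_coord ord0 x) * H (rV_behead x)) /\
  \int[lebesgue_rV R d.+1]_x (F (rV_coord ord0 x) * H (rV_behead x)) =
  \int[@lebesgue_measure R]_s F s * \int[lebesgue_rV R d]_y H y.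
Proof.
move=> iF iH.
have mf : measurable_fun setT (fun x : 'rV[R]_d.+1 =>
    (F (rV_coord ord0 x) * H (rV_behead x))%:E).
  apply/measurable_EFinP/measurable_funM.
    exact: measurableT_comp (intble_meas iF) (@measurable_rV_entry _ ord0).
  exact: measurableT_comp (intble_meas iH) (@measurable_rV_behead R d).
have compE : (fun x : 'rV[R]_d.+1 => (F (rV_coord ord0 x) * H (rV_behead x))%:E) \o
    @rV_cons R d = (fun z => (F z.1 * H z.2)%:E).
  by apply/funext => z /=; rewrite /rV_coord rV_cons0 rV_consK.
have iFH := intble_prod iF iH.
have iFH' : (@lebesgue_measure R \x lebesgue_rV R d)%E.-integrable
    (@rV_cons R d @^-1` setT)
    ((fun x : 'rV[R]_d.+1 => (F (rV_coord ord0 x) * H (rV_behead x))%:E) \o @rV_cons R d).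
  by rewrite compE preimage_setT.
have mc : measurable_fun [set: measurableTypeR R * 'rV[R]_d] (@rV_cons R d).
  exact: (@measurable_rV_cons R d).
have h1 := @integrable_pushforward _ _ _ _ R _ mc (lebesgue_measure \x lebesgue_rV R d)%E setT _ mf iFH' measurableT.
split; first exact: h1.
have := integral_pushforward mc mf iFH' measurableT.
rewrite preimage_setT compE => h.
rewrite /Rintegral/= /rV_cons_measure h.
rewrite -/(Rintegral (lebesgue_measure \x lebesgue_rV R d)%E setT (fun z => F z.1 * H z.2)).
rewrite -(RI_prod iFH)/=.
under eq_Rintegral do rewrite RIZ//.
by rewrite RintegralZr.
Qed.

Lemma intble_rV0 (f : 'rV[R]_0 -> R) : intble (lebesgue_rV R 0) f /\
  \int[lebesgue_rV R 0]_x f x = f 0.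
Proof.
have mf : measurable_fun setT (EFin \o f).
  move=> _ Y _; rewrite setTI.
  have [[]|[]] : ((EFin \o f) @^-1` Y = setT) \/ ((EFin \o f) @^-1` Y = set0).
  - have [Y0|Y0] := pselect (Y (f 0)%:E); [left|right].
      by apply/seteqP; split=> // x _ /=; rewrite (_ : x = 0)//; apply/rowP; case.
    by apply/seteqP; split=> // x /=; rewrite (_ : x = 0)//; apply/rowP; case.
  - by move=> ->.
  - by move=> ->.
split.
  apply/integrableP; split => //=.
  rewrite integral_dirac//=; last first.
    by apply/measurable_EFinP/measurableT_comp => //; exact/measurable_EFinP.
  by rewrite diracT mul1e ltry.
by rewrite /Rintegral /= integral_dirac// diracT mul1e.
Qed.

Lemma intble_rV_prod d (F : 'I_d -> R -> R) :
  (forall i, intble (@lebesgue_measure R) (F i)) ->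
  intble (lebesgue_rV R d) (fun x => \prod_i F i (rV_coord i x)) /\
  \int[lebesgue_rV R d]_x (\prod_i F i (rV_coord i x)) =
  \prod_i \int[@lebesgue_measure R]_s F i s.
Proof.
elim: d F => [|d IH] F iF.
  have [h1 h2] := intble_rV0 (fun x => \prod_i F i (rV_coord i x)).
  by split => //; rewrite h2 !big_ord0.
have [h1 h2] := IH (fun i => F (lift ord0 i)) (fun i => iF _).
have [h3 h4] := intble_rV_cons (iF ord0) h1.
have E (x : 'rV[R]_d.+1) : \prod_i F i (rV_coord i x) =
    F ord0 (rV_coord ord0 x) *
       \prod_i F (lift ord0 i) (rV_coord i (rV_behead x)).
  rewrite big_ord_recl; congr (_ * _).
  by apply: eq_bigr => i _; rewrite /rV_coord mxE.
split; first by under eq_fun do rewrite E.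
by under eq_Rintegral do rewrite E; rewrite h4 h2 big_ord_recl.
Qed.

(** A pi-system generating the sigma-algebra, chosen because the indicator of an orthant is a
    product of one-variable indicators. *)
Definition orthants d := [set A : set 'rV[R]_d |
  exists a : 'rV[R]_d, A = [set x | forall i, a ord0 i < x ord0 i]].

Lemma measurable_orthants d :
  @measurable _ ('rV[R]_d) = <<s (@orthants d) >>.
Proof.
apply/seteqP; split; last first.
  apply: smallest_sub; first exact: sigma_algebra_measurable.
  move=> _ [a ->].
  have h := @measurable_rV_set d (fun i => `]a ord0 i, +oo[%classic)
    (fun i => measurable_itv _).
  apply: (eq_ind _ measurable h).
  by apply/seteqP; split=> x /= ax i; have := ax i; rewrite in_itv/= andbT.
pose T := g_sigma_algebraType (@orthants d).
have mcoord i : measurable_fun [set: T] (fun x : T => (x : 'rV[R]_d) ord0 i).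
  apply: (measurability _ (RGenOInfty.measurableE R)).
  move=> _ [_ [a ->] <-]; rewrite setTI.
  (* A half-space is the union over n of the orthants whose remaining corner coordinates are
     [- n]. *)
  rewrite (_ : _ @^-1` _ = \bigcup_n [set x : 'rV[R]_d |
      forall j, (if j == i then a else - n%:R) < x ord0 j]).
    apply: bigcupT_measurable => n; apply: sub_sigma_algebra.
    exists (\row_j if j == i then a else - n%:R).
    by apply/seteqP; split=> x xP j; have := xP j; rewrite mxE.
  apply/seteqP; split=> x /=; rewrite in_itv/= andbT; last first.
    by move=> [n _ /(_ i)]; rewrite eqxx.
  move=> ax; exists (Num.truncn `|x|).+1 => // j; case: eqP => [->//|_].
  rewrite ltrNl; apply: le_lt_trans (real_truncnS_gt (num_real _)).
  apply: le_trans (_ : `|x ord0 j| <= _); first by rewrite -normrN ler_norm.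
  rewrite [leRHS]/Num.norm/= mx_normrE.
  by apply/bigmax_geP; right; exists (ord0, j).
apply: smallest_sub; first exact: smallest_sigma_algebra.
rewrite -bigcup_seq/= => A [i _ [B mB <-]].
exact: mcoord.
Qed.

Lemma orthants_setI d : setI_closed (@orthants d).
Proof.
move=> _ _ [a ->] [b ->]; exists (\row_i Num.max (a ord0 i) (b ord0 i)).
apply/seteqP; split=> x /=.
  by move=> [ax bx] i; rewrite mxE gt_max ax bx.
by move=> h; split=> i; have := h i; rewrite mxE gt_max => /andP[].
Qed.

End rV_measure_theory.

(** * Integrals that do not depend on a parameter *)

Section constant_integral.
Context (R : realType).
Notation mu := (@lebesgue_measure R).

Lemma RI_itv_cvg (k : R -> R) : intble mu k ->
  \int[mu]_(y in `[- n%:R, n%:R]) k y @[n --> \oo] --> \int[mu]_y k y.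
Proof.
move=> ki; have mk := intble_meas ki.
under eq_fun do rewrite Rintegral_mkcond.
apply: (@RI_dct _ _ _ mu _ _ (fun y => `|k y|) _ mk (intble_norm ki) _ _).2.
- by move=> n; apply: (measurable_restrictT _ _).1 => //; exact: measurable_funTS.
- by move=> n x; rewrite patchE; case: ifP => // _; rewrite normr0.
apply: aeW => y; apply: cvg_near_cst; near=> n.
rewrite patchE ifT// inE/= in_itv/= -ler_norml.
near: n; exists (Num.truncn `|y|).+1 => // n /= yn.
by apply: le_trans (ltW (truncnS_gt _)) _; rewrite ler_nat.
Unshelve. all: by end_near. Qed.

(* When d/dx h = d/dy Psi, the x-derivative of the integral of h in y is a
   boundary term of Psi at infinity *)
Lemma constant_integral (h k Psi : R -> R -> R) :
  (forall x y, is_derive x (1:R) (h ^~ y) (k x y)) ->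
  (forall x y, is_derive y (1:R) (Psi x) (k x y)) ->
  (forall x, continuous (k x)) ->
  (forall x, intble mu (h x)) ->
  (forall M : R, exists2 G, intble mu G &
    forall x y, `|x| < M -> `|k x y| <= G y) ->
  (forall x, (Psi x n%:R - Psi x (- n%:R)) @[n --> \oo] --> (0 : R)) ->
  forall x, \int[mu]_y h x y = \int[mu]_y h 0 y.
Proof.
move=> hk Pk ck hi kG P0.
have k0 x : \int[mu]_y k x y = 0.
  have [G iG kx] := kG (`|x| + 1).
  have ki : intble mu (k x).
    apply: intble_le iG; first exact: continuous_measurable_fun.
    by move=> y; apply: kx; rewrite ltrDl.
  rewrite -(cvg_lim (@Rhausdorff R) (RI_itv_cvg ki)); apply: cvg_lim => //.
  (* The fundamental theorem of calculus is applied on [-n, n], which must be nondegenerate: hence n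
     at least 1. *)
  apply: cvg_trans (P0 x); apply: near_eq_cvg; exists 1%N => // n /= n0.
  rewrite /Rintegral (continuous_FTC2 (F := Psi x))//.
  - by rewrite -subr_gt0 opprK addr_gt0// ltr0n.
  - by apply: continuous_subspaceT; exact: ck.
  - have cP y : Psi x @ y --> Psi x y.
      by apply: differentiable_continuous; apply/derivable1_diffP; exact: ex_derive.
    by split=> [y _||]; [exact: ex_derive|exact: cvg_at_right_filter|
      exact: cvg_at_left_filter].
  - by move=> y _; rewrite derive1E; exact: derive_val.
move=> x; apply: (@is_derive_0_is_cst R (fun x => \int[mu]_y h x y)) => a.
have Ia : `]- (`|a| + 1), `|a| + 1[%classic a.
  rewrite /= in_itv/= -ltr_norml ltrDl//.
have [G iG kx] := kG (`|a| + 1).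
have iG' := intble_norm iG.
have hd : forall x y, `]- (`|a| + 1), `|a| + 1[%classic x -> setT y ->
    derivable (h ^~ y) x 1.
  by move=> b y _ _; exact: ex_derive.
have d1E b y : partial1of2 h b y = k b y.
  by rewrite partial1of2E; exact: derive_val.
have Gub : forall x y, `]- (`|a| + 1), `|a| + 1[%classic x -> setT y ->
    `|partial1of2 h x y| <= `|G y|.
  move=> b y /=; rewrite in_itv/= -ltr_norml d1E => /kx bG _.
  exact: le_trans (bG y) (ler_norm _).
have D := derivable_under_integral measurableT Ia (fun x _ => hi x) hd
  (fun y => normr_ge0 (G y)) iG' Gub.
have E := differentiation_under_integral measurableT Ia (fun x _ => hi x) hd
  (fun y => normr_ge0 (G y)) iG' Gub.
apply: DeriveDef => //; rewrite -derive1E E.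
by under eq_Rintegral do rewrite d1E.
Qed.

End constant_integral.

(** * Gaussian kernels *)

Section gaussian_line.
Context (R : realType).
Notation mu := (@lebesgue_measure R).
Implicit Types u w x y : R.

(** Variance 2u makes this the heat kernel of the second derivative at time u, namely (4 pi
    u)^{-1/2} exp(-x^2/(4u)). *)
Definition heat_line u x : R := normal_pdf 0 (Num.sqrt (2 * u)) x.

Lemma heat_lineE u x : 0 < u ->
  heat_line u x = (Num.sqrt (4 * u * pi))^-1 * expR (- (x ^+ 2 / (4 * u))).
Proof.
move=> u0; have s0 : Num.sqrt (2 * u) != 0 by rewrite gt_eqF// sqrtr_gt0 mulr_gt0.
rewrite /heat_line normal_pdfE// /normal_peak /normal_fun sqr_sqrtr ?mulr_ge0 ?ltW//.
by rewrite subr0; congr ((Num.sqrt _)^-1 * expR _); [ring|rewrite mulNr; congr (- (_ / _)); ring].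
Qed.

Lemma heat_line_int u x : 0 < u ->
  intble mu (fun s => heat_line u (x - s)) /\ \int[mu]_s heat_line u (x - s) = 1.
Proof.
move=> u0; have E s : heat_line u (x - s) = normal_pdf x (Num.sqrt (2 * u)) s.
  rewrite heat_lineE// normal_pdfE; last by rewrite gt_eqF// sqrtr_gt0 mulr_gt0.
  rewrite /normal_peak /normal_fun sqr_sqrtr ?mulr_ge0 ?ltW//.
  by congr ((Num.sqrt _)^-1 * expR _); [ring|rewrite mulNr; congr (- (_ / _)); ring].
have [h1 h2] : intble mu (normal_pdf x (Num.sqrt (2 * u))) /\
    \int[mu]_s normal_pdf x (Num.sqrt (2 * u)) s = 1.
  by split; [exact: integrable_normal_pdf|rewrite /Rintegral integral_normal_pdf].
split; first by under eq_fun do rewrite E.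
by under eq_Rintegral do rewrite E.
Qed.

(** Up to a factor, exp(-u y^2) is the heat kernel at time 1/(4u), whose total mass is 1. *)
Lemma gauss_line_int u : 0 < u ->
  intble mu (fun y => expR (- (u * y ^+ 2))) /\
  \int[mu]_y expR (- (u * y ^+ 2)) = Num.sqrt (pi / u).
Proof.
move=> u0; have u40 : 0 < (4 * u)^-1 by rewrite invr_gt0 mulr_gt0.
have E y : expR (- (u * y ^+ 2)) = Num.sqrt (pi / u) * heat_line (4 * u)^-1 (0 - y).
  rewrite heat_lineE// sub0r sqrrN (_ : 4 * (4 * u)^-1 = u^-1); last by field; rewrite gt_eqF.
  rewrite [RHS]mulrA (_ : Num.sqrt (pi / u) * _ = 1) ?mul1r; first by congr expR; field; rewrite gt_eqF.
  by rewrite mulrC (mulrC pi) mulVf// gt_eqF// sqrtr_gt0 mulr_gt0 ?invr_gt0 ?pi_gt0.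
have [h1 h2] := heat_line_int 0 u40.
split; first by under eq_fun do rewrite E; exact: intbleZ.
by under eq_Rintegral do rewrite E; rewrite RIZ// h2 mulr1.
Qed.

Lemma heat_line_ge0 u x : 0 <= heat_line u x.
Proof. exact: normal_pdf_ge0. Qed.

(** The factor exp(x^2/(4u)) compensates the expected transform exp(-x^2/(4u)) of the Gaussian, so
    that the integrals of E cos(xy) and E sin(xy) in y become constant in x. *)
Let E u x y := expR (x ^+ 2 / (4 * u) - u * y ^+ 2).

Let E_cvg u x (c : R) : 0 < u ->
  c * E u x n%:R @[n --> \oo] --> (0 : R).
Proof.
move=> u0; rewrite /E -(mulr0 c); apply: cvgMr.
under eq_fun do rewrite expRD.
rewrite -(mulr0 (expR (x ^+ 2 / (4 * u)))); apply: cvgMr.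
apply: (@cvg_comp _ _ _ (fun n : nat => u * n%:R ^+ 2) (fun t : R => expR (- t)) _ (+oo%R)).
  apply/cvgryPge => A; exists (Num.truncn (A / u)).+1 => // n /= An.
  rewrite -ler_pdivrMl// mulrC; apply: (le_trans (ltW (truncnS_gt _))).
  apply: le_trans (_ : n%:R <= _); first by rewrite ler_nat.
  by rewrite expr2 -natrM ler_nat leq_pmulr// (leq_trans _ An).
exact: cvgr_expR.
Qed.

(** Integrable domination of the x-derivatives, uniform for |x| < M: half of the Gaussian absorbs
    the linear factor. *)
Let E_bound u (M : R) : 0 < u -> exists2 G, intble mu G & forall x y, `|x| < M ->
  E u x y * (`|x| / (2 * u) + `|y|) <= G y.
Proof.
move=> u0; have u20 : 0 < u / 2 by rewrite divr_gt0.
(* The constant 1 + 2/u is such that (1 + 2/u)(1 + u y^2/2) expands to a sum containing 1 + y^2,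
   which dominates |y|; then 1 + u y^2/2 <= exp(u y^2/2). *)
pose C := expR (M ^+ 2 / (4 * u)) * (M / (2 * u) + (1 + 2 / u)).
exists (fun y => C * expR (- (u / 2 * y ^+ 2))); first exact/intbleZ/(gauss_line_int u20).1.
move=> x y xM; have M0 : 0 < M by exact: le_lt_trans xM.
have e1 := expR_ge1Dx (u / 2 * y ^+ 2).
have xy : `|x| / (2 * u) + `|y| <= (M / (2 * u) + (1 + 2 / u)) * expR (u / 2 * y ^+ 2).
  rewrite [leRHS]mulrDl; apply: lerD.
    rewrite -[leLHS]mulr1 ler_pM ?divr_ge0 ?mulr_ge0 ?(ltW u0)//.
      by rewrite ler_pM2r ?invr_gt0 ?mulr_gt0// ltW.
    by apply: le_trans e1; rewrite lerDl mulr_ge0 ?sqr_ge0 ?ltW.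
  apply: (@le_trans _ _ ((1 + 2 / u) * (1 + u / 2 * y ^+ 2))); last first.
    by rewrite ler_pM2l// addr_gt0// divr_gt0.
  have -> : (1 + 2 / u) * (1 + u / 2 * y ^+ 2) = 1 + y ^+ 2 + 2 / u + u / 2 * y ^+ 2.
    by field; rewrite gt_eqF.
  have := sqr_ge0 (`|y| - 1); rewrite sqrrB1 real_normK ?num_real// => h.
  have h1 : 0 <= 2 / u by rewrite divr_ge0// ltW.
  have h2 : 0 <= u / 2 * y ^+ 2 by rewrite mulr_ge0 ?sqr_ge0 ?ltW.
  have h3 := normr_ge0 y.
  by move: h; rewrite -mulr_natl; lra.
rewrite /E expRD; apply: (@le_trans _ _ (expR (M ^+ 2 / (4 * u)) * expR (- (u * y ^+ 2)) *
  ((M / (2 * u) + (1 + 2 / u)) * expR (u / 2 * y ^+ 2)))).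
  apply: ler_pM => //.
  - by rewrite addr_ge0// divr_ge0// mulr_ge0// ltW.
  rewrite ler_pM2r ?expR_gt0// ler_expR ler_pM2r ?invr_gt0 ?mulr_gt0//.
  rewrite -[x ^+ 2]real_normK ?num_real//.
  by rewrite ler_pXn2r ?nnegrE ?(ltW M0)// ltW.
rewrite le_eqVlt; apply/orP; left; apply/eqP.
rewrite /C (_ : - (u / 2 * y ^+ 2) = - (u * y ^+ 2) + u / 2 * y ^+ 2); last by field.
by rewrite expRD; ring.
Qed.

Let cont_k (f g : R -> R) u x (c : R) : continuous f -> continuous g ->
  continuous (fun y => E u x y * (c * f (x * y) + y * g (x * y))).
Proof.
move=> cf cg y.
have cxy : x * y0 @[y0 --> y] --> x * y by apply: cvgMr; exact: cvg_id.
apply: cvgM.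
  apply: continuous_comp; last exact: continuous_expR.
  apply: cvgB; first exact: cvg_cst.
  by apply: cvgMr; exact: exprn_continuous.
apply: cvgD.
  by apply: cvgMr; apply: (continuous_comp cxy); exact: cf.
by apply: cvgM; [exact: cvg_id|apply: (continuous_comp cxy); exact: cg].
Qed.

Let intE u x (f : R -> R) : 0 < u -> continuous f -> (forall s, `|f s| <= 1) ->
  intble mu (fun y => E u x y * f (x * y)).
Proof.
move=> u0 cf f1 /=; apply: (intble_le _ _ (intbleZ (expR (x ^+ 2 / (4 * u))) (gauss_line_int u0).1)).
- apply: continuous_measurable_fun => y; apply: cvgM.
    apply: continuous_comp; last exact: continuous_expR.
    apply: cvgB; first exact: cvg_cst.
    by apply: cvgMr; exact: exprn_continuous.
  apply: continuous_comp; last exact: cf.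
  by apply: cvgMr; exact: cvg_id.
- move=> y; rewrite normrM ger0_norm ?expR_ge0// /E expRD ler_piMr// ?mulr_ge0 ?expR_ge0//.
Qed.

Let dE u x y : u != 0 -> is_derive x (1:R) (fun x => E u x y) (x / (2 * u) * E u x y).
Proof.
move=> u0; apply: is_derive_eq.
by rewrite /E ?scaler0 /GRing.scale/=; field.
Qed.

Let dE' u x y : is_derive y (1:R) (fun y => E u x y) (- (2 * u * y) * E u x y).
Proof.
rewrite (_ : (fun y => E u x y) = (fun y => expR (x ^+ 2 / (4 * u) - y ^+ 2 * u))).
  by apply: is_derive_eq; rewrite /E (mulrC u) ?scaler0 /GRing.scale/=; ring.
by apply/funext => z; rewrite /E (mulrC u).
Qed.

Let dcos c x : is_derive x (1:R) (fun x => cos (x * c)) (- (c * sin (x * c))).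
Proof. by apply: is_derive_eq; rewrite ?scaler0 /GRing.scale/=; ring. Qed.

Let dsin c x : is_derive x (1:R) (fun x => sin (x * c)) (c * cos (x * c)).
Proof. by apply: is_derive_eq; rewrite ?scaler0 /GRing.scale/=; ring. Qed.

Let dcos' c x : is_derive x (1:R) (fun x => cos (c * x)) (- (c * sin (c * x))).
Proof.
by under eq_fun do rewrite mulrC; rewrite (mulrC c x); exact: dcos.
Qed.

Let dsin' c x : is_derive x (1:R) (fun x => sin (c * x)) (c * cos (c * x)).
Proof.
by under eq_fun do rewrite mulrC; rewrite (mulrC c x); exact: dsin.
Qed.

Let Psi_cvg u x (K : R) (f : R -> R) : 0 < u -> (forall s, `|f s| <= K) ->
  (E u x n%:R * f n%:R - E u x (- n%:R) * f (- n%:R)) @[n --> \oo] --> (0 : R).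
Proof.
move=> u0 f1; apply/norm_cvg0P.
apply: (@squeeze_cvgr _ _ _ _ (fun=> 0) (fun n => 2 * K * E u x n%:R)).
- apply: nearW => n; rewrite normr_ge0/= (le_trans (ler_normB _ _))//.
  rewrite (_ : E u x (- n%:R) = E u x n%:R); last by rewrite /E sqrrN.
  rewrite !normrM !(ger0_norm (expR_ge0 _)) -mulrA (mulr_natl (K * _)) mulr2n.
  by apply: lerD; rewrite mulrC ler_wpM2r// expR_ge0.
- exact: cvg_cst.
- exact: E_cvg.
Qed.

Let E0 u w y : u != 0 -> expR (- (u * y ^+ 2)) = expR (- (w ^+ 2 / (4 * u))) * E u w y.
Proof.
by move=> u0; rewrite -expRD; congr expR; rewrite addrA addNr add0r.
Qed.

(** [constant_integral] applies with [Psi] = E sin(xy)/(2u), whose y-derivative is the x-derivative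
    of E cos(xy). At x = 0 what remains is the Gaussian integral. *)
Lemma gauss_cos u w : 0 < u ->
  intble mu (fun y => expR (- (u * y ^+ 2)) * cos (w * y)) /\
  \int[mu]_y (expR (- (u * y ^+ 2)) * cos (w * y)) = 2 * pi * heat_line u w.
Proof.
move=> u0; have u0' : u != 0 by rewrite gt_eqF.
have iE x := intE x u0 (@continuous_cos R) (@cos_max R).
split; first by under eq_fun do rewrite (E0 w)// -mulrA; exact: intbleZ.
under eq_Rintegral do rewrite (E0 w)// -mulrA.
rewrite RIZ//.
have CI : forall x, \int[mu]_y (E u x y * cos (x * y)) = \int[mu]_y (E u 0 y * cos (0 * y)).
  apply: (@constant_integral _ (fun x y => E u x y * cos (x * y))
  (fun x y => E u x y * (x / (2 * u) * cos (x * y) + y * - sin (x * y)))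
  (fun x y => E u x y * (sin (x * y) / (2 * u)))).
  - move=> x y; have := dE x y u0'; have := dcos y x => d1 d2.
    apply: is_derive_eq; rewrite /GRing.scale/=; ring.
  - move=> x y; have := dE' u x y; have := dsin' x y => d1 d2.
    by apply: is_derive_eq; rewrite ?scaler0 /GRing.scale/=; field.
  - move=> x; apply: (@cont_k cos (fun s => - sin s)); first exact: continuous_cos.
    by move=> s; apply: cvgN; exact: continuous_sin.
  - exact: iE.
  - move=> M; have [G iG GE] := E_bound M u0; exists G => // x y xM.
    apply: le_trans (GE _ y xM); rewrite normrM ger0_norm ?expR_ge0//.
    rewrite ler_pM2l ?expR_gt0// (le_trans (ler_normD _ _))// !normrM normrN.
    rewrite (ger0_norm (_ : 0 <= (2 * u)^-1)) ?invr_ge0 ?mulr_ge0 ?(ltW u0)//.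
    by apply: lerD; rewrite ler_piMr ?divr_ge0 ?mulr_ge0 ?(ltW u0)// ?cos_max ?sin_max.
  - move=> x; apply: (@Psi_cvg u x (2 * u)^-1 (fun y => sin (x * y) / (2 * u))) => // s.
    rewrite normrM (ger0_norm (_ : 0 <= (2 * u)^-1)) ?invr_ge0 ?mulr_ge0 ?(ltW u0)//.
    by rewrite ler_piMl ?invr_ge0 ?mulr_ge0 ?(ltW u0)// ?cos_max ?sin_max.
rewrite CI.
under eq_Rintegral do rewrite /E expr0n/= !mul0r add0r cos0 mulr1.
rewrite (gauss_line_int u0).2 heat_lineE// mulrA [RHS]mulrC; congr (_ * _).
rewrite (_ : 4 * u * pi = (2 * u) ^+ 2 * (pi / u)); last by field.
rewrite [Num.sqrt (_ ^+ 2 * _)]sqrtrM ?sqr_ge0// sqrtr_sqr gtr0_norm ?mulr_gt0//.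
have s0 : Num.sqrt (pi / u) != 0 by rewrite gt_eqF// sqrtr_gt0 divr_gt0 ?pi_gt0.
apply: (mulIf s0); rewrite -expr2 sqr_sqrtr ?divr_ge0 ?pi_ge0 ?ltW//.
by field; rewrite s0.
Qed.

(** The same argument with [Psi] = - E cos(xy)/(2u); at x = 0 the integrand vanishes. *)
Lemma gauss_sin u w : 0 < u ->
  intble mu (fun y => expR (- (u * y ^+ 2)) * sin (w * y)) /\
  \int[mu]_y (expR (- (u * y ^+ 2)) * sin (w * y)) = 0.
Proof.
move=> u0; have u0' : u != 0 by rewrite gt_eqF.
have iE x := intE x u0 (@continuous_sin R) (@sin_max R).
split; first by under eq_fun do rewrite (E0 w)// -mulrA; exact: intbleZ.
under eq_Rintegral do rewrite (E0 w)// -mulrA.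
rewrite RIZ//.
have CI : forall x, \int[mu]_y (E u x y * sin (x * y)) = \int[mu]_y (E u 0 y * sin (0 * y)).
  apply: (@constant_integral _ (fun x y => E u x y * sin (x * y))
  (fun x y => E u x y * (x / (2 * u) * sin (x * y) + y * cos (x * y)))
  (fun x y => E u x y * (- cos (x * y) / (2 * u)))).
  - move=> x y; have := dE x y u0'; have := dsin y x => d1 d2.
    by apply: is_derive_eq; rewrite /GRing.scale/=; ring.
  - move=> x y; have := dE' u x y; have := dcos' x y => d1 d2.
    by apply: is_derive_eq; rewrite ?scaler0 /GRing.scale/=; field.
  - by move=> x; apply: cont_k; [exact: continuous_sin|exact: continuous_cos].
  - exact: iE.
  - move=> M; have [G iG GE] := E_bound M u0; exists G => // x y xM.
    apply: le_trans (GE _ y xM); rewrite normrM ger0_norm ?expR_ge0//.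
    rewrite ler_pM2l ?expR_gt0// (le_trans (ler_normD _ _))// !normrM.
    rewrite (ger0_norm (_ : 0 <= (2 * u)^-1)) ?invr_ge0 ?mulr_ge0 ?(ltW u0)//.
    by apply: lerD; rewrite ler_piMr ?divr_ge0 ?mulr_ge0 ?(ltW u0)// ?cos_max ?sin_max.
  - move=> x; apply: (@Psi_cvg u x (2 * u)^-1 (fun y => - cos (x * y) / (2 * u))) => // s.
    rewrite normrM normrN (ger0_norm (_ : 0 <= (2 * u)^-1)) ?invr_ge0 ?mulr_ge0 ?(ltW u0)//.
    by rewrite ler_piMl ?invr_ge0 ?mulr_ge0 ?(ltW u0)// ?cos_max ?sin_max.
rewrite CI.
by under eq_Rintegral do rewrite mul0r sin0 mulr0; rewrite RI0 mulr0.
Qed.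

End gaussian_line.

(** * The Gaussian approximate identity on the line *)

Section approximate_identity_line.
Context (R : realType).
Notation mu := (@lebesgue_measure R).

(** Times tending to 0 along which the heat kernels approximate the identity. *)
Definition harm (n : nat) : R := n.+1%:R^-1.

Lemma harm_gt0 n : 0 < harm n. Proof. by rewrite invr_gt0. Qed.

Lemma measurable_heat_line u : measurable_fun setT (@heat_line R u).
Proof. exact: measurable_normal_pdf. Qed.

Lemma heat_lineN u (x : R) : 0 < u -> heat_line u (- x) = heat_line u x.
Proof. by move=> u0; rewrite !heat_lineE// sqrrN. Qed.

Lemma heat_line_ub u (x : R) : 0 < u -> heat_line u x <= (Num.sqrt (4 * u * pi))^-1.
Proof.
move=> u0; rewrite heat_lineE// ler_piMr// ?invr_ge0 ?sqrtr_ge0//.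
by rewrite -expR0 ler_expR oppr_le0 divr_ge0 ?sqr_ge0 ?mulr_ge0 ?(ltW u0).
Qed.

Lemma continuous_heat_line u : 0 < u -> continuous (@heat_line R u).
Proof.
by move=> u0; apply: continuous_normal_pdf; rewrite gt_eqF// sqrtr_gt0 mulr_gt0.
Qed.

(** At distance at least delta, half of the exponent yields the small factor exp(-delta^2/(8u)); the
    other half is the kernel at time 2u, and sqrt 2 is the ratio of the normalisations. *)
Lemma heat_line_tail (u delta z : R) : 0 < u -> 0 < delta -> delta <= `|z| ->
  heat_line u z <= Num.sqrt 2 * expR (- (delta ^+ 2 / (8 * u))) * heat_line (2 * u) z.
Proof.
move=> u0 d0 dz; have u20 : 0 < 2 * u by rewrite mulr_gt0.
rewrite !heat_lineE// (_ : 4 * (2 * u) * pi = 2 * (4 * u * pi)); last by ring.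
rewrite (sqrtrM (4 * u * pi))// [(Num.sqrt 2 * _)^-1]invfM.
have s20 : Num.sqrt 2 != 0 :> R by rewrite gt_eqF// sqrtr_gt0.
rewrite (_ : Num.sqrt 2 * _ * (_ * _) = (Num.sqrt (4 * u * pi))^-1 *
  (expR (- (delta ^+ 2 / (8 * u))) * expR (- (z ^+ 2 / (4 * (2 * u)))))); last first.
  have s40 : Num.sqrt (4 * u * pi) != 0 by rewrite gt_eqF// sqrtr_gt0 !mulr_gt0 ?pi_gt0.
  by field; rewrite s20 s40.
rewrite ler_wpM2l ?invr_ge0 ?sqrtr_ge0// -expRD ler_expR.
have : delta ^+ 2 <= z ^+ 2.
  by rewrite -[z ^+ 2]real_normK ?num_real// ler_pXn2r ?nnegrE ?(ltW d0).
rewrite -(ler_pM2r (_ : 0 < (8 * u)^-1)); last by rewrite invr_gt0 mulr_gt0.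
have -> : z ^+ 2 / (4 * u) = z ^+ 2 / (8 * u) + z ^+ 2 / (8 * u) by field; rewrite gt_eqF.
have -> : 4 * (2 * u) = 8 * u by ring.
lra.
Qed.

(** Within delta of x continuity bounds the error; beyond, the tail bound does, and the kernel at
    twice the time still has mass 1. *)
Lemma heat_line_approx (f : R -> R) (K x : R) : measurable_fun setT f ->
  (forall s, `|f s| <= K) -> {for x, continuous f} ->
  (forall n, intble mu (fun s => heat_line (harm n) (x - s) * f s)) /\
  \int[mu]_s (heat_line (harm n) (x - s) * f s) @[n --> \oo] --> f x.
Proof.
move=> mf fK cf.
have hi n := (heat_line_int x (harm_gt0 n)).1.
have hi2 n : intble mu (fun s => heat_line (2 * harm n) (x - s)).
  by apply: (heat_line_int x _).1; rewrite mulr_gt0 ?harm_gt0.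
have mf' : measurable_fun [set: measurableTypeR R] f := mf.
have fi n : intble mu (fun s => heat_line (harm n) (x - s) * f s).
  by under eq_fun do rewrite mulrC; exact: intble_bdM mf' fK (hi n).
split => //; apply/cvgrPdist_le => e e0.
have K0 : 0 <= K by apply: le_trans (fK 0).
move/cvgrPdist_le : cf => /(_ (e / 2)); rewrite divr_gt0// => /(_ isT).
move=> /nbhs_ballP[delta /= d0 fd].
(* Weight of the far region: 2K bounds |f x - f s|, the rest is the factor from [heat_line_tail]. *)
pose c n := 2 * K * (Num.sqrt 2 * expR (- (delta ^+ 2 / (8 * harm n)))).
have cvgc : c n @[n --> \oo] --> (0 : R).
  rewrite -(mulr0 (2 * K)); apply: cvgMr; rewrite -(mulr0 (Num.sqrt 2)); apply: cvgMr.
  apply: (@cvg_comp _ _ _ (fun n => delta ^+ 2 / (8 * harm n)) (fun t : R => expR (- t)) _ (+oo%R)); last exact: cvgr_expR.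
  apply/cvgryPge => A; exists (Num.truncn (A * 8 / delta ^+ 2)).+1 => // n /= An.
  rewrite /harm invfM invrK mulrA mulrC -ler_pdivrMr; last by rewrite divr_gt0// exprn_gt0.
  rewrite invfM invrK mulrCA mulrC; apply: (le_trans (ltW (truncnS_gt _))).
  by rewrite ler_nat (leq_trans An).
move/cvgrPdist_le : cvgc => /(_ (e / 2)); rewrite divr_gt0// => /(_ isT)[N _ cN].
exists N => // n /cN; rewrite sub0r normrN => cn.
have -> : f x = \int[mu]_s (f x * heat_line (harm n) (x - s)).
  by rewrite RIZ// (heat_line_int x (harm_gt0 n)).2 mulr1.
rewrite -RIB//; last exact: intbleZ.
apply: le_trans (RI_norm _) _; first by apply: intbleB => //; exact: intbleZ.
apply: (@le_trans _ _ (\int[mu]_s (e / 2 * heat_line (harm n) (x - s) +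
   c n * heat_line (2 * harm n) (x - s)))); last first.
  rewrite RID; [|exact: intbleZ..].
  rewrite !RIZ// (heat_line_int x (harm_gt0 n)).2.
  rewrite (heat_line_int x (_ : 0 < 2 * harm n)).2; last by rewrite mulr_gt0 ?harm_gt0.
  by have := ler_norm (c n); lra.
apply: RI_le.
- by apply: intble_norm; apply: intbleB => //; exact: intbleZ.
- by apply: intbleD; exact: intbleZ.
move=> s; rewrite mulrC -mulrBr normrM ger0_norm ?heat_line_ge0//.
have h0 := heat_line_ge0 (harm n) (x - s).
have h20 := heat_line_ge0 (2 * harm n) (x - s).
have [sd|ds] := ltP `|x - s| delta.
  have h : `|f x - f s| <= e / 2 by apply: fd; rewrite -ball_normE.
  rewrite -[leLHS]addr0; apply: lerD; first by rewrite mulrC ler_wpM2r.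
  by rewrite mulr_ge0// /c !mulr_ge0 ?expR_ge0 ?sqrtr_ge0.
rewrite -[leLHS]add0r; apply: lerD; first by rewrite mulr_ge0// divr_ge0// ltW.
rewrite mulrC /c -mulrA; apply: ler_pM => //.
  by rewrite (le_trans (ler_normB _ _))// mulr_natl mulr2n; apply: lerD.
exact: heat_line_tail (harm_gt0 n) d0 ds.
Qed.

End approximate_identity_line.

(** * Gaussians on R^d and their Fourier transforms *)

Section gaussian_rV.
Context (R : realType).
Implicit Types d : nat.

Definition gauss_rV d (u : R) (y : 'rV[R]_d) : R := expR (- (u * dotv y y)).

Definition heat_rV d (u : R) (x : 'rV[R]_d) : R := \prod_i heat_line u (x ord0 i).

Lemma gauss_rV_prod d u (y : 'rV[R]_d) :
  gauss_rV u y = \prod_i expR (- (u * rV_coord i y ^+ 2)).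
Proof.
rewrite /gauss_rV /dotv mulr_sumr -sumrN.
by rewrite (big_morph expR (@expRD R) (@expR0 R)).
Qed.

Lemma gauss_rV_gt0 d u (y : 'rV[R]_d) : 0 < gauss_rV u y.
Proof. exact: expR_gt0. Qed.

Lemma gauss_rV_le1 d u (y : 'rV[R]_d) : 0 <= u -> gauss_rV u y <= 1.
Proof. by move=> u0; rewrite -expR0 ler_expR oppr_le0 mulr_ge0// dotv_ge0. Qed.

Lemma measurable_gauss_rV d u : measurable_fun setT (@gauss_rV d u).
Proof.
apply: measurableT_comp => //; apply: measurableT_comp => //.
by apply: measurable_funM => //; exact: measurable_dotv.
Qed.

Lemma heat_rV_ge0 d u (x : 'rV[R]_d) : 0 <= heat_rV u x.
Proof. by apply: prodr_ge0 => i _; exact: heat_line_ge0. Qed.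

Lemma measurable_heat_rV d u : measurable_fun setT (@heat_rV d u).
Proof.
apply: measurable_prod => i _.
exact: measurableT_comp (measurable_heat_line u) (@measurable_rV_entry _ d i).
Qed.

Lemma heat_rV_int d u (x : 'rV[R]_d) : 0 < u ->
  intble (lebesgue_rV R d) (fun y => heat_rV u (x - y)) /\
  \int[lebesgue_rV R d]_y heat_rV u (x - y) = 1.
Proof.
move=> u0; have E y : heat_rV u (x - y) = \prod_i heat_line u (x ord0 i - rV_coord i y).
  by apply: eq_bigr => i _; rewrite !mxE.
have [h1 h2] := intble_rV_prod (fun i => (heat_line_int (x ord0 i) u0).1).
split; first by under eq_fun do rewrite E.
under eq_Rintegral do rewrite E.
by rewrite h2 big1// => i _; rewrite (heat_line_int _ u0).2.
Qed.

Lemma heat_rVN d u (x : 'rV[R]_d) : 0 < u -> heat_rV u (- x) = heat_rV u x.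
Proof. by move=> u0; apply: eq_bigr => i _; rewrite mxE heat_lineN. Qed.

Lemma heat_rV_ub d u (x : 'rV[R]_d) : 0 < u ->
  heat_rV u x <= (Num.sqrt (4 * u * pi))^-1 ^+ d.
Proof.
move=> u0; rewrite -[in leRHS](card_ord d) -prodr_const.
by apply: ler_prod => i _; rewrite heat_line_ge0 heat_line_ub.
Qed.

Lemma intble_gauss_rV d u : 0 < u -> intble (lebesgue_rV R d) (gauss_rV u).
Proof.
move=> u0; under eq_fun do rewrite gauss_rV_prod.
exact: (intble_rV_prod (fun i => (gauss_line_int u0).1)).1.
Qed.

Let gauss_osc_int d u (f : 'rV[R]_d -> R) : 0 < u -> measurable_fun setT f ->
  (forall y, `|f y| <= 1) -> intble (lebesgue_rV R d) (fun y => gauss_rV u y * f y).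
Proof.
move=> u0 mf f1; under eq_fun do rewrite mulrC.
exact: intble_bdM mf f1 (intble_gauss_rV d u0).
Qed.

Lemma measurable_cosR : measurable_fun setT (@cos R).
Proof. apply: continuous_measurable_fun; exact: continuous_cos. Qed.

Lemma measurable_sinR : measurable_fun setT (@sin R).
Proof. apply: continuous_measurable_fun; exact: continuous_sin. Qed.

Let mcos d (w : 'rV[R]_d) : measurable_fun setT (fun y : 'rV[R]_d => cos (dotv w y)).
Proof. apply: measurableT_comp measurable_cosR _; exact: measurable_dotv. Qed.

Let msin d (w : 'rV[R]_d) : measurable_fun setT (fun y : 'rV[R]_d => sin (dotv w y)).
Proof. apply: measurableT_comp measurable_sinR _; exact: measurable_dotv. Qed.

(** Cosine and sine are treated together because splitting off one coordinate in the induction mixes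
    them through the addition formulas. *)
Lemma gauss_rV_ft d u (w : 'rV[R]_d) : 0 < u ->
  \int[lebesgue_rV R d]_y (gauss_rV u y * cos (dotv w y)) =
    (2 * pi) ^+ d * heat_rV u w /\
  \int[lebesgue_rV R d]_y (gauss_rV u y * sin (dotv w y)) = 0.
Proof.
move=> u0; elim: d w => [|d IH] w.
  rewrite !(intble_rV0 _).2 /gauss_rV /dotv /heat_rV !big_ord0.
  by rewrite mulr0 oppr0 expR0 cos0 sin0 !mulr1 mulr0.
have [IHc IHs] := IH (rV_behead w).
have dotS (x y : 'rV[R]_d.+1) : dotv x y =
    rV_coord ord0 x * rV_coord ord0 y + dotv (rV_behead x) (rV_behead y).
  by rewrite /dotv big_ord_recl; congr (_ + _); apply: eq_bigr => i _; rewrite !mxE.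
have gS (y : 'rV[R]_d.+1) : gauss_rV u y =
    expR (- (u * rV_coord ord0 y ^+ 2)) * gauss_rV u (rV_behead y).
  by rewrite /gauss_rV dotS mulrDr opprD expRD expr2.
have [lc lcE] := gauss_cos (rV_coord ord0 w) u0.
have [ls lsE] := gauss_sin (rV_coord ord0 w) u0.
have gc := gauss_osc_int u0 (mcos (rV_behead w)) (fun y => cos_max _).
have gs := gauss_osc_int u0 (msin (rV_behead w)) (fun y => sin_max _).
have [i1 E1] := intble_rV_cons lc gc.
have [i2 E2] := intble_rV_cons ls gs.
have [i3 E3] := intble_rV_cons ls gc.
have [i4 E4] := intble_rV_cons lc gs.
split.
  under eq_Rintegral do rewrite gS dotS cosD mulrBr mulrACA [X in _ - X]mulrACA.
  rewrite RIB// E1 E2 lcE IHc lsE mul0r subr0 /heat_rV big_ord_recl exprS.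
  rewrite (_ : \prod_i heat_line u (w ord0 (lift ord0 i)) =
    \prod_i heat_line u (rV_behead w ord0 i)); last first.
    by apply: eq_bigr => i _; rewrite mxE.
  by rewrite /rV_coord; ring.
under eq_Rintegral do rewrite gS dotS sinD mulrDr mulrACA [X in _ + X]mulrACA.
by rewrite RID// E3 E4 lsE IHs mul0r mulr0 addr0.
Qed.

End gaussian_rV.

(** * Complex numbers as a real Euclidean plane *)

Section complex_arith.
Context (R : realType).
Implicit Types (z w : R[i]) (c : R).

(** Real inner product on the plane. It keeps every integral real-valued; the complex structure
    returns only in [complex_eigenfunction_count]. *)
Definition rdot z w : R := Re z * Re w + Im z * Im w.

Lemma ReD z w : Re (z + w) = Re z + Re w. Proof. by case: z w => [? ?] [? ?]. Qed.
Lemma ImD z w : Im (z + w) = Im z + Im w. Proof. by case: z w => [? ?] [? ?]. Qed.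
Lemma ReN z : Re (- z) = - Re z. Proof. by case: z. Qed.
Lemma ImN z : Im (- z) = - Im z. Proof. by case: z. Qed.
Lemma cReM z w : Re (z * w) = Re z * Re w - Im z * Im w.
Proof. by case: z w => [? ?] [? ?]. Qed.
Lemma cImM z w : Im (z * w) = Re z * Im w + Im z * Re w.
Proof. by case: z w => [? ?] [? ?]. Qed.
Lemma ReCM c z : Re (c%:C%C * z) = c * Re z.
Proof. by rewrite cReM /= mul0r subr0. Qed.
Lemma ImCM c z : Im (c%:C%C * z) = c * Im z.
Proof. by rewrite cImM /= mul0r addr0. Qed.
Lemma ReJ z : Re (conjc z) = Re z. Proof. by case: z. Qed.
Lemma ImJ z : Im (conjc z) = - Im z. Proof. by case: z. Qed.
Lemma Re_sum I (s : seq I) (F : I -> R[i]) :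
  Re (\sum_(i <- s) F i) = \sum_(i <- s) Re (F i).
Proof. by elim: s => [|i s IH]; rewrite ?big_nil// !big_cons ReD IH. Qed.
Lemma Im_sum I (s : seq I) (F : I -> R[i]) :
  Im (\sum_(i <- s) F i) = \sum_(i <- s) Im (F i).
Proof. by elim: s => [|i s IH]; rewrite ?big_nil// !big_cons ImD IH. Qed.

Lemma complexP z w : Re z = Re w -> Im z = Im w -> z = w.
Proof. by case: z w => [? ?] [? ?] /= -> ->. Qed.

Lemma rdotE z w : rdot z w = Re (conjc z * w).
Proof. by rewrite cReM ReJ ImJ mulNr opprK. Qed.

Lemma sqmodE z : sqmod z = rdot z z. Proof. by []. Qed.

Lemma sqmod_ge0 z : 0 <= sqmod z.
Proof. by rewrite addr_ge0// sqr_ge0. Qed.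

Lemma rdotC z w : rdot z w = rdot w z.
Proof. by rewrite /rdot mulrC (mulrC (Im z)). Qed.
Lemma rdotDl z1 z2 w : rdot (z1 + z2) w = rdot z1 w + rdot z2 w.
Proof. by rewrite /rdot ReD ImD; ring. Qed.
Lemma rdotCMl c z w : rdot (c%:C%C * z) w = c * rdot z w.
Proof. by rewrite /rdot ReCM ImCM; ring. Qed.
Lemma rdotCMr c z w : rdot z (c%:C%C * w) = c * rdot z w.
Proof. by rewrite /rdot ReCM ImCM; ring. Qed.
Lemma rdotNl z w : rdot (- z) w = - rdot z w.
Proof. by rewrite /rdot ReN ImN; ring. Qed.
Lemma rdotNr z w : rdot z (- w) = - rdot z w.
Proof. by rewrite /rdot ReN ImN; ring. Qed.
Lemma rdot_suml I (s : seq I) (F : I -> R[i]) w :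
  rdot (\sum_(i <- s) F i) w = \sum_(i <- s) rdot (F i) w.
Proof. by rewrite /rdot Re_sum Im_sum !mulr_suml -big_split. Qed.
Lemma rdot_sumr I (s : seq I) (F : I -> R[i]) w :
  rdot w (\sum_(i <- s) F i) = \sum_(i <- s) rdot w (F i).
Proof. by rewrite rdotC rdot_suml; apply: eq_bigr => i _; rewrite rdotC. Qed.

Lemma rdot_le z w : `|rdot z w| <= sqmod z + sqmod w.
Proof.
rewrite ler_norml /rdot /sqmod; apply/andP; split.
  have := sqr_ge0 (Re z + Re w); have := sqr_ge0 (Im z + Im w).
  have := sqr_ge0 (Re z); have := sqr_ge0 (Im z).
  have := sqr_ge0 (Re w); have := sqr_ge0 (Im w).
  rewrite !expr2; lra.
have := sqr_ge0 (Re z - Re w); have := sqr_ge0 (Im z - Im w).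
have := sqr_ge0 (Re z); have := sqr_ge0 (Im z).
have := sqr_ge0 (Re w); have := sqr_ge0 (Im w).
rewrite !expr2; lra.
Qed.

Lemma sqmodD z w : sqmod (z + w) = sqmod z + 2 * rdot z w + sqmod w.
Proof. by rewrite /sqmod /rdot ReD ImD; ring. Qed.

Lemma sqmodM z w : sqmod (z * w) = sqmod z * sqmod w.
Proof. by rewrite /sqmod cReM cImM; ring. Qed.

Lemma sqmodCM c z : sqmod (c%:C%C * z) = c ^+ 2 * sqmod z.
Proof. by rewrite /sqmod ReCM ImCM; ring. Qed.

Lemma sqmodN z : sqmod (- z) = sqmod z.
Proof. by rewrite /sqmod ReN ImN; ring. Qed.

Lemma sqmod_conj z : sqmod (conjc z) = sqmod z.
Proof. by rewrite /sqmod ReJ ImJ sqrrN. Qed.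

Lemma sqmod_eq0 z : sqmod z = 0 -> z = 0.
Proof.
move=> /eqP; rewrite /sqmod paddr_eq0 ?sqr_ge0// !sqrf_eq0 => /andP[/eqP a /eqP b].
exact: complexP.
Qed.

Lemma sqr_Re_le z : Re z ^+ 2 <= sqmod z.
Proof. by rewrite lerDl sqr_ge0. Qed.

Lemma sqr_Im_le z : Im z ^+ 2 <= sqmod z.
Proof. by rewrite lerDr sqr_ge0. Qed.

End complex_arith.

(** * Square-integrable functions with the real inner product *)

Section complex_L2_theory.
Context (R : realType) (d : nat).
Implicit Types (f g h : 'rV[R]_d -> R[i]).
Notation mu := (lebesgue_rV R d).

(** The real part of [L2inner]. *)
Definition rip f g : R := \int[mu]_x rdot (f x) (g x).

Lemma cmeasurable_rdot f g : cmeasurable f -> cmeasurable g ->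
  measurable_fun setT (fun x => rdot (f x) (g x)).
Proof. by move=> [? ?] [? ?]; apply: measurable_funD; exact: measurable_funM. Qed.

Lemma cmeasurable_sqmod f : cmeasurable f -> measurable_fun setT (fun x => sqmod (f x)).
Proof. by move=> mf; exact: cmeasurable_rdot. Qed.

Lemma cmeasurableD f g : cmeasurable f -> cmeasurable g ->
  cmeasurable (fun x => f x + g x).
Proof.
move=> [f1 f2] [g1 g2]; split.
  by under eq_fun do rewrite ReD; exact: measurable_funD.
by under eq_fun do rewrite ImD; exact: measurable_funD.
Qed.

Lemma cmeasurableM f g : cmeasurable f -> cmeasurable g ->
  cmeasurable (fun x => f x * g x).
Proof.
move=> [f1 f2] [g1 g2]; split.
  by under eq_fun do rewrite cReM; apply: measurable_funB; exact: measurable_funM.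
by under eq_fun do rewrite cImM; apply: measurable_funD; exact: measurable_funM.
Qed.

Lemma cmeasurable_cst (c : R[i]) : cmeasurable (fun _ : 'rV[R]_d => c).
Proof. by split. Qed.

Lemma cmeasurableR (a : 'rV[R]_d -> R) : measurable_fun setT a ->
  cmeasurable (fun x => (a x)%:C%C).
Proof. by split => //; exact: measurable_cst. Qed.

Lemma cmeasurable_conj f : cmeasurable f -> cmeasurable (fun x => conjc (f x)).
Proof.
move=> [f1 f2]; split; first by under eq_fun do rewrite ReJ.
by under eq_fun do rewrite ImJ; exact: measurableT_comp.
Qed.

Lemma L2_intble f : L2 f -> intble mu (fun x => sqmod (f x)).
Proof.
move=> [mf foo]; apply: intble_lty => //; first exact: cmeasurable_sqmod.
by move=> x; exact: sqmod_ge0.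
Qed.

Lemma L2P f : cmeasurable f -> intble mu (fun x => sqmod (f x)) -> L2 f.
Proof.
move=> mf fi; split => //; rewrite /sqL2norm -EFin_RI//; exact: ltry.
Qed.

Lemma sqL2normE f : L2 f -> sqL2norm f = (rip f f)%:E.
Proof. by move=> /L2_intble fi; rewrite /rip EFin_RI. Qed.

Lemma L2_rdot f g : L2 f -> L2 g -> intble mu (fun x => rdot (f x) (g x)).
Proof.
move=> Lf Lg; apply: (intble_le _ _ (intbleD (L2_intble Lf) (L2_intble Lg))).
  exact: cmeasurable_rdot Lf.1 Lg.1.
by move=> x; exact: rdot_le.
Qed.

Lemma L2D f g : L2 f -> L2 g -> L2 (fun x => f x + g x).
Proof.
move=> Lf Lg; apply: L2P; first exact: cmeasurableD Lf.1 Lg.1.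
under eq_fun do rewrite sqmodD.
apply: intbleD (L2_intble Lg); apply: intbleD (L2_intble Lf) _.
exact/intbleZ/L2_rdot.
Qed.

Lemma L2M_bounded (K : R) f g : cmeasurable g -> (forall x, sqmod (g x) <= K) -> L2 f ->
  L2 (fun x => g x * f x).
Proof.
move=> mg gK Lf; apply: L2P; first exact: cmeasurableM mg Lf.1.
apply: (intble_le _ _ (intbleZ K (L2_intble Lf))).
  by apply: cmeasurable_sqmod; exact: cmeasurableM mg Lf.1.
move=> x; rewrite sqmodM ger0_norm ?mulr_ge0 ?sqmod_ge0//.
by rewrite ler_wpM2r ?sqmod_ge0.
Qed.

Lemma L2Z (c : R[i]) f : L2 f -> L2 (fun x => c * f x).
Proof. exact: (L2M_bounded (cmeasurable_cst c) (fun=> lexx _)). Qed.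

Lemma L2N f : L2 f -> L2 (fun x => - f x).
Proof. by move=> /(L2Z (-1)); under eq_fun do rewrite mulN1r. Qed.

Lemma L2B f g : L2 f -> L2 g -> L2 (fun x => f x - g x).
Proof. by move=> Lf /L2N; exact: L2D. Qed.

Lemma L20 : L2 (fun _ : 'rV[R]_d => 0).
Proof.
apply: L2P; first exact: cmeasurable_cst.
by under eq_fun do rewrite /sqmod /= expr0n addr0; exact: intble0.
Qed.

Lemma rip_ge0 f : 0 <= rip f f.
Proof. by apply: Rintegral_ge0 => x _; exact: sqmod_ge0. Qed.

Lemma ripC f g : rip f g = rip g f.
Proof. by apply: eq_Rintegral => x _; rewrite rdotC. Qed.

Lemma ripDl f g h : L2 f -> L2 g -> L2 h ->
  rip (fun x => f x + g x) h = rip f h + rip g h.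
Proof.
move=> Lf Lg Lh; rewrite /rip; under eq_Rintegral do rewrite rdotDl.
by rewrite RID//; exact: L2_rdot.
Qed.

Lemma ripZl (c : R) f g : L2 f -> L2 g -> rip (fun x => c%:C%C * f x) g = c * rip f g.
Proof.
move=> Lf Lg; rewrite /rip; under eq_Rintegral do rewrite rdotCMl.
by rewrite RIZ//; exact: L2_rdot.
Qed.

Lemma ripD_sqr f g : L2 f -> L2 g ->
  rip (fun x => f x + g x) (fun x => f x + g x) = rip f f + 2 * rip f g + rip g g.
Proof.
move=> Lf Lg; rewrite (ripDl Lf Lg (L2D Lf Lg)) ripC (ripDl Lf Lg Lf).
rewrite (ripC g (fun x => f x + g x)) (ripDl Lf Lg Lg) (ripC g f); ring.
Qed.

Lemma ripB_sqr f g : L2 f -> L2 g ->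
  rip (fun x => f x - g x) (fun x => f x - g x) = rip f f - 2 * rip f g + rip g g.
Proof.
move=> Lf Lg; rewrite (ripD_sqr Lf (L2N Lg)).
have -> : rip f (fun x => - g x) = - rip f g.
  rewrite /rip; under eq_Rintegral do rewrite rdotNr -mulN1r.
  by rewrite RIZ ?mulN1r//; exact: L2_rdot.
have -> : rip (fun x => - g x) (fun x => - g x) = rip g g.
  by apply: eq_Rintegral => x _; rewrite rdotNl rdotNr opprK.
by ring.
Qed.

(** Pointwise, |p|^2 - |q|^2 = 2 p.(p-q) - |p-q|^2, and Young's inequality with weight c bounds it
    by c |p|^2 + (1 + 1/c) |p-q|^2. *)
Lemma rip_cvg (F : nat -> 'rV[R]_d -> R[i]) f : (forall n, L2 (F n)) -> L2 f ->
  rip (fun x => f x - F n x) (fun x => f x - F n x) @[n --> \oo] --> (0 : R) ->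
  rip (F n) (F n) @[n --> \oo] --> rip f f.
Proof.
move=> LF Lf F0; apply/cvgrPdist_le => e e0.
have r0 := rip_ge0 f.
(* Small enough that c |f|^2 integrates to at most e/2; the [+ 1] covers a function of norm zero. *)
pose c := e / (2 * (rip f f + 1)).
have c0 : 0 < c by rewrite divr_gt0// mulr_gt0// ltr_wpDl.
have c1 : 0 < 1 + c^-1 by rewrite addr_gt0// invr_gt0.
move/cvgrPdist_le : F0 => /(_ (e / 2 / (1 + c^-1))).
rewrite !divr_gt0// => /(_ isT)[N _ FN]; exists N => // n /FN.
rewrite sub0r normrN ger0_norm ?rip_ge0// ler_pdivlMr// => h.
have LB := L2B Lf (LF n).
have H : `|rip f f - rip (F n) (F n)| <=
    (1 + c^-1) * rip (fun x => f x - F n x) (fun x => f x - F n x) + c * rip f f.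
  rewrite /rip -RIB; [|exact/L2_rdot|exact/L2_rdot].
  apply: le_trans (RI_norm _) _; first by apply: intbleB; exact: L2_rdot.
  rewrite -!RIZ; [|exact: L2_rdot..].
  rewrite -RID; [|by apply/intbleZ; exact: L2_rdot..].
  apply: RI_le.
  - by apply/intble_norm/intbleB; exact: L2_rdot.
  - by apply: intbleD; apply/intbleZ; exact: L2_rdot.
  move=> x; rewrite -!sqmodE; set p := f x; set q := F n x.
  have E : sqmod p - sqmod q = 2 * rdot p (p - q) - sqmod (p - q).
    by rewrite /rdot /sqmod !ReD !ImD !ReN !ImN; ring.
  have E2 : sqmod (c%:C%C * p - (p - q)) = c ^+ 2 * sqmod p - 2 * c * rdot p (p - q) + sqmod (p - q).
    by rewrite /sqmod /rdot !(ReD, ImD, ReN, ImN, ReCM, ImCM); ring.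
  have E3 : sqmod (c%:C%C * p + (p - q)) = c ^+ 2 * sqmod p + 2 * c * rdot p (p - q) + sqmod (p - q).
    by rewrite /sqmod /rdot !(ReD, ImD, ReN, ImN, ReCM, ImCM); ring.
  have := sqmod_ge0 (c%:C%C * p - (p - q)); rewrite E2.
  have := sqmod_ge0 (c%:C%C * p + (p - q)); rewrite E3.
  have s0 := sqmod_ge0 (p - q); have sp := sqmod_ge0 p.
  move=> h1 h2.
  have {}h1 : - (2 * rdot p (p - q)) <= c * sqmod p + c^-1 * sqmod (p - q).
    rewrite -(ler_pM2l c0) [leRHS]mulrDr (mulrA c c^-1) mulfV ?gt_eqF// mul1r; nra.
  have {}h2 : 2 * rdot p (p - q) <= c * sqmod p + c^-1 * sqmod (p - q).
    rewrite -(ler_pM2l c0) [leRHS]mulrDr (mulrA c c^-1) mulfV ?gt_eqF// mul1r; nra.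
  rewrite E mulrDl mul1r ler_norml; apply/andP; split; lra.
apply: le_trans H _.
have : c * rip f f <= e / 2.
  have <- : c * (rip f f + 1) = e / 2.
    by rewrite /c; field; rewrite gt_eqF// ltr_wpDl.
  by rewrite ler_pM2l// lerDl.
by rewrite mulrC in h => h'; lra.
Qed.

End complex_L2_theory.

Import HBNNSimple.

(** * Weak convergence of heat smoothing to the identity *)

Section weak_approximation.
Context (R : realType) (d : nat).
Notation mu := (lebesgue_rV R d).
Notation mu2 := (lebesgue_rV R d \x lebesgue_rV R d)%E.
Implicit Types (a b : 'rV[R]_d -> R).

Lemma measurable_heat_sub u :
  measurable_fun setT (fun z : 'rV[R]_d * 'rV[R]_d => heat_rV u (z.1 - z.2)).
Proof. exact: measurableT_comp (measurable_heat_rV u) (@measurable_subv _ d). Qed.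

Lemma intble_heat2 u a b : 0 < u -> intble mu a -> intble mu b ->
  intble mu2 (fun z => heat_rV u (z.1 - z.2) * (a z.1 * b z.2)).
Proof.
move=> u0 ia ib; apply: intble_bdM (intble_prod ia ib).
  exact: measurable_heat_sub.
move=> z; rewrite ger0_norm ?heat_rV_ge0//; exact: heat_rV_ub.
Qed.

Lemma heat_rVC u (x y : 'rV[R]_d) : 0 < u -> heat_rV u (x - y) = heat_rV u (y - x).
Proof. by move=> u0; rewrite -heat_rVN// opprB. Qed.

(** The coordinate factors used below may jump at c i; the corresponding hyperplanes are null. *)
Let hyperplane_free (c : 'I_d -> R) : {ae mu, forall x, forall i, rV_coord i x != c i}.
Proof.
apply: filter_forall => i.
exists [set x : 'rV[R]_d | forall j, (if j == i then [set c i] else setT) (x ord0 j)]; split.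
- apply: (@measurable_rV_set R d (fun j => if j == i then [set c i] else setT)) => j.
  by case: ifP.
- have := @lebesgue_rV_box R d (fun j => if j == i then [set c i] else setT).
  move=> ->; last by move=> j; case: ifP.
  by rewrite (bigD1 i)//= eqxx lebesgue_measure_set1 mul0e.
- move=> x /= /negP; rewrite negbK => /eqP xc j; case: eqP => // ->; exact: xc.
Qed.

Let approx_box (f : 'I_d -> R -> R) (k : R) (x : 'rV[R]_d) :
  (forall i, measurable_fun setT (f i)) -> (forall i s, `|f i s| <= k) ->
  (forall i, {for (rV_coord i x), continuous (f i)}) ->
  \int[mu]_y (heat_rV (harm R n) (x - y) * \prod_i f i (rV_coord i y)) @[n --> \oo] -->
  \prod_i f i (rV_coord i x).
Proof.
move=> mf fk cf.
have H i := heat_line_approx (mf i) (fk i) (cf i).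
have E n y : heat_rV (harm R n) (x - y) * \prod_i f i (rV_coord i y) =
    \prod_i (heat_line (harm R n) (rV_coord i x - rV_coord i y) * f i (rV_coord i y)).
  by rewrite big_split; congr (_ * _); apply: eq_bigr => i _; rewrite !mxE.
have I n := intble_rV_prod (fun i => (H i).1 n).
rewrite (_ : (fun n => _) = (fun n => \prod_i \int[@lebesgue_measure R]_s
    (heat_line (harm R n) (rV_coord i x - s) * f i s))); last first.
  by apply/funext => n; rewrite -(I n).2; apply: eq_Rintegral => y _; rewrite E.
by apply: cvg_big => [|i _]; [exact: mul_continuous|exact: (H i).2].
Qed.

Variables (a : 'rV[R]_d -> R) (K : R).
Hypotheses (ia : intble mu a) (aK : forall x, `|a x| <= K).

Let ma := intble_meas ia.

Let A n (y : 'rV[R]_d) := \int[mu]_x (heat_rV (harm R n) (y - x) * a x).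

Let mA n : measurable_fun setT (A n).
Proof.
rewrite /A; apply: (@measurable_RI _ _ _ _ _ mu
  (fun z : 'rV[R]_d * 'rV[R]_d => heat_rV (harm R n) (z.1 - z.2) * a z.2)).
apply: measurable_funM; first exact: measurable_heat_sub.
exact: measurableT_comp ma measurable_snd.
Qed.

Let hA n y : intble mu (fun x => heat_rV (harm R n) (y - x) * a x).
Proof.
under eq_fun do rewrite mulrC.
exact: intble_bdM ma aK (heat_rV_int y (harm_gt0 R n)).1.
Qed.

Let A_ub n y : `|A n y| <= K.
Proof.
have [h1 h2] := heat_rV_int y (harm_gt0 R n).
apply: le_trans (RI_norm (hA n y)) _.
rewrite -[leRHS]mulr1 -[X in _ * X]h2 -RIZ//; apply: RI_le.
- exact/intble_norm/hA.
- exact: intbleZ.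
by move=> x; rewrite normrM ger0_norm ?heat_rV_ge0// mulrC ler_wpM2r// heat_rV_ge0.
Qed.

Let T n b := \int[mu]_y (A n y * b y).

(** The class of test functions for which the smoothing [A] of [a] converges weakly. It is shown to
    be linear and closed in L^1, to contain the products of one-variable functions, and then to
    contain every integrable function. *)
Let P b := T n b @[n --> \oo] --> \int[mu]_y (a y * b y).

Let iAb n b : intble mu b -> intble mu (fun y => A n y * b y).
Proof. by move=> ib; exact: intble_bdM (mA n) (A_ub n) ib. Qed.

Let iab b : intble mu b -> intble mu (fun y => a y * b y).
Proof. by move=> ib; exact: intble_bdM ma aK ib. Qed.

Let P_lin (c : R) b1 b2 : intble mu b1 -> intble mu b2 -> P b1 -> P b2 ->
  P (fun y => b1 y + c * b2 y).
Proof.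
move=> i1 i2 P1 P2; rewrite /P /T.
have E (f : 'rV[R]_d -> R) y : f y * (b1 y + c * b2 y) = f y * b1 y + c * (f y * b2 y) by ring.
under eq_Rintegral do rewrite E.
rewrite RID ?RIZ//; [|exact: iab..|exact/intbleZ/iab].
rewrite (_ : (fun n => _) = (fun n => T n b1 + c * T n b2)); last first.
  apply/funext => n; under eq_Rintegral do rewrite E.
  by rewrite RID ?RIZ//; [exact: iAb..|exact/intbleZ/iAb].
by apply: cvgD => //; apply: cvgMr.
Qed.

(** The bound K on [A n] is uniform in n, so replacing b by B k costs at most K times their L^1
    distance, for all n at once. *)
Let P_closed (B : nat -> 'rV[R]_d -> R) b : (forall k, intble mu (B k)) ->
  intble mu b -> (forall k, P (B k)) ->
  \int[mu]_y `|b y - B k y| @[k --> \oo] --> (0 : R) -> P b.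
Proof.
move=> iB ib PB Bb; apply/cvgrPdist_le => e e0.
have K0 : 0 <= K by exact: le_trans (aK 0).
(* K + 1 instead of K, since K may be zero. *)
have e3 : 0 < e / (3 * (K + 1)) by rewrite divr_gt0// mulr_gt0// ltr_wpDl.
have [k kP] : exists k, \int[mu]_y `|b y - B k y| <= e / (3 * (K + 1)).
  move/cvgrPdist_le : Bb => /(_ _ e3)[N _ /(_ N (leqnn N))].
  by rewrite sub0r normrN => h; exists N; apply: le_trans h; exact: ler_norm.
have bnd (f : 'rV[R]_d -> R) : measurable_fun setT f -> (forall y, `|f y| <= K) ->
    `|\int[mu]_y (f y * b y) - \int[mu]_y (f y * B k y)| <= e / 3.
  move=> mf fK; have i1 := intble_bdM mf fK ib; have i2 := intble_bdM mf fK (iB k).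
  rewrite -RIB//; apply: le_trans (RI_norm (intbleB i1 i2)) _.
  apply: (@le_trans _ _ (K * (\int[mu]_y `|b y - B k y|))).
    have ibB := intble_norm (intbleB ib (iB k)).
    rewrite -RIZ//; apply: RI_le; [exact/intble_norm/intbleB|exact: intbleZ|].
    by move=> y; rewrite -mulrBr normrM ler_wpM2r.
  apply: (@le_trans _ _ ((K + 1) * (e / (3 * (K + 1))))).
    apply: ler_pM => //; first exact: Rintegral_ge0.
    by rewrite lerDl.
  by rewrite le_eqVlt; apply/orP; left; apply/eqP; field; rewrite gt_eqF// ltr_wpDl.
have e30 : 0 < e / 3 by rewrite divr_gt0.
move/cvgrPdist_le : (PB k) => /(_ _ e30)[N _ NP]; exists N => // n /NP.
have := bnd _ (mA n) (A_ub n); have := bnd _ ma aK.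
rewrite -/(T n b) -/(T n (B k)) !ler_norml => /andP[? ?] /andP[? ?] /andP[? ?].
apply/andP; split; lra.
Qed.

(** Fubini and the symmetry of the kernel move the smoothing from [a] to the product function, where
    it converges coordinate by coordinate off the hyperplanes x_i = c_i. *)
Let P_box (f : 'I_d -> R -> R) (c : 'I_d -> R) (k : R) :
  (forall i, measurable_fun setT (f i)) -> (forall i s, `|f i s| <= k) ->
  (forall i, intble (@lebesgue_measure R) (f i)) ->
  (forall i s, s != c i -> {for s, continuous (f i)}) ->
  P (fun y => \prod_i f i (rV_coord i y)).
Proof.
move=> mf fk fi cf; set b := fun y => _.
have ib : intble mu b by exact: (intble_rV_prod fi).1.
have bk y : `|b y| <= \prod_(i < d) k.
  by rewrite normr_prod; apply: ler_prod => i _; rewrite normr_ge0 fk.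
have E n : T n b = \int[mu]_x (a x * \int[mu]_y (heat_rV (harm R n) (x - y) * b y)).
  pose F z := heat_rV (harm R n) (z.1 - z.2) * (b z.1 * a z.2).
  have iF : intble mu2 F by apply: intble_heat2 => //; exact: harm_gt0.
  transitivity (\int[mu]_y \int[mu]_x F (y, x)).
    apply: eq_Rintegral => y _; rewrite mulrC /A -RIZ; last exact: hA.
    by apply: eq_Rintegral => x _; rewrite /F/=; ring.
  rewrite RI_fubini//; apply: eq_Rintegral => x _.
  rewrite -RIZ; last first.
    under eq_fun do rewrite mulrC.
    apply: intble_bdM (intble_meas ib) bk (heat_rV_int x (harm_gt0 R n)).1.
  by apply: eq_Rintegral => y _; rewrite /F/= heat_rVC ?harm_gt0//; ring.
rewrite /P; under eq_fun do rewrite E.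
pose G n x := \int[mu]_y (heat_rV (harm R n) (x - y) * b y).
have mb := intble_meas ib.
have Gk n x : `|G n x| <= \prod_(i < d) k.
  have [h1 h2] := heat_rV_int x (harm_gt0 R n).
  have ihb : intble mu (fun y => heat_rV (harm R n) (x - y) * b y).
    by under eq_fun do rewrite mulrC; exact: intble_bdM mb bk h1.
  apply: le_trans (RI_norm ihb) _.
  rewrite -[leRHS]mulr1 -[X in _ * X]h2 -RIZ//; apply: RI_le => //.
  - exact/intble_norm.
  - exact: intbleZ.
  by move=> y; rewrite normrM ger0_norm ?heat_rV_ge0// mulrC ler_wpM2r// heat_rV_ge0.
apply: (@RI_dct _ _ _ mu (fun n x => a x * G n x) _
  (fun x => (\prod_(i < d) k) * `|a x|) _ _ _ _ _).2.
- move=> n; apply: measurable_funM => //.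
  apply: (@measurable_RI _ _ _ _ _ mu
    (fun z : 'rV[R]_d * 'rV[R]_d => heat_rV (harm R n) (z.1 - z.2) * b z.2)).
  apply: measurable_funM; first exact: measurable_heat_sub.
  exact: measurableT_comp mb measurable_snd.
- exact: measurable_funM.
- exact/intbleZ/intble_norm.
- by move=> n x; rewrite normrM mulrC ler_wpM2r.
- apply: filterS (hyperplane_free c) => x xc; apply: cvgMr.
  by apply: (@approx_box f k x mf fk) => i; exact: cf.
Qed.

(** Lebesgue measure being infinite, indicators are weighted by this positive integrable product;
    the whole space then gives an integrable function, as the Dynkin induction requires. *)
Let w : 'rV[R]_d -> R := heat_rV 1.

Let wE (y : 'rV[R]_d) : w y = \prod_i heat_line 1 (rV_coord i y).
Proof. by []. Qed.

Let w_gt0 y : 0 < w y.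
Proof. by apply: prodr_gt0 => i _; rewrite heat_lineE// mulr_gt0 ?expR_gt0// invr_gt0 sqrtr_gt0 !mulr_gt0 ?pi_gt0. Qed.

Let l_int : intble (@lebesgue_measure R) (heat_line 1).
Proof.
have := (heat_line_int (0 : R) ltr01).1.
by under eq_fun do rewrite sub0r heat_lineN//.
Qed.

Let iw : intble mu w.
Proof.
have := (heat_rV_int (0 : 'rV[R]_d) ltr01).1.
by under eq_fun do rewrite sub0r heat_rVN//.
Qed.

Let ind (S : set 'rV[R]_d) y : R := \1_S y * w y.

Let iind S : measurable S -> intble mu (ind S).
Proof.
move=> mS; apply: (@intble_bdM _ _ _ mu 1) iw.
  exact: measurable_indic.
by move=> y; rewrite indicE; case: (_ \in _); rewrite ?normr1 ?normr0.
Qed.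

Let l_ub s : `|heat_line 1 s| <= (Num.sqrt (4 * 1 * pi))^-1 :> R.
Proof. by rewrite ger0_norm ?heat_line_ge0// heat_line_ub. Qed.

Let P_setT : P (ind setT).
Proof.
rewrite (_ : ind setT = fun y => \prod_i heat_line 1 (rV_coord i y)); last first.
  by apply/funext => y; rewrite /ind indicT mul1r.
apply: (@P_box (fun=> heat_line 1) (fun=> 0) (Num.sqrt (4 * 1 * pi))^-1) => [i|i s|i|i s _].
- exact: measurable_heat_line.
- exact: l_ub.
- exact: l_int.
- exact: continuous_heat_line.
Qed.

(** The weighted indicator factorises, and each factor is continuous except at the corner
    coordinate. *)
Let P_orthant S : @orthants R d S -> P (ind S).
Proof.
move=> [c ->].
pose f i s : R := \1_(`]c ord0 i, +oo[%classic) s * heat_line 1 s.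
rewrite (_ : ind _ = fun y => \prod_i f i (rV_coord i y)); last first.
  apply/funext => y; rewrite /f big_split /ind wE; congr (_ * _).
  rewrite indicE; case: (boolP (_ \in _)) => [|/negP yc].
    rewrite inE => yc; rewrite big1// => i _; rewrite indicE mem_set//=.
    by rewrite in_itv/= andbT; exact: yc.
  apply/esym; have [i yi] : exists i, y ord0 i <= c ord0 i.
    apply: contrapT => h; apply: yc; rewrite inE /= => i.
    by rewrite ltNge; apply/negP => yi; apply: h; exists i.
  rewrite (bigD1 i)//= indicE memNset ?mul0r//=.
  by rewrite in_itv/= andbT; apply/negP; rewrite -leNgt.
have m1 i : measurable_fun [set: measurableTypeR R] (\1_(`]c ord0 i, +oo[%classic) : R -> R).
  by apply: measurable_indic; exact: measurable_itv.
have mf i : measurable_fun setT (f i).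
  by apply: measurable_funM; [exact: m1|exact: measurable_heat_line].
have f1 i s : `|\1_(`]c ord0 i, +oo[%classic) s| <= 1 :> R.
  by rewrite indicE; case: (_ \in _); rewrite ?normr1 ?normr0.
apply: (@P_box f (fun i => c ord0 i) (Num.sqrt (4 * 1 * pi))^-1) => //.
- by move=> i s; rewrite /f normrM -[leRHS]mul1r ler_pM.
- by move=> i; exact: (intble_bdM (m1 i) (f1 i) l_int).
move=> i s; rewrite neq_lt => /orP[sc|cs].
- have fs0 : f i s = 0.
    rewrite /f indicE memNset ?mul0r//.
    by rewrite /= in_itv/= andbT; apply/negP; rewrite -leNgt ltW.
  suff : f i y @[y --> s] --> f i s by []; rewrite fs0; apply: cvg_near_cst.
  have ns : \forall y \near s, y < c ord0 i by exact: (cvgr_lt s cvg_id).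
  apply: filterS ns => y yc; rewrite /f indicE memNset ?mul0r//.
  by rewrite /= in_itv/= andbT; apply/negP; rewrite -leNgt ltW.
- have fs : f i s = heat_line 1 s.
    by rewrite /f indicE mem_set ?mul1r//= in_itv/= andbT.
  suff : f i y @[y --> s] --> f i s by []; rewrite fs; 
  have H : heat_line 1 y @[y --> s] --> heat_line 1 s := @continuous_heat_line R 1 ltr01 s.
  apply: cvg_trans H.
  apply: near_eq_cvg.
  have ns : \forall y \near s, c ord0 i < y by exact: (cvgr_gt s cvg_id).
  by apply: filterS ns => y cy; rewrite /f indicE mem_set ?mul1r//= in_itv/= andbT.
Qed.

Let sum_indic_trivIset (F : nat -> set 'rV[R]_d) y j k : trivIset setT F -> F j y ->
  \sum_(i < k) (\1_(F i) y : R) = (j < k)%:R.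
Proof.
move=> tF Fjy; elim: k => [|k IH]; first by rewrite big_ord0.
rewrite big_ord_recr IH /= (ltnS j k) (leq_eqVlt j k); have [<-|jk] := eqVneq j k.
  by rewrite ltnn add0r indicE mem_set.
rewrite indicE memNset ?addr0// => Fky; move/eqP : jk; apply.
by apply: tF => //; exists y.
Qed.

(** Dynkin induction from the orthants: complements by linearity, disjoint unions by L^1 closure
    under the dominating function w. *)
Let P_measurable S : measurable S -> P (ind S).
Proof.
move=> mS; have := mS; rewrite measurable_orthants => gS; move: S gS {mS}.
apply: (@dynkin_induction _ _ (@orthants R d)).
- exact: measurable_orthants.
- exact: orthants_setI.
- exact: P_setT.
- exact: P_orthant.
- move=> S mS PS; have -> : ind (~` S) = (fun y => ind setT y + -1 * ind S y).
    apply/funext => y; rewrite /ind !indicE in_setC in_setT.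
    by case: (y \in S) => /=; ring.
  by apply: P_lin => //; exact: iind.
- move=> F mF tF PF.
  apply: (@P_closed (fun k y => \sum_(i < k) ind (F i) y)).
  + by move=> k; apply: intble_sum => i; exact: iind.
  + by apply: iind; exact: bigcupT_measurable.
  + elim=> [|k IH].
      rewrite (_ : (fun y => _) = (fun=> 0)); last by apply/funext => y; rewrite big_ord0.
      rewrite /P /T; under eq_fun do under eq_Rintegral do rewrite mulr0.
      under eq_Rintegral do rewrite mulr0.
      by rewrite RI0; exact: cvg_cst.
    rewrite (_ : (fun y => _) = (fun y => (\sum_(i < k) ind (F i) y) + 1 * ind (F k) y)).
      apply: P_lin => //; [|exact: iind].
      by apply: intble_sum => i; exact: iind.
    by apply/funext => y; rewrite big_ord_recr mul1r.
  have mU : measurable (\bigcup_k F k) by exact: bigcupT_measurable.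
  suff : \int[mu]_y `|ind (\bigcup_k F k) y - \sum_(i < k) ind (F i) y| @[k --> \oo] -->
    \int[mu]_y (0 : R) by rewrite RI0.
  apply: (@RI_dct _ _ _ mu _ _ w _ _ iw _ _).2.
  + move=> k; apply: measurableT_comp => //; apply: intble_meas; apply: intbleB.
      exact: iind.
    by apply: intble_sum => i; exact: iind.
  + exact: measurable_cst.
  + move=> k y; rewrite normr_id /ind -mulr_suml -mulrBl normrM (gtr0_norm (w_gt0 y)).
    rewrite ler_piMl ?(ltW (w_gt0 _))//.
    have [[j _ Fj]|nF] := pselect ((\bigcup_k F k) y).
      rewrite (sum_indic_trivIset k tF Fj) indicE mem_set; last by exists j.
      by case: (_ < _)%N; rewrite ?subrr ?subr0 ?normr0 ?normr1.
    rewrite big1 => [|i _]; last by rewrite indicE memNset// => Fi; apply: nF; exists i.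
    by rewrite indicE memNset// subr0 normr0.
  + apply: aeW => y; apply: cvg_near_cst.
    have [[j _ Fj]|nF] := pselect ((\bigcup_k F k) y).
      exists j.+1 => // k /= jk.
      rewrite /ind -mulr_suml -mulrBl (sum_indic_trivIset k tF Fj) indicE mem_set; last by exists j.
      by rewrite jk subrr mul0r normr0.
    apply: nearW => k; rewrite /ind -mulr_suml -mulrBl.
    rewrite big1 => [|i _]; last by rewrite indicE memNset// => Fi; apply: nF; exists i.
    by rewrite indicE memNset// subr0 mul0r normr0.
Qed.

(** Simple functions increasing to b / w, multiplied back by w, are finite combinations of weighted
    indicators lying below b; dominated convergence provides the L^1 limit. *)
Let P_ge0 b : intble mu b -> (forall y, 0 <= b y) -> P b.
Proof.
move=> ib b0; have mb := intble_meas ib.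
have mw : measurable_fun setT w by exact: measurable_heat_rV.
have mwV : measurable_fun setT (fun y => (w y)^-1).
  rewrite (_ : (fun y => _) = (fun y => expR (- ln (w y)))); last first.
    by apply/funext => y; rewrite expRN lnK// posrE.
  by apply: measurableT_comp => //; apply: measurableT_comp => //; exact: measurableT_comp.
have mh : measurable_fun setT (fun y => (b y / w y)%:E).
  by apply/measurable_EFinP; exact: measurable_funM.
have h0 y : setT y -> (0 <= (b y / w y)%:E)%E.
  by move=> _; rewrite lee_fin divr_ge0// ltW.
pose s := nnsfun_approx measurableT mh.
have sb n y : 0 <= s n y <= b y / w y.
  apply/andP; split; first exact: fun_ge0.
  rewrite -lee_fin; rewrite /s nnsfun_approxE; exact: le_approx.
have sw n y : s n y * w y <= b y.
  by rewrite -ler_pdivlMr//; have /andP[] := sb n y.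
have sw0 n y : 0 <= s n y * w y by rewrite mulr_ge0 ?(ltW (w_gt0 _))//; have /andP[] := sb n y.
have msw n : measurable_fun setT (fun y => s n y * w y) by exact: measurable_funM.
have isw n : intble mu (fun y => s n y * w y).
  by apply: intble_le ib => // y; rewrite ger0_norm.
apply: (@P_closed (fun n y => s n y * w y)) => //.
  move=> n; rewrite (_ : (fun y => _) =
      (fun y => \sum_(r <- finmap.enum_fset (fset_set (range (s n)))) r * ind (s n @^-1` [set r]) y)).
    have pre r : measurable (s n @^-1` [set r]) by exact: measurable_sfunP.
    elim: (finmap.enum_fset _) => [|r t IH].
      rewrite (_ : (fun y => _) = (fun=> 0)); last by apply/funext => y; rewrite big_nil.
      rewrite /P /T; under eq_fun do under eq_Rintegral do rewrite mulr0.
      under eq_Rintegral do rewrite mulr0.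
      by rewrite RI0; exact: cvg_cst.
    rewrite (_ : (fun y => _) = (fun y => (\sum_(r <- t) r * ind (s n @^-1` [set r]) y)
        + r * ind (s n @^-1` [set r]) y)).
      apply: P_lin => //; last exact: P_measurable.
      + by apply: intble_sum => i; apply: intbleZ; exact: iind.
      + exact: iind.
    by apply/funext => y; rewrite big_cons addrC.
  apply/funext => y; rewrite {1}fimfunE fsbig_finite//= mulr_suml.
  by apply: eq_bigr => r _; rewrite mulrA.
suff : \int[mu]_y `|b y - s k y * w y| @[k --> \oo] --> \int[mu]_y (0 : R).
  by rewrite RI0.
apply: (@RI_dct _ _ _ mu _ _ b _ _ ib _ _).2.
- by move=> n; apply: measurableT_comp => //; exact: measurable_funB.
- exact: measurable_cst.
- by move=> n y; rewrite normr_id ger0_norm ?subr_ge0// gerBl.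
apply: aeW => y; rewrite -[X in _ --> X](@normr0 _ R); apply: cvg_norm.
rewrite -[X in _ --> X](subrr (b y)); apply: cvgB; first exact: cvg_cst.
rewrite -[X in _ --> X](@divfK _ (w y)) ?gt_eqF//; apply: cvgMl.
by have /fine_cvg := cvg_nnsfun_approx measurableT mh h0 (I : setT y).
Qed.

(** The position-space half of Plancherel's identity: it is applied to real and imaginary parts with
    b = a. *)
Lemma heat_weak_approx b : intble mu b ->
  \int[mu2]_z (heat_rV (harm R n) (z.1 - z.2) * (a z.1 * b z.2)) @[n --> \oo] -->
  \int[mu]_y (a y * b y).
Proof.
move=> ib; have Pb : P b.
  have ip : intble mu (fun y => Num.max (b y) 0).
    apply: intble_le (intble_norm ib).
      by apply: measurable_maxr => //; exact: intble_meas ib.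
    by move=> y; rewrite ger0_norm ?le_max ?lexx ?orbT// ge_max ler_norm normr_ge0.
  have iq : intble mu (fun y => Num.max (- b y) 0).
    apply: intble_le (intble_norm ib).
      by apply: measurable_maxr => //; apply: measurableT_comp (intble_meas ib).
    by move=> y; rewrite ger0_norm ?le_max ?lexx ?orbT// ge_max -normrN ler_norm normr_ge0.
  rewrite (_ : b = fun y => Num.max (b y) 0 + -1 * Num.max (- b y) 0).
    by apply: P_lin => //; apply: P_ge0 => // y; rewrite le_max lexx orbT.
  apply/funext => y; rewrite mulN1r; have [y0|y0] := leP 0 (b y).
    by rewrite max_r ?subr0// oppr_le0.
  by rewrite max_l ?opprK ?add0r// oppr_ge0 ltW.
rewrite (_ : (fun n => _) = T ^~ b) //; apply/funext => n.
have u0 := harm_gt0 R n.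
have iF := intble_heat2 u0 ia ib; rewrite -(RI_prod iF) (RI_fubini iF).
apply: eq_Rintegral => y _; rewrite mulrC /A -RIZ; last exact: hA.
by apply: eq_Rintegral => x _; rewrite /= heat_rVC//; ring.
Qed.

End weak_approximation.

(** * Fourier transform *)

Section fourier_L1.
Context (R : realType) (d : nat).
Notation mu := (lebesgue_rV R d).
Notation mu2 := (lebesgue_rV R d \x lebesgue_rV R d)%E.
Implicit Types (f g : 'rV[R]_d -> R[i]) (x y : 'rV[R]_d).

Definition ft_const : R := (2 * pi) `^ (- (d%:R / 2)).

Definition ft f y : R[i] :=
  ft_const%:C%C * cintegral [set: 'rV[R]_d] (fun x => expi (- dotv x y) * f x).

Definition ker_re f x y : R := cos (dotv x y) * Re (f x) + sin (dotv x y) * Im (f x).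
Definition ker_im f x y : R := cos (dotv x y) * Im (f x) - sin (dotv x y) * Re (f x).

Lemma Re_expiN f x y : Re (expi (- dotv x y) * f x) = ker_re f x y.
Proof. by rewrite cReM /= cosN sinN mulNr opprK. Qed.

Lemma Im_expiN f x y : Im (expi (- dotv x y) * f x) = ker_im f x y.
Proof. by rewrite cImM /= cosN sinN mulNr. Qed.

Lemma Re_ft f y : Re (ft f y) = ft_const * \int[mu]_x ker_re f x y.
Proof. by rewrite ReCM /=; congr (_ * _); apply: eq_Rintegral => x _; rewrite Re_expiN. Qed.

Lemma Im_ft f y : Im (ft f y) = ft_const * \int[mu]_x ker_im f x y.
Proof. by rewrite ImCM /=; congr (_ * _); apply: eq_Rintegral => x _; rewrite Im_expiN. Qed.

Lemma ft_const_gt0 : 0 < ft_const.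
Proof. by rewrite powR_gt0// mulr_gt0// pi_gt0. Qed.

Lemma ft_const_sqr : ft_const ^+ 2 * (2 * pi) ^+ d = 1.
Proof.
have p0 : 0 < 2 * pi :> R by rewrite mulr_gt0// pi_gt0.
rewrite -(powR_mulrn d) ?(ltW p0)// -(powR_mulrn 2) ?powR_ge0// -powRrM -powRD.
  by rewrite (_ : _ + _ = 0) ?powRr0//; field.
by rewrite (gt_eqF p0) implybT.
Qed.

Lemma dotvBl x x' y : dotv (x - x') y = dotv x y - dotv x' y.
Proof. by rewrite /dotv -sumrB; apply: eq_bigr => i _; rewrite !mxE mulrBl. Qed.

Lemma dotvC x y : dotv x y = dotv y x.
Proof. by apply: eq_bigr => i _; rewrite mulrC. Qed.

Lemma ker_rdot f g x x' y :
  ker_re f x y * ker_re g x' y + ker_im f x y * ker_im g x' y =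
  cos (dotv (x - x') y) * rdot (f x) (g x') +
  sin (dotv (x - x') y) * (Im (f x) * Re (g x') - Re (f x) * Im (g x')).
Proof. by rewrite dotvBl cosB sinB /rdot /ker_re /ker_im; ring. Qed.

Lemma cintegrable_cmeasurable f : cintegrable setT f -> cmeasurable f.
Proof. by move=> [f1 f2]; split; [exact: (intble_meas f1)|exact: (intble_meas f2)]. Qed.

Lemma cintegrableD f g : cintegrable setT f -> cintegrable setT g ->
  cintegrable setT (fun x => f x + g x).
Proof.
move=> [f1 f2] [g1 g2]; split.
  by under eq_fun do rewrite ReD; exact: intbleD.
by under eq_fun do rewrite ImD; exact: intbleD.
Qed.

Lemma cintegrableZ (c : R[i]) f : cintegrable setT f ->
  cintegrable setT (fun x => c * f x).
Proof.
move=> [f1 f2]; split.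
  by under eq_fun do rewrite cReM; apply: intbleB; exact: intbleZ.
by under eq_fun do rewrite cImM; apply: intbleD; exact: intbleZ.
Qed.

Lemma cintegrable_rdot2 f g : cintegrable setT f -> cintegrable setT g ->
  intble mu2 (fun z => rdot (f z.1) (g z.2)).
Proof. by move=> [f1 f2] [g1 g2]; exact: (intbleD (intble_prod f1 g1) (intble_prod f2 g2)). Qed.

Lemma measurable_ker f : cmeasurable f ->
  measurable_fun setT (fun z : 'rV[R]_d * 'rV[R]_d => ker_re f z.2 z.1) /\
  measurable_fun setT (fun z : 'rV[R]_d * 'rV[R]_d => ker_im f z.2 z.1).
Proof.
move=> [mr mi]; pose D (z : 'rV[R]_d * 'rV[R]_d) := dotv z.2 z.1.
have mD : measurable_fun setT D.
  by apply: measurable_dotv; [exact: measurable_snd|exact: measurable_fst].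
have mc : measurable_fun setT (cos \o D) by exact: measurableT_comp (@measurable_cosR R) mD.
have ms : measurable_fun setT (sin \o D) by exact: measurableT_comp (@measurable_sinR R) mD.
have m1 : measurable_fun setT (fun z : 'rV[R]_d * 'rV[R]_d => Re (f z.2)).
  exact: measurableT_comp mr measurable_snd.
have m2 : measurable_fun setT (fun z : 'rV[R]_d * 'rV[R]_d => Im (f z.2)).
  exact: measurableT_comp mi measurable_snd.
by split; [apply: measurable_funD|apply: measurable_funB]; exact: measurable_funM.
Qed.

Lemma ker_int f y : cintegrable setT f ->
  intble mu (fun x => ker_re f x y) /\ intble mu (fun x => ker_im f x y).
Proof.
move=> [f1 f2]; have mD : measurable_fun setT (fun x => dotv x y) by exact: measurable_dotv.
have mc : measurable_fun setT (fun x => cos (dotv x y)).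
  exact: measurableT_comp (@measurable_cosR R) mD.
have ms : measurable_fun setT (fun x => sin (dotv x y)).
  exact: measurableT_comp (@measurable_sinR R) mD.
by split; [apply: intbleD|apply: intbleB];
  (apply: (@intble_bdM _ _ _ mu 1) => // x; rewrite ?cos_max ?sin_max).
Qed.

Lemma ft_cmeasurable f : cmeasurable f -> cmeasurable (ft f).
Proof.
move=> mf; have [m1 m2] := measurable_ker mf; split.
  under eq_fun do rewrite Re_ft; apply: measurable_funM => //.
  exact: (measurable_RI _ m1).
under eq_fun do rewrite Im_ft; apply: measurable_funM => //.
exact: (measurable_RI _ m2).
Qed.

Lemma ft_bounded f : cintegrable setT f -> exists K, forall y, sqmod (ft f y) <= K.
Proof.
move=> fi; have [f1 f2] := fi.
pose I := \int[mu]_x (`|Re (f x)| + `|Im (f x)|).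
exists (2 * (ft_const * I) ^+ 2) => y; have [k1 k2] := ker_int y fi.
have iI : intble mu (fun x => `|Re (f x)| + `|Im (f x)|) by apply: intbleD; exact: intble_norm.
have c0 := ltW ft_const_gt0.
have h1 : `|Re (ft f y)| <= ft_const * I.
  rewrite Re_ft normrM (ger0_norm c0) ler_wpM2l//.
  apply: le_trans (RI_norm k1) _; apply: RI_le => //; first exact: intble_norm.
  move=> x; rewrite (le_trans (ler_normD _ _))// !normrM.
  by apply: lerD; rewrite ler_piMl ?cos_max ?sin_max.
have h2 : `|Im (ft f y)| <= ft_const * I.
  rewrite Im_ft normrM (ger0_norm c0) ler_wpM2l//.
  apply: le_trans (RI_norm k2) _; apply: RI_le => //; first exact: intble_norm.
  move=> x; rewrite (le_trans (ler_normB _ _))// !normrM addrC.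
  by apply: lerD; rewrite ler_piMl ?cos_max ?sin_max.
have I0 : 0 <= ft_const * I by exact: le_trans h1.
rewrite /sqmod mulr2n mulrDl !mul1r -[Re _ ^+ 2]real_normK ?num_real//.
rewrite -[Im _ ^+ 2]real_normK ?num_real//.
by apply: lerD; rewrite ler_pXn2r ?nnegrE.
Qed.

Lemma ftD f g y : cintegrable setT f -> cintegrable setT g ->
  ft (fun x => f x + g x) y = ft f y + ft g y.
Proof.
move=> fi gi; have [f1 f2] := ker_int y fi; have [g1 g2] := ker_int y gi.
apply: complexP.
  rewrite ReD !Re_ft -mulrDr -RID//; congr (_ * _).
  by apply: eq_Rintegral => x _; rewrite /ker_re ReD ImD; ring.
rewrite ImD !Im_ft -mulrDr -RID//; congr (_ * _).
by apply: eq_Rintegral => x _; rewrite /ker_im ReD ImD; ring.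
Qed.

Lemma ftZ (c : R[i]) f y : cintegrable setT f ->
  ft (fun x => c * f x) y = c * ft f y.
Proof.
move=> fi; have [f1 f2] := ker_int y fi.
apply: complexP.
  rewrite (cReM c) !Re_ft Im_ft mulrCA [X in _ - X]mulrCA -mulrBr; congr (_ * _).
  rewrite -!RIZ// -RIB; [|exact: intbleZ..].
  by apply: eq_Rintegral => x _; rewrite /ker_re /ker_im cReM cImM; ring.
rewrite (cImM c) !Im_ft Re_ft mulrCA [X in _ + X]mulrCA -mulrDr; congr (_ * _).
rewrite -!RIZ// -RID; [|exact: intbleZ..].
by apply: eq_Rintegral => x _; rewrite /ker_re /ker_im cReM cImM; ring.
Qed.

Lemma RI_prodM (a b : 'rV[R]_d -> R) : intble mu a -> intble mu b ->
  \int[mu]_x a x * \int[mu]_y b y = \int[mu2]_z (a z.1 * b z.2).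
Proof.
move=> ia ib; rewrite -(RI_prod (intble_prod ia ib))/=.
under [RHS]eq_Rintegral do rewrite RIZ//.
by rewrite RintegralZr.
Qed.

Let cross f g (z : 'rV[R]_d * 'rV[R]_d) : R :=
  Im (f z.1) * Re (g z.2) - Re (f z.1) * Im (g z.2).

Let integrable_cross f g : cintegrable setT f -> cintegrable setT g ->
  intble mu2 (cross f g).
Proof. by move=> [f1 f2] [g1 g2]; exact: (intbleB (intble_prod f2 g1) (intble_prod f1 g2)). Qed.

(** For an even weight this is the convolution kernel of the multiplier w. The constant is squared
    because two transforms are multiplied in [ft_weight]. *)
Definition cos_transform (w : 'rV[R]_d -> R) z : R :=
  ft_const ^+ 2 * \int[mu]_y (w y * cos (dotv z y)).
Definition sin_transform (w : 'rV[R]_d -> R) z : R :=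
  ft_const ^+ 2 * \int[mu]_y (w y * sin (dotv z y)).

Lemma intble_cos_transform (w : 'rV[R]_d -> R) z : intble mu w ->
  intble mu (fun y => w y * cos (dotv z y)) /\ intble mu (fun y => w y * sin (dotv z y)).
Proof.
move=> wi; have mz : measurable_fun setT (fun y => dotv z y) by exact: measurable_dotv.
have H (s : 'rV[R]_d -> R) : measurable_fun setT s -> (forall y, `|s y| <= 1) ->
    intble mu (fun y => w y * s y).
  by move=> ms s1; under eq_fun do rewrite mulrC; exact: intble_bdM ms s1 wi.
split; apply: H => [|y]; rewrite ?cos_max ?sin_max//.
  exact: measurableT_comp (@measurable_cosR R) mz.
exact: measurableT_comp (@measurable_sinR R) mz.
Qed.

(** Fubini in three variables: the integral in y of w against the oscillating kernels is done first.
    Gaussian weights lead to Plancherel, the weight exp(-t sigma) to the heat kernel. *)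
Lemma ft_weight f g (w : 'rV[R]_d -> R) : intble mu w ->
  cintegrable setT f -> cintegrable setT g ->
  \int[mu]_y (w y * rdot (ft f y) (ft g y)) =
  \int[mu2]_z (cos_transform w (z.1 - z.2) * rdot (f z.1) (g z.2) +
     sin_transform w (z.1 - z.2) *
       (Im (f z.1) * Re (g z.2) - Re (f z.1) * Im (g z.2))).
Proof.
move=> wi fi gi; have iP := cintegrable_rdot2 fi gi; have iQ := integrable_cross fi gi.
have mw := intble_meas wi.
pose F (p : 'rV[R]_d * ('rV[R]_d * 'rV[R]_d)) : R := w p.1 *
  (cos (dotv (p.2.1 - p.2.2) p.1) * rdot (f p.2.1) (g p.2.2) +
   sin (dotv (p.2.1 - p.2.2) p.1) * cross f g p.2).
have mD : measurable_fun setT (fun p : 'rV[R]_d * ('rV[R]_d * 'rV[R]_d) =>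
    dotv (p.2.1 - p.2.2) p.1).
  apply: measurable_dotv; last exact: measurable_fst.
  exact: measurableT_comp (@measurable_subv R d) measurable_snd.
have mF : measurable_fun setT F.
  apply: measurable_funM; first exact: measurableT_comp mw measurable_fst.
  apply: measurable_funD; apply: measurable_funM.
  - exact: measurableT_comp (@measurable_cosR R) mD.
  - exact: measurableT_comp (intble_meas iP) measurable_snd.
  - exact: measurableT_comp (@measurable_sinR R) mD.
  - exact: measurableT_comp (intble_meas iQ) measurable_snd.
have iF : intble (mu \x prod_sf mu mu)%E F.
  have iG := @intble_prod _ _ 'rV[R]_d ('rV[R]_d * 'rV[R]_d)%type _ mu (prod_sf mu mu) _ _
    (intble_norm wi) (intbleD (intble_norm iP) (intble_norm iQ)).
  apply: (intble_le mF _ iG) => p.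
  rewrite normrM ler_wpM2l// (le_trans (ler_normD _ _))// !normrM.
  by apply: lerD; rewrite ler_piMl ?cos_max ?sin_max.
have E1 y : w y * rdot (ft f y) (ft g y) = ft_const ^+ 2 * \int[mu2]_z F (y, z).
  have [f1 f2] := ker_int y fi; have [g1 g2] := ker_int y gi.
  rewrite /rdot !Re_ft !Im_ft.
  have -> : forall a b c d' e : R, a * b * (a * c) + a * d' * (a * e) = a ^+ 2 * (b * c + d' * e).
    by move=> *; ring.
  have ip1 := intble_prod f1 g1; have ip2 := intble_prod f2 g2.
  rewrite (RI_prodM f1 g1) (RI_prodM f2 g2) -(RID ip1 ip2).
  rewrite mulrCA; congr (_ * _); rewrite -(RIZ _ (intbleD ip1 ip2)).
  by apply: eq_Rintegral => z _; rewrite ker_rdot.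
under eq_Rintegral do rewrite E1.
rewrite RIZ; last exact: (intble_RI iF).
rewrite (RI_fubini iF) -RIZ; last first.
  exact: (intble_RI (intble_swap iF)).
apply: eq_Rintegral => z _; rewrite /F /=.
have [i1 i2] := intble_cos_transform (z.1 - z.2) wi.
under eq_Rintegral do rewrite mulrDr mulrA (mulrA _ (sin _)) mulrC
  (mulrC _ (cross f g z)).
rewrite (RID (intbleZ _ i1) (intbleZ _ i2)) (RIZ _ i1) (RIZ _ i2).
by rewrite /cos_transform /sin_transform /cross; ring.
Qed.

Lemma ft_weight_real (a b w : 'rV[R]_d -> R) : intble mu w -> intble mu a -> intble mu b ->
  \int[mu]_y (w y * rdot (ft (fun x => (a x)%:C%C) y) (ft (fun x => (b x)%:C%C) y)) =
  \int[mu2]_z (cos_transform w (z.1 - z.2) * (a z.1 * b z.2)).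
Proof.
move=> wi ai bi; rewrite ft_weight//; [|by split => //; exact: intble0..].
apply: eq_Rintegral => z _.
by rewrite /rdot /= !(mul0r, mulr0) subr0 mulr0 !addr0.
Qed.

Lemma ft_gauss f g (u : R) : 0 < u -> cintegrable setT f -> cintegrable setT g ->
  \int[mu]_y (gauss_rV u y * rdot (ft f y) (ft g y)) =
  \int[mu2]_z (heat_rV u (z.1 - z.2) * rdot (f z.1) (g z.2)).
Proof.
move=> u0 fi gi; rewrite (ft_weight (intble_gauss_rV d u0) fi gi).
apply: eq_Rintegral => z _; have [h1 h2] := gauss_rV_ft (z.1 - z.2) u0.
by rewrite /cos_transform /sin_transform h1 h2 mulr0 mul0r addr0 mulrA ft_const_sqr mul1r.
Qed.

Lemma gauss_rV_cvg y : gauss_rV (harm R n) y @[n --> \oo] --> (1 : R).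
Proof.
rewrite -expR0; apply: continuous_cvg; first exact: continuous_expR.
rewrite -oppr0; apply: cvgN; rewrite -(mul0r (dotv y y)); apply: cvgMl.
exact: cvg_harmonic.
Qed.

Lemma intble_gauss_ft f (u : R) : 0 < u -> cintegrable setT f ->
  intble mu (fun y => gauss_rV u y * sqmod (ft f y)).
Proof.
move=> u0 fi; have [K Kf] := ft_bounded fi.
under eq_fun do rewrite mulrC.
apply: (@intble_bdM _ _ _ mu K) (intble_gauss_rV d u0).
  exact: (cmeasurable_sqmod (ft_cmeasurable (cintegrable_cmeasurable fi))).
by move=> x; rewrite ger0_norm ?sqmod_ge0.
Qed.

Lemma L1_bounded_L2 f K : cintegrable setT f -> (forall x, sqmod (f x) <= K) -> L2 f.
Proof.
move=> fi fK; have mf := cintegrable_cmeasurable fi; have [f1 f2] := fi.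
apply: L2P => //.
apply: (intble_le _ _ (intbleZ (K + 1) (intbleD (intble_norm f1) (intble_norm f2)))).
  exact: cmeasurable_sqmod.
move=> x; rewrite ger0_norm ?sqmod_ge0// /sqmod mulrDr.
have K0 : 0 <= K by exact: le_trans (sqmod_ge0 (f x)) (fK x).
have H (t : R) : t ^+ 2 <= K -> t ^+ 2 <= (K + 1) * `|t|.
  move=> tK; rewrite -real_normK ?num_real// expr2 ler_wpM2r//.
  have [t1|t1] := leP `|t| 1; first by rewrite (le_trans t1)// lerDr.
  apply: (@le_trans _ _ (`|t| ^+ 2)); first by rewrite expr2 ler_peMl// ltW.
  by rewrite real_normK ?num_real// (le_trans tK)// lerDl.
apply: lerD; apply: H.
  exact: le_trans (sqr_Re_le _) (fK x).
exact: le_trans (sqr_Im_le _) (fK x).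
Qed.

(** A Gaussian factor is inserted and removed: on the Fourier side by monotone convergence, on the
    position side by [heat_weak_approx], which is where boundedness of f enters. *)
Lemma plancherel_bounded f K : cintegrable setT f -> (forall x, sqmod (f x) <= K) ->
  L2 (ft f) /\ rip (ft f) (ft f) = rip f f.
Proof.
move=> fi fK; have Lf := L1_bounded_L2 fi fK; have [f1 f2] := fi.
have mft := ft_cmeasurable (cintegrable_cmeasurable fi).
have lim : \int[mu]_y (gauss_rV (harm R n) y * sqmod (ft f y)) @[n --> \oo] --> rip f f.
  rewrite (_ : (fun n => _) = (fun n =>
      \int[mu2]_z (heat_rV (harm R n) (z.1 - z.2) * (Re (f z.1) * Re (f z.2))) +
      \int[mu2]_z (heat_rV (harm R n) (z.1 - z.2) * (Im (f z.1) * Im (f z.2))))).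
    have i1 : intble mu (fun x => Re (f x) * Re (f x)).
      apply: intble_le (L2_intble Lf); first by apply: measurable_funM; exact: (intble_meas f1).
      by move=> x; rewrite ger0_norm -expr2 ?sqr_ge0// sqr_Re_le.
    have i2 : intble mu (fun x => Im (f x) * Im (f x)).
      apply: intble_le (L2_intble Lf); first by apply: measurable_funM; exact: (intble_meas f2).
      by move=> x; rewrite ger0_norm -expr2 ?sqr_ge0// sqr_Im_le.
    rewrite /rip RID//.
    have K0 : 0 <= K by exact: le_trans (sqmod_ge0 (f 0)) (fK 0).
    have b (t : R) x : t ^+ 2 <= sqmod (f x) -> `|t| <= Num.sqrt K.
      by move=> h; rewrite -sqrtr_sqr ler_wsqrtr// (le_trans h).
    apply: cvgD.
      by apply: (@heat_weak_approx _ _ _ (Num.sqrt K)) => // x; apply: b; exact: sqr_Re_le.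
    by apply: (@heat_weak_approx _ _ _ (Num.sqrt K)) => // x; apply: b; exact: sqr_Im_le.
  apply/funext => n; have u0 := harm_gt0 R n.
  rewrite (ft_gauss u0 fi fi) -RID; [|exact: (intble_heat2 u0 f1 f1)|exact: (intble_heat2 u0 f2 f2)].
  by apply: eq_Rintegral => z _; rewrite -mulrDr.
(* The Gaussians increase to 1, so this limit is available before the transform is known to be
   square-integrable. *)
have mc : (\int[mu]_y (gauss_rV (harm R n) y * sqmod (ft f y))%:E @[n --> \oo] -->
    \int[mu]_y (sqmod (ft f y))%:E)%E.
  have -> : (\int[mu]_y (sqmod (ft f y))%:E)%E = (\int[mu]_y
      limn (fun n => (gauss_rV (harm R n) y * sqmod (ft f y))%:E))%E.
    apply: eq_integral => y _; apply/esym/cvg_lim => //; apply: cvg_EFin; first exact: nearW.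
    by rewrite -[X in _ --> X]mul1r; apply: cvgMl; exact: gauss_rV_cvg.
  apply: (@cvg_monotone_convergence _ _ _ mu setT measurableT
    (fun n y => (gauss_rV (harm R n) y * sqmod (ft f y))%:E)).
  - move=> n; apply/measurable_EFinP/measurable_funM.
      exact: measurable_gauss_rV.
    exact: cmeasurable_sqmod.
  - by move=> n y _; rewrite lee_fin mulr_ge0 ?sqmod_ge0 ?(ltW (gauss_rV_gt0 _ _)).
  - move=> y _ n m nm; rewrite lee_fin ler_wpM2r ?sqmod_ge0// ler_expR lerN2.
    by rewrite ler_wpM2r ?dotv_ge0// /harm lef_pV2 ?posrE// ler_nat ltnS.
have E : (\int[mu]_y (sqmod (ft f y))%:E)%E = (rip f f)%:E.
  apply: (cvg_unique _ mc) => //.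
  have -> : (fun n => \int[mu]_y (gauss_rV (harm R n) y * sqmod (ft f y))%:E)%E =
    (fun n => (\int[mu]_y (gauss_rV (harm R n) y * sqmod (ft f y)))%:E).
    by apply/funext => n; rewrite EFin_RI//; exact: intble_gauss_ft (harm_gt0 R n) fi.
  by apply: cvg_EFin => //; exact: nearW.
have Lft : L2 (ft f) by split => //; rewrite /sqL2norm E ltry.
by split => //; apply/EFin_inj; rewrite -E -sqL2normE.
Qed.

End fourier_L1.

(** * Plancherel's theorem on the intersection of L^1 and L^2 *)

Section plancherel.
Context (R : realType) (d : nat).
Notation mu := (lebesgue_rV R d).
Notation mu2 := (lebesgue_rV R d \x lebesgue_rV R d)%E.
Implicit Types (f g h : 'rV[R]_d -> R[i]) (x y : 'rV[R]_d) (n : nat).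

Definition cutoff n x : R := if enorm x <= n%:R then 1 else 0.

Lemma measurable_cutoff n : measurable_fun setT (cutoff n).
Proof.
by apply: measurable_fun_ifT => //; apply: measurable_fun_ler => //; exact: measurable_enorm.
Qed.

Lemma cutoff_ge0 n x : 0 <= cutoff n x. Proof. by rewrite /cutoff; case: ifP. Qed.

Lemma cutoff_le1 n x : cutoff n x <= 1. Proof. by rewrite /cutoff; case: ifP. Qed.

(** On the ball of radius n, exp(n^2) exp(-|x|^2) is at least 1; this replaces computing the volume
    of the ball. *)
Lemma intble_cutoff n : intble mu (cutoff n).
Proof.
apply: (intble_le _ _ (intbleZ (expR (n%:R ^+ 2)) (intble_gauss_rV d (ltr01 : 0 < 1 :> R)))).
  exact: measurable_cutoff.
move=> x; rewrite ger0_norm ?cutoff_ge0// /cutoff.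
case: ifP => xn; last by rewrite mulr_ge0 ?expR_ge0 ?(ltW (gauss_rV_gt0 _ _)).
rewrite /gauss_rV -expRD -[leLHS]expR0 ler_expR (mul1r (dotv x x)) subr_ge0 -sqr_enorm.
by rewrite ler_pXn2r ?nnegrE ?sqrtr_ge0.
Qed.

Lemma cutoff_cvg x : \forall n \near \oo, cutoff n x = 1.
Proof.
exists (Num.truncn (enorm x)).+1 => // n /= h; rewrite /cutoff.
rewrite ifT//.
by rewrite (le_trans (ltW (truncnS_gt _)))// ler_nat.
Qed.

Definition trunc f n x : R[i] := (cutoff n x)%:C%C * f x.

Lemma fourier_truncE f n y : fourier_trunc f n y = ft (trunc f n) y.
Proof.
rewrite /fourier_trunc /ft /ft_const /cintegral; congr (_ * _).
have E x : expi (- dotv x y) * trunc f n x =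
    (cutoff n x)%:C%C * (expi (- dotv x y) * f x) by rewrite mulrCA.
have E2 (k : 'rV[R]_d -> R) x : (k \_ [set x | enorm x <= n%:R]) x = cutoff n x * k x.
  rewrite patchE /cutoff; case: ifPn => [/set_mem/= ->|/negP h]; first by rewrite mul1r.
  by case: ifP => h'; [case: h; exact/mem_set|rewrite mul0r].
apply: complexP; rewrite [LHS]Rintegral_mkcond; apply: eq_Rintegral => x _.
  by rewrite E2 E ReCM.
by rewrite E2 E ImCM.
Qed.

Lemma cmeasurable_trunc f n : cmeasurable f -> cmeasurable (trunc f n).
Proof. by move=> mf; apply: cmeasurableM => //; exact: (cmeasurableR (measurable_cutoff n)). Qed.

Lemma L2_trunc f n : L2 f -> L2 (trunc f n).
Proof.
apply: (L2M_bounded (K := 1)); first exact: (cmeasurableR (measurable_cutoff n)).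
by move=> x; rewrite /sqmod /= /cutoff; case: ifP => _; rewrite ?expr0n ?expr1n ?expr0n ?addr0.
Qed.

Lemma cintegrable_trunc f n : L2 f -> cintegrable setT (trunc f n).
Proof.
move=> Lf; have [m1 m2] := cmeasurable_trunc n Lf.1.
have iF := intbleD (intble_cutoff n) (L2_intble Lf).
have H (t s : R) x : t ^+ 2 <= s -> `|cutoff n x * t| <= cutoff n x + s.
  move=> ts; have s0 : 0 <= s by rewrite (le_trans (sqr_ge0 t)).
  rewrite /cutoff; case: ifP => _; rewrite ?mul0r ?normr0 ?add0r// mul1r.
  have := sqr_ge0 (`|t| - 1); rewrite sqrrB expr1n mulr1 real_normK ?num_real//.
  have := normr_ge0 t; lra.
split; apply: (intble_le _ _ iF) => // x.
  by rewrite ReCM; apply: H; exact: sqr_Re_le.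
by rewrite ImCM; apply: H; exact: sqr_Im_le.
Qed.

Lemma rip_sub_cvg0 f (c : nat -> 'rV[R]_d -> R) : L2 f ->
  (forall n, measurable_fun setT (c n)) -> (forall n x, 0 <= c n x <= 1) ->
  (forall x, \forall n \near \oo, c n x = 1) ->
  rip (fun x => f x - (c n x)%:C%C * f x) (fun x => f x - (c n x)%:C%C * f x)
    @[n --> \oo] --> (0 : R).
Proof.
move=> Lf mc c01 c1.
have E n x : f x - (c n x)%:C%C * f x = (1 - c n x)%:C%C * f x.
  by apply: complexP; rewrite ?ReD ?ImD ?ReN ?ImN !(ReCM, ImCM); ring.
rewrite [X in _ --> X](_ : 0 = \int[mu]_x (0 : R)); last by rewrite RI0.
apply: (RI_dct _ _ (L2_intble Lf) _ _).2.
- move=> n; apply: cmeasurable_rdot; apply: cmeasurableD => //; try exact: Lf.1.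
    by rewrite /=; under eq_fun do rewrite -mulN1r; apply: cmeasurableM;
     [exact: cmeasurable_cst|apply: cmeasurableM; [exact: cmeasurableR|exact: Lf.1]].
  by rewrite /=; under eq_fun do rewrite -mulN1r; apply: cmeasurableM;
     [exact: cmeasurable_cst|apply: cmeasurableM; [exact: cmeasurableR|exact: Lf.1]].
- exact: measurable_cst.
- move=> n x; rewrite E -sqmodE ger0_norm ?sqmod_ge0// sqmodCM.
  have := c01 n x => /andP[h0 h1]; have h2 : 0 <= 1 - c n x by rewrite subr_ge0.
  by rewrite ler_piMl ?sqmod_ge0// expr_le1// lerBlDl lerDr.
- apply: aeW => x; apply: cvg_near_cst; apply: filterS (c1 x) => n cn.
  by rewrite E cn subrr mul0r /rdot /= mul0r addr0.
Qed.

(** Truncation by the size of the value, reducing to bounded functions; [cutoff] truncates in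
    space. *)
Let bcut f n x : R := if sqmod (f x) <= n%:R then 1 else 0.

Let mbcut f n : cmeasurable f -> measurable_fun setT (bcut f n).
Proof.
move=> mf; apply: measurable_fun_ifT => //; apply: measurable_fun_ler => //.
exact: cmeasurable_sqmod.
Qed.

Let bcut01 f n x : 0 <= bcut f n x <= 1.
Proof. by rewrite /bcut; case: ifP; rewrite ?lexx ?ler01. Qed.

Let bcut1 f x : \forall n \near \oo, bcut f n x = 1.
Proof.
exists (Num.truncn (sqmod (f x))).+1 => // n /= h; rewrite /bcut.
rewrite ifT//.
by rewrite (le_trans (ltW (truncnS_gt _)))// ler_nat.
Qed.

Let btr f n x := (bcut f n x)%:C%C * f x.

Let cintegrable_btr f n : cintegrable setT f -> cintegrable setT (btr f n).
Proof.
move=> fi; have mf := cintegrable_cmeasurable fi; have [f1 f2] := fi.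
have b1 x : `|bcut f n x| <= 1.
  by have /andP[b0 b1] := bcut01 f n x; rewrite ger0_norm.
split.
  under eq_fun do rewrite ReCM; exact: intble_bdM (mbcut n mf) b1 f1.
under eq_fun do rewrite ImCM; exact: intble_bdM (mbcut n mf) b1 f2.
Qed.

Let btr_bounded f n x : sqmod (btr f n x) <= n%:R.
Proof.
rewrite sqmodCM /bcut; case: ifP => h; rewrite ?expr0n ?mul0r//.
by rewrite expr1n mul1r.
Qed.

Let ft_btr f y : cintegrable setT f -> sqmod (ft (btr f n) y) @[n --> \oo] --> sqmod (ft f y).
Proof.
move=> fi; have mf := cintegrable_cmeasurable fi; have [f1 f2] := fi.
have [k1 k2] := ker_int y fi.
have b1 n x : `|bcut f n x| <= 1.
  by have /andP[b0 b1] := bcut01 f n x; rewrite ger0_norm.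
have E1 n x : ker_re (btr f n) x y = bcut f n x * ker_re f x y.
  by rewrite /ker_re ReCM ImCM; ring.
have E2 n x : ker_im (btr f n) x y = bcut f n x * ker_im f x y.
  by rewrite /ker_im ReCM ImCM; ring.
have H (k : 'rV[R]_d -> R) : intble mu k ->
    \int[mu]_x (bcut f n x * k x) @[n --> \oo] --> \int[mu]_x k x.
  move=> ki; apply: (RI_dct _ (intble_meas ki) (intble_norm ki) _ _).2.
  - by move=> n; apply: measurable_funM; [exact: mbcut|exact: (intble_meas ki)].
  - by move=> n x; rewrite normrM ler_piMl.
  - apply: aeW => x; apply: cvg_near_cst; apply: filterS (bcut1 f x) => n ->.
    by rewrite mul1r.
rewrite /sqmod; apply: cvgD.
  apply: (@cvg_comp _ _ _ (fun n => Re (ft (btr f n) y)) (fun t => t ^+ 2)); last exact: exprn_continuous.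

  rewrite (_ : (fun n => _) = (fun n => ft_const R d * \int[mu]_x (bcut f n x * ker_re f x y))); last first.
  by apply/funext => n; rewrite Re_ft; congr (_ * _); apply: eq_Rintegral => x _.
rewrite Re_ft; apply: cvgMr; exact: H.
  apply: (@cvg_comp _ _ _ (fun n => Im (ft (btr f n) y)) (fun t => t ^+ 2)); last exact: exprn_continuous.

rewrite (_ : (fun n => _) = (fun n => ft_const R d * \int[mu]_x (bcut f n x * ker_im f x y))); last first.
  by apply/funext => n; rewrite Im_ft; congr (_ * _); apply: eq_Rintegral => x _.
rewrite Im_ft; apply: cvgMr; exact: H.
Qed.

(** The transforms of the bounded truncations converge pointwise, so Fatou's lemma gives a
    contraction; equality is left to [plancherel]. *)
Let plancherel_le f : cintegrable setT f -> L2 f ->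
  L2 (ft f) /\ rip (ft f) (ft f) <= rip f f.
Proof.
move=> fi Lf; have mft := ft_cmeasurable (cintegrable_cmeasurable fi).
have mf := cintegrable_cmeasurable fi.
have H : (\int[mu]_y (sqmod (ft f y))%:E <= (rip f f)%:E)%E.
  have -> : (\int[mu]_y (sqmod (ft f y))%:E = \int[mu]_y
      limn_einf (fun n => (sqmod (ft (btr f n) y))%:E))%E.
    apply: eq_integral => y _; apply/esym; apply: (cvg_limn_einf_sup _).1.
    by apply: cvg_EFin; [exact: nearW|exact: ft_btr].
  apply: le_trans (fatou _ _ _ _) _ => //.
  - move=> n; apply/measurable_EFinP.
    exact: (cmeasurable_sqmod (ft_cmeasurable (cintegrable_cmeasurable (cintegrable_btr n fi)))).
  - by move=> n x _; rewrite lee_fin sqmod_ge0.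
  have HH n : (\int[mu]_y (sqmod (ft (btr f n) y))%:E <= (rip f f)%:E)%E.
    have [L E] := plancherel_bounded (cintegrable_btr n fi) (btr_bounded f n).
    rewrite -/(sqL2norm _) sqL2normE// E lee_fin; apply: RI_le.
    - exact: (L2_intble (L1_bounded_L2 (cintegrable_btr n fi) (btr_bounded f n))).
    - exact: L2_intble.
    move=> x; rewrite -!sqmodE sqmodCM ler_piMl ?sqmod_ge0//.
    by have /andP[b0 b1] := bcut01 f n x; rewrite expr_le1.
  rewrite limn_einf_lim; apply: lime_le; first exact: is_cvg_einfs.
  by apply: nearW => n; apply: le_trans (HH n); apply: ereal_inf_lbound; exists n => /=.
have L : L2 (ft f) by split => //; apply: le_lt_trans H _; rewrite ltry.
by split => //; rewrite -lee_fin -sqL2normE.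
Qed.

Lemma ftB f g y : cintegrable setT f -> cintegrable setT g ->
  ft (fun x => f x - g x) y = ft f y - ft g y.
Proof.
move=> fi gi; under eq_fun do rewrite -[X in _ + X]mulN1r.
by rewrite ftD ?ftZ ?mulN1r//; exact: cintegrableZ.
Qed.

Lemma cintegrableB f g : cintegrable setT f -> cintegrable setT g ->
  cintegrable setT (fun x => f x - g x).
Proof.
move=> fi gi; under eq_fun do rewrite -[X in _ + X]mulN1r.
by apply: cintegrableD => //; exact: cintegrableZ.
Qed.

(** The contraction applied to f - btr f n shows that the transforms of the truncations converge in
    norm, and the equality of norms passes to the limit. *)
Theorem plancherel f : cintegrable setT f -> L2 f ->
  L2 (ft f) /\ rip (ft f) (ft f) = rip f f.
Proof.
move=> fi Lf; have [L _] := plancherel_le fi Lf; split => //.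
have mf := cintegrable_cmeasurable fi.
have Lb n := L1_bounded_L2 (cintegrable_btr n fi) (btr_bounded f n).
have P n := plancherel_bounded (cintegrable_btr n fi) (btr_bounded f n).
have c0 : rip (fun x => f x - btr f n x) (fun x => f x - btr f n x) @[n --> \oo] --> (0 : R).
  by apply: rip_sub_cvg0 => // n; exact: mbcut.
have c1 := rip_cvg Lb Lf c0.
have c2 : rip (fun y => ft f y - ft (btr f n) y) (fun y => ft f y - ft (btr f n) y)
    @[n --> \oo] --> (0 : R).
  apply: (@squeeze_cvgr _ _ _ _ (fun=> 0)) c0; last exact: cvg_cst.
  apply: nearW => n; rewrite rip_ge0/=.
  have := (plancherel_le (cintegrableB fi (cintegrable_btr n fi)) (L2B Lf (Lb n))).2.
  rewrite (_ : ft (fun x => _) = fun y => ft f y - ft (btr f n) y)//.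
  by apply/funext => y; exact: (ftB _ fi (cintegrable_btr n fi)).
have c3 := rip_cvg (fun n => (P n).1) L c2.
apply: (cvg_unique _ c3) => //.
by rewrite /= (_ : (fun n => _) = (fun n => rip (btr f n) (btr f n)))//;
  apply/funext => n; rewrite (P n).2.
Qed.

End plancherel.

(** * The Fourier transform on L^2: Parseval and inversion *)

Section fourier_transform.
Context (R : realType) (d : nat).
Notation mu := (lebesgue_rV R d).
Notation mu2 := (lebesgue_rV R d \x lebesgue_rV R d)%E.
Implicit Types (f g h : 'rV[R]_d -> R[i]) (x y : 'rV[R]_d) (n : nat).

Lemma fourierP f g : is_fourier f g <-> [/\ L2 f, L2 g &
  rip (fun y => g y - ft (trunc f n) y) (fun y => g y - ft (trunc f n) y)
    @[n --> \oo] --> (0 : R)].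
Proof.
have H : L2 f -> L2 g -> (fun n => sqL2norm (fun y => g y - fourier_trunc f n y)) =
    (fun n => (rip (fun y => g y - ft (trunc f n) y) (fun y => g y - ft (trunc f n) y))%:E).
  move=> Lf Lg; apply/funext => n.
  rewrite (_ : fourier_trunc f n = ft (trunc f n)); last exact/funext/fourier_truncE.
  apply: sqL2normE; apply: L2B => //.
  exact: (plancherel (cintegrable_trunc n Lf) (L2_trunc n Lf)).1.
split=> -[Lf Lg].
  by rewrite H// => fg; split => //; exact: (fine_cvg fg).
by move=> fg; split => //; rewrite H//; apply: cvg_EFin => //; exact: nearW.
Qed.

Lemma fourier_isometry f g : is_fourier f g -> rip g g = rip f f.
Proof.
move=> /fourierP[Lf Lg fg].
have P n := plancherel (cintegrable_trunc n Lf) (L2_trunc n Lf).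
have c1 := rip_cvg (fun n => (P n).1) Lg fg.
have c2 : rip (trunc f n) (trunc f n) @[n --> \oo] --> rip f f.
  apply: rip_cvg => //; first by move=> n; exact: L2_trunc.
  apply: rip_sub_cvg0 => //.
  - exact: measurable_cutoff.
  - by move=> n x; rewrite cutoff_ge0 cutoff_le1.
  - exact: cutoff_cvg.
apply: (cvg_unique _ c1) => //; rewrite /=.
rewrite (_ : (fun n => _) = (fun n => rip (trunc f n) (trunc f n)))//.
by apply/funext => n; rewrite (P n).2.
Qed.

Lemma rip_subD_le f g f' g' : L2 f -> L2 g -> L2 f' -> L2 g' ->
  rip (fun x => f x + g x - (f' x + g' x)) (fun x => f x + g x - (f' x + g' x)) <=
  2 * rip (fun x => f x - f' x) (fun x => f x - f' x) +
  2 * rip (fun x => g x - g' x) (fun x => g x - g' x).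
Proof.
move=> Lf Lg Lf' Lg'.
have L1 := L2B Lf Lf'; have L2' := L2B Lg Lg'.
have I1 := L2_rdot L1 L1; have I2 := L2_rdot L2' L2'.
rewrite /rip -(RIZ 2 I1) -(RIZ 2 I2) -(RID (intbleZ 2 I1) (intbleZ 2 I2)).
apply: RI_le.
- by apply: L2_rdot; apply: L2B; exact: L2D.
- by apply: intbleD; exact: intbleZ.
move=> x; rewrite (_ : f x + g x - (f' x + g' x) = (f x - f' x) + (g x - g' x)); last first.
  by rewrite opprD addrACA.
move: (f x - f' x) (g x - g' x) => a b; rewrite -!sqmodE.
have := sqmod_ge0 (a - b); rewrite (sqmodD a (- b)) sqmodN rdotNr (sqmodD a b); lra.
Qed.

Lemma fourierD f1 g1 f2 g2 : is_fourier f1 g1 -> is_fourier f2 g2 ->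
  is_fourier (fun x => f1 x + f2 x) (fun y => g1 y + g2 y).
Proof.
move=> /fourierP[Lf1 Lg1 fg1] /fourierP[Lf2 Lg2 fg2]; apply/fourierP.
split; [exact: L2D|exact: L2D|].
have P1 n := plancherel (cintegrable_trunc n Lf1) (L2_trunc n Lf1).
have P2 n := plancherel (cintegrable_trunc n Lf2) (L2_trunc n Lf2).
have E n y : ft (trunc (fun x => f1 x + f2 x) n) y = ft (trunc f1 n) y + ft (trunc f2 n) y.
  rewrite -ftD; [|exact: cintegrable_trunc..].
  by congr (ft _ y); apply/funext => x; rewrite /trunc mulrDr.
apply: (@squeeze_cvgr _ _ _ _ (fun=> 0) (fun n =>
    2 * rip (fun y => g1 y - ft (trunc f1 n) y) (fun y => g1 y - ft (trunc f1 n) y) +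
    2 * rip (fun y => g2 y - ft (trunc f2 n) y) (fun y => g2 y - ft (trunc f2 n) y))).
- apply: nearW => n; rewrite rip_ge0/=.
  rewrite (_ : ft (trunc (fun x => f1 x + f2 x) n) =
    (fun y => ft (trunc f1 n) y + ft (trunc f2 n) y)); last exact/funext/E.
  exact: (rip_subD_le Lg1 Lg2 (P1 n).1 (P2 n).1).
- exact: cvg_cst.
- rewrite [X in _ --> X](_ : 0 = 2 * 0 + 2 * 0 :> R); last by ring.
  have H (u : nat -> R) : u n @[n --> \oo] --> (0 : R) -> 2 * u n @[n --> \oo] --> (2 * 0 : R).
    exact: cvgMr.
  exact: (cvgD (H _ fg1) (H _ fg2)).
Qed.

Lemma fourierZ (c : R[i]) f g : is_fourier f g ->
  is_fourier (fun x => c * f x) (fun y => c * g y).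
Proof.
move=> /fourierP[Lf Lg fg]; apply/fourierP; split; [exact: L2Z|exact: L2Z|].
have E n y : ft (trunc (fun x => c * f x) n) y = c * ft (trunc f n) y.
  rewrite -ftZ; last exact: cintegrable_trunc.
  by congr (ft _ y); apply/funext => x; rewrite /trunc mulrCA.
rewrite (_ : (fun n => _) = (fun n => sqmod c *
  rip (fun y => g y - ft (trunc f n) y) (fun y => g y - ft (trunc f n) y))); last first.
  apply/funext => n; rewrite /rip -RIZ; last first.
    by apply: L2_rdot; apply: L2B => //;
      exact: (plancherel (cintegrable_trunc n Lf) (L2_trunc n Lf)).1.
  by apply: eq_Rintegral => y _; rewrite E -mulrBr -!sqmodE sqmodM.
by rewrite -(mulr0 (sqmod c)); apply: cvgMr.
Qed.

(** Polarisation of the isometry, applied to f1 + f2. *)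
Theorem parseval f1 g1 f2 g2 : is_fourier f1 g1 -> is_fourier f2 g2 ->
  rip g1 g2 = rip f1 f2.
Proof.
move=> fg1 fg2; have [Lf1 Lg1 _] := fg1; have [Lf2 Lg2 _] := fg2.
have := fourier_isometry (fourierD fg1 fg2).
rewrite !ripD_sqr// (fourier_isometry fg1) (fourier_isometry fg2); lra.
Qed.

(** The truncations are eventually equal to f, so the approximating sequence is eventually
    constant. *)
Lemma fourier_ft f m : cmeasurable f -> L2 f ->
  (forall x, m%:R < enorm x -> f x = 0) -> is_fourier f (ft f).
Proof.
move=> mf Lf f0; have E n : (m <= n)%N -> trunc f n = f.
  move=> mn; apply/funext => x; rewrite /trunc /cutoff; case: ifPn; rewrite ?mul1r//.
  rewrite -ltNge => nx; rewrite f0 ?mulr0//; apply: le_lt_trans nx.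
  by rewrite ler_nat.
have := plancherel (cintegrable_trunc m Lf) (L2_trunc m Lf); rewrite E// => -[Lft _].
apply/fourierP; split => //; apply: cvg_near_cst; exists m => // n /= mn.
rewrite E// /rip; under eq_Rintegral do rewrite subrr.
by rewrite /rdot /= mulr0 addr0 RI0.
Qed.

(* the inverse transform, as the adjoint of [ft] *)
Definition ift h x : R[i] := conjc (ft (fun y => conjc (h y)) x).

Lemma cintegrable_conj f : cintegrable setT f -> cintegrable setT (fun x => conjc (f x)).
Proof.
move=> [f1 f2]; split; first by under eq_fun do rewrite ReJ.
by under eq_fun do rewrite ImJ; exact: intbleN.
Qed.

Lemma rip_ift f h : cintegrable setT f -> cintegrable setT h ->
  rip (ift h) f = rip h (ft f).
Proof.
move=> fi hi; have [f1 f2] := fi; have [h1 h2] := hi.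
pose F (z : 'rV[R]_d * 'rV[R]_d) : R :=
  Re (h z.1) * ker_re f z.2 z.1 + Im (h z.1) * ker_im f z.2 z.1.
have [m1 m2] := measurable_ker (cintegrable_cmeasurable fi).
have mF : measurable_fun setT F.
  apply: measurable_funD; apply: measurable_funM => //.
    exact: measurableT_comp (intble_meas h1) measurable_fst.
  exact: measurableT_comp (intble_meas h2) measurable_fst.
have iF : intble mu2 F.
  pose A (k : 'rV[R]_d -> R[i]) x := `|Re (k x)| + `|Im (k x)|.
  have iA k : cintegrable setT k -> intble mu (A k).
    by move=> [k1 k2]; apply: intbleD; exact: intble_norm.
  apply: (intble_le mF _ (intble_prod (iA h hi) (iA f fi))) => z.
  have k1 : `|ker_re f z.2 z.1| <= A f z.2.
    rewrite (le_trans (ler_normD _ _))// !normrM.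
    by apply: lerD; rewrite ler_piMl ?cos_max ?sin_max.
  have k2 : `|ker_im f z.2 z.1| <= A f z.2.
    rewrite (le_trans (ler_normB _ _))// !normrM /A addrC.
    by apply: lerD; rewrite ler_piMl ?cos_max ?sin_max.
  rewrite (le_trans (ler_normD _ _))// !normrM /A mulrDl.
  by apply: lerD; rewrite ler_wpM2l.
have -> : rip h (ft f) = ft_const R d * \int[mu]_y \int[mu]_x F (y, x).
  rewrite -RIZ; last exact: intble_RI.
  apply: eq_Rintegral => y _; have [k1 k2] := ker_int y fi.
  rewrite /rdot Re_ft Im_ft /F.
  rewrite (RID (intbleZ (Re (h y)) k1) (intbleZ (Im (h y)) k2)).
  by rewrite (RIZ _ k1) (RIZ _ k2); ring.
rewrite (RI_fubini iF) -RIZ; last exact: (intble_RI (intble_swap iF)).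
apply: eq_Rintegral => x _; have [k1 k2] := ker_int x (cintegrable_conj hi).
rewrite /rdot ReJ ImJ Re_ft Im_ft.
rewrite mulNr -!mulrA -mulrBr; congr (_ * _).
rewrite mulrC [X in _ - X]mulrC -!RIZ// -RIB; [|exact: intbleZ..].
apply: eq_Rintegral => y _.
by rewrite /F /ker_re /ker_im ReJ ImJ dotvC; ring.
Qed.

Lemma ift_L2 h K : cintegrable setT h -> (forall y, sqmod (h y) <= K) ->
  L2 (ift h) /\ rip (ift h) (ift h) = rip h h.
Proof.
move=> hi hK; have := @plancherel_bounded _ _ (fun y => conjc (h y)) K (cintegrable_conj hi).
move=> [|[mL Loo] E]; first by move=> y; rewrite sqmod_conj.
have rE (a b : R[i]) : rdot (conjc a) (conjc b) = rdot a b.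
  by rewrite /rdot !ReJ !ImJ mulrNN.
have ripE k : rip (fun x => conjc (k x)) (fun x => conjc (k x)) = rip k k.
  by apply: eq_Rintegral => x _; rewrite rE.
split; last by rewrite /ift ripE E ripE.
split; first exact: cmeasurable_conj.
by rewrite /sqL2norm /ift; under eq_integral do rewrite sqmod_conj.
Qed.

(** Let g = ift h with truncations g_n. Convergence of their transforms to h reduces to convergence
    of the norms of g_n to that of g, which equals the norm of h. *)
Theorem fourier_inversion h K : cintegrable setT h -> (forall y, sqmod (h y) <= K) ->
  is_fourier (ift h) h.
Proof.
move=> hi hK; have [Lg Eg] := ift_L2 hi hK; have Lh := L1_bounded_L2 hi hK.
apply/fourierP; split => //.
have P n := plancherel (cintegrable_trunc n Lg) (L2_trunc n Lg).
(* The cross term <h, ft g_n> equals <g, g_n> by adjointness, and this is |g_n|^2 because a cutoff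
   with values 0 and 1 is idempotent. *)
have E n : rip (fun y => h y - ft (trunc (ift h) n) y) (fun y => h y - ft (trunc (ift h) n) y)
    = rip h h - rip (trunc (ift h) n) (trunc (ift h) n).
  rewrite ripB_sqr//; last exact: (P n).1.
  rewrite (P n).2 -(rip_ift (cintegrable_trunc n Lg) hi).
  rewrite (_ : rip (ift h) (trunc (ift h) n) = rip (trunc (ift h) n) (trunc (ift h) n)); last first.
    apply: eq_Rintegral => x _; rewrite !rdotCMr rdotCMl mulrA; congr (_ * _).
    by rewrite /cutoff; case: ifP; rewrite ?mulr1 ?mulr0.
  by ring.
rewrite (_ : (fun n => _) = (fun n => rip h h - rip (trunc (ift h) n) (trunc (ift h) n))); last first.
  by apply/funext => n; exact: E.
rewrite -(subrr (rip h h)); apply: cvgB; first exact: cvg_cst.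
rewrite -Eg; apply: rip_cvg => //; first by move=> n; exact: L2_trunc.
apply: rip_sub_cvg0 => //.
- exact: measurable_cutoff.
- by move=> n x; rewrite cutoff_ge0 cutoff_le1.
- exact: cutoff_cvg.
Qed.

End fourier_transform.

(** * Positivity of the heat kernel *)

(* Writing F(s) for the sum over all integers j of (1 - exp(- b^j s)) q^(-j), one has
   F(b s) = q F(s); with q = b^g this forces F(s) to be nearly proportional to s^g
   when b is close to 1. The two halves of the sum are treated separately. *)
Section log_periodic_sum.
Context (R : realType) (b q : R).
Hypotheses (q1 : 1 < q) (qb : q < b).

Let b1 : 1 < b := lt_trans q1 qb.
Let q0 : 0 < q := lt_trans ltr01 q1.
Let b0 : 0 < b := lt_trans ltr01 b1.

(** [up] carries the indices j >= 0, dominated by q^(-j). [dn] carries the indices -(j+1), so that 0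
    is counted once; there 1 - exp(-x) <= x leaves a geometric series of ratio q/b. *)
Let up (s : R) (j : nat) : R := (1 - expR (- (b ^+ j * s))) / q ^+ j.
Let dn (s : R) (j : nat) : R := (1 - expR (- (s / b ^+ j.+1))) * q ^+ j.+1.

Let exp01 (s : R) : 0 <= s -> 0 <= 1 - expR (- s) <= 1.
Proof.
move=> s0; rewrite lerBlDr lerDl expR_ge0 andbT subr_ge0 -[leRHS]expR0 ler_expR.
by rewrite oppr_le0.
Qed.

Let up_ge0 s j : 0 <= s -> 0 <= up s j.
Proof.
move=> s0; rewrite divr_ge0 ?exprn_ge0 ?(ltW q0)//.
by have /andP[] := exp01 (mulr_ge0 (exprn_ge0 j (ltW b0)) s0).
Qed.

Let dn_ge0 s j : 0 <= s -> 0 <= dn s j.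
Proof.
move=> s0; rewrite mulr_ge0 ?exprn_ge0 ?(ltW q0)//.
by have /andP[] := exp01 (divr_ge0 s0 (exprn_ge0 j.+1 (ltW b0))).
Qed.

Let up_cvg s : 0 <= s -> cvgn (series (up s)).
Proof.
move=> s0; apply: (@series_le_cvg _ _ (geometric 1 q^-1)).
- by move=> n; exact: up_ge0.
- by move=> n /=; rewrite mul1r exprn_ge0// invr_ge0 ltW.
- move=> n /=; rewrite mul1r exprVn ler_piMl ?invr_ge0 ?exprn_ge0 ?(ltW q0)//.
apply: is_cvg_geometric_series; rewrite ger0_norm ?invr_ge0 ?(ltW q0)//.
by rewrite invf_lt1.
Qed.

Let dn_cvg s : 0 <= s -> cvgn (series (dn s)).
Proof.
move=> s0; apply: (@series_le_cvg _ _ (geometric (s * (q / b)) (q / b))).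
- by move=> n; exact: dn_ge0.
- by move=> n /=; rewrite !mulr_ge0 ?exprn_ge0 ?divr_ge0 ?invr_ge0 ?(ltW q0) ?(ltW b0).
- move=> n /=; rewrite -mulrA -exprS expr_div_n mulrA mulrAC ler_wpM2r ?exprn_ge0 ?(ltW q0)//.
  by have := expR_ge1Dx (- (s / b ^+ n.+1)); lra.
apply: is_cvg_geometric_series; rewrite ger0_norm ?divr_ge0 ?(ltW q0) ?(ltW b0)//.
by rewrite ltr_pdivrMr// mul1r.
Qed.

Definition log_periodic_partial (s : R) n : R := series (up s) n + series (dn s) n.

Definition log_periodic (s : R) : R := limn (log_periodic_partial s).

Lemma log_periodic_cvg s : 0 <= s ->
  log_periodic_partial s n @[n --> \oo] --> log_periodic s.
Proof. by move=> s0; apply: is_cvgD; [exact: up_cvg|exact: dn_cvg]. Qed.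

Lemma log_periodicE s : log_periodic_partial s = (fun n => \sum_(0 <= j < n)
  ((q ^+ j)^-1 * (1 - expR (- (b ^+ j * s))) +
   q ^+ j.+1 * (1 - expR (- ((b ^+ j.+1)^-1 * s))))).
Proof.
apply/funext => n; rewrite /log_periodic_partial /series /= -big_split /=.
apply: eq_bigr => j _; rewrite /up /dn mulrC; congr (_ + _).
by rewrite mulrC (mulrC s).
Qed.

Lemma log_periodic_scale s : 0 <= s -> log_periodic (b * s) = q * log_periodic s.
Proof.
move=> s0; have bs0 : 0 <= b * s by rewrite mulr_ge0// ltW.
apply: (cvg_unique _ (log_periodic_cvg bs0)) => //=.
(* Multiplying s by b shifts the index by one, so one term crosses from [dn] to [up]: n+1 terms of
   each become n+2 and n. *)
have E n : log_periodic_partial (b * s) n.+1 =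
    q * (series (up s) n.+2 + series (dn s) n).
  rewrite /log_periodic_partial /series /=.
  have E1 : \sum_(0 <= i < n.+1) up (b * s) i = q * \sum_(0 <= i < n.+1) up s i.+1.
    rewrite mulr_sumr; apply: eq_bigr => i _; rewrite /up (exprSr b) (mulrA (b ^+ i)) (exprS q).
    by rewrite invfM [RHS]mulrCA (mulrA q) mulfV ?gt_eqF// mul1r.
  have E2 : \sum_(0 <= i < n) dn (b * s) i.+1 = q * \sum_(0 <= i < n) dn s i.
    rewrite mulr_sumr; apply: eq_bigr => i _; rewrite /dn (exprS q i.+1) mulrCA; congr (_ * (_ * _)).
    by rewrite (exprS b i.+1) invfM mulrCA !mulrA mulVf ?gt_eqF// mul1r mulrC.
  have E3 : dn (b * s) 0 = q * up s 0.
    by rewrite /dn /up !expr1 !expr0 mul1r divr1 mulrAC mulfV ?gt_eqF// mul1r mulrC.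
  have E4 : \sum_(0 <= i < n.+1) dn (b * s) i = q * (up s 0 + \sum_(0 <= i < n) dn s i).
    by rewrite big_nat_recl// E2 E3 mulrDr.
  have E5 : \sum_(0 <= i < n.+2) up s i = up s 0 + \sum_(0 <= i < n.+1) up s i.+1.
    by rewrite big_nat_recl.
  by rewrite E1 E4 E5; ring.
rewrite -cvg_shiftS (_ : (fun n => _) = (fun n => q * (series (up s) n.+2 + series (dn s) n)));
  last exact/funext/E.
apply: cvgMr.
rewrite /log_periodic /log_periodic_partial limD; [|exact: up_cvg|exact: dn_cvg].
apply: cvgD; last exact: dn_cvg.
rewrite (cvg_shiftS (fun n => series (up s) n.+1)) cvg_shiftS; exact: up_cvg.
Qed.

Lemma log_periodic_le s t : 0 <= s -> s <= t -> log_periodic s <= log_periodic t.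
Proof.
move=> s0 st; have t0 := le_trans s0 st.
apply: ler_lim; [exact: cvgP (log_periodic_cvg s0)|exact: cvgP (log_periodic_cvg t0)|].
apply: nearW => n; rewrite !log_periodicE; apply: ler_sum => j _.
by apply: lerD; rewrite ler_wpM2l ?invr_ge0 ?exprn_ge0 ?(ltW q0)// lerD2l lerN2 ler_expR
  lerN2 ler_wpM2l ?invr_ge0 ?exprn_ge0 ?(ltW b0).
Qed.

Lemma log_periodic_gt0 s : 0 < s -> 0 < log_periodic s.
Proof.
move=> s0; have e0 : 0 < 1 - expR (- s) by rewrite subr_gt0 -expR0 ltr_expR oppr_lt0.
apply: lt_le_trans e0 _; apply: limr_ge; first exact: cvgP (log_periodic_cvg (ltW s0)).
exists 1%N => // n /= n1; rewrite log_periodicE -(prednK n1) big_nat_recl//=.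
rewrite !expr0 invr1 !mul1r -addrA lerDl addr_ge0//.
  rewrite mulr_ge0 ?exprn_ge0 ?(ltW q0)//.
  by rewrite subr_ge0 -[leRHS]expR0 ler_expR oppr_le0 mulr_ge0 ?invr_ge0 ?exprn_ge0 ?ltW.
apply: sumr_ge0 => j _; apply: addr_ge0.
  rewrite mulr_ge0 ?invr_ge0 ?exprn_ge0 ?(ltW q0)//.
  by have /andP[] := exp01 (mulr_ge0 (exprn_ge0 j.+1 (ltW b0)) (ltW s0)).
rewrite mulr_ge0 ?exprn_ge0 ?(ltW q0)//.
by rewrite subr_ge0 -[leRHS]expR0 ler_expR oppr_le0 mulr_ge0 ?invr_ge0 ?exprn_ge0 ?ltW.
Qed.

Lemma log_periodic_scale_iter s k : 0 <= s ->
  log_periodic (b ^+ k * s) = q ^+ k * log_periodic s.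
Proof.
move=> s0; elim: k => [|k IH]; first by rewrite !expr0 !mul1r.
by rewrite !exprS -!mulrA log_periodic_scale ?IH// mulr_ge0// exprn_ge0// ltW.
Qed.

End log_periodic_sum.

(** * Powers as limits of nonnegative combinations of the functions 1 - exp(-cs) *)

Section power_approximation.
Context (R : realType) (g M : R).
Hypotheses (g0 : 0 < g) (g1 : g < 1) (M0 : 0 < M).

Let bn (n : nat) : R := 1 + n.+1%:R^-1.
Let qn (n : nat) : R := bn n `^ g.

Let bn1 n : 1 < bn n. Proof. by rewrite ltrDl invr_gt0. Qed.

Let powR_1 (e : R) : 1 `^ e = 1. Proof. by rewrite powR1. Qed.

Lemma power_base1 n : 1 < qn n.
Proof. by rewrite -[ltLHS](powR_1 g) gt0_ltr_powR ?nnegrE// (le_trans ler01)// ltW. Qed.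

Lemma power_base2 n : qn n < bn n.
Proof.
have b0 : 0 <= bn n by rewrite (le_trans ler01)// ltW.
have : 1 < bn n `^ (1 - g) by rewrite -[ltLHS](powR_1 (1 - g)) gt0_ltr_powR ?nnegrE// subr_gt0.
have q0 : 0 < qn n by rewrite powR_gt0// (lt_trans ltr01).
rewrite -(ltr_pM2l q0) mulr1 -powRD; first by rewrite addrC subrK powRr1.
by rewrite (gt_eqF (lt_trans ltr01 (bn1 n))) implybT.
Qed.

(** Normalised to be exact at s = M, the smallest argument occurring in the application. *)
Definition power_approx n (s : R) : R :=
  M `^ g * (log_periodic (bn n) (qn n) s / log_periodic (bn n) (qn n) M).

(** Locates r between consecutive powers of the base, on which the log-periodic sum is known
    exactly. *)
Let bracket n (r : R) : 1 <= r -> exists k, bn n ^+ k <= r < bn n ^+ k.+1.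
Proof.
move=> r1; have b1 := bn1 n.
have [N rN] : exists N, r < bn n ^+ N.
  (* Bernoulli's inequality gives bn n ^+ n.+1 >= 2, so the power is at least 2^(truncn r + 1),
     which exceeds r. *)
  exists (n.+1 * (Num.truncn r).+1)%N; apply: lt_le_trans (truncnS_gt _) _.
  rewrite exprM; apply: (@le_trans _ _ (2 ^+ (Num.truncn r).+1)).
    by rewrite -natrX ler_nat ltnW// ltn_expl.
  rewrite lerXn2r ?nnegrE// ?exprn_ge0//.
    by rewrite (le_trans ler01)// ltW.
  have : forall m, 1 + n.+1%:R^-1 * m%:R <= bn n ^+ m.
    elim=> [|m IH]; first by rewrite mulr0 addr0 expr0.
    rewrite exprS; apply: le_trans (_ : _ <= bn n * (1 + n.+1%:R^-1 * m%:R)) _; last first.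
      by rewrite ler_pM2l// (lt_trans ltr01).
    rewrite /bn -natr1; have : 0 <= n.+1%:R^-1 :> R by rewrite invr_ge0.
    have : 0 <= m%:R :> R by []. nra.
  by move=> /(_ n.+1); rewrite mulVf// pnatr_eq0.
case: (ex_minnP (ex_intro (fun N => r < bn n ^+ N) N rN)) => [[|k]] rk kmin.
  by move: rk; rewrite expr0 ltNge r1.
exists k; rewrite rk andbT leNgt; apply/negP => /kmin; by rewrite ltnn.
Qed.

(** With r = s/M between b^k and b^(k+1), monotonicity and scaling place both r^g and the normalised
    sum in [q^k, q^(k+1)]. The gap is q^k (q - 1) <= r^g (b - 1) = r^g/(n+1). *)
Lemma power_approx_cvg s : M <= s -> power_approx n s @[n --> \oo] --> s `^ g.
Proof.
move=> Ms; have s0 : 0 < s by exact: lt_le_trans Ms.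
have r1 : 1 <= s / M by rewrite ler_pdivlMr// mul1r.
pose r := s / M; have sE : s = r * M by rewrite /r mulfVK// gt_eqF.
have r0 : 0 <= r := le_trans ler01 r1.
have H n : `|s `^ g - power_approx n s| <= s `^ g * n.+1%:R^-1.
  have q1 := power_base1 n; have qb := power_base2 n; have b1 := bn1 n.
  have q0 : 0 < qn n := lt_trans ltr01 q1; have b0 : 0 < bn n := lt_trans ltr01 b1.
  have [k /andP[k1 k2]] := bracket n r1.
  have F0 := log_periodic_gt0 q1 qb M0.
  have sc j := log_periodic_scale_iter q1 qb j (ltW M0).
  have Fle := log_periodic_le q1 qb.
  have pq j : (bn n ^+ j) `^ g = qn n ^+ j.
    by rewrite -powR_mulrn ?(ltW b0)// -powRrM mulrC powRrM powR_mulrn// powR_ge0.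
  have p1 : qn n ^+ k <= r `^ g <= qn n ^+ k.+1.
    by rewrite -!pq !ge0_ler_powR ?nnegrE ?exprn_ge0 ?(ltW b0) ?(ltW g0)// ltW.
  have p2 : qn n ^+ k <= log_periodic (bn n) (qn n) s / log_periodic (bn n) (qn n) M <= qn n ^+ k.+1.
    rewrite ler_pdivlMr// ler_pdivrMr// -!sc; apply/andP; split; apply: Fle.
    - by rewrite mulr_ge0 ?exprn_ge0 ?ltW.
    - by rewrite sE ler_pM2r.
    - exact: ltW.
    - by rewrite sE ler_pM2r// ltW.
  have -> : s `^ g = M `^ g * r `^ g by rewrite sE powRM// 1?mulrC// ltW.
  rewrite /power_approx -mulrBr normrM ger0_norm ?powR_ge0// -mulrA ler_wpM2l ?powR_ge0//.
  apply: (@le_trans _ _ (qn n ^+ k.+1 - qn n ^+ k)).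
    move: p1 p2 => /andP[a1 a2] /andP[a3 a4]; rewrite ler_norml; apply/andP; split; lra.
  rewrite exprS -{2}(mul1r (qn n ^+ k)) -mulrBl mulrC.
  apply: ler_pM; rewrite ?exprn_ge0 ?(ltW q0) ?subr_ge0 ?(ltW q1)//.
    by have /andP[] := p1.
  by rewrite lerBlDl; exact: ltW.
apply/cvgrPdist_le => e e0.
have : s `^ g * n.+1%:R^-1 @[n --> \oo] --> s `^ g * 0.
  by apply: cvgMr; exact: cvg_harmonic.
rewrite mulr0 => /cvgrPdist_le/(_ _ e0); apply: filterS => n.
rewrite sub0r normrN ger0_norm; first exact: le_trans.
by rewrite mulr_ge0 ?powR_ge0// invr_ge0.
Qed.

End power_approximation.

(** * Positivity-preserving Fourier multipliers *)

Section gaussian_positivity.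
Context (R : realType) (d : nat).
Notation mu := (lebesgue_rV R d).
Implicit Types (f g beta : 'rV[R]_d -> R).

(** Positivity of a Fourier integral after Gaussian regularisation. By [ft_gauss] it holds when beta
    is [rdot] of the transforms of two nonnegative functions, the integral then being one of a heat
    kernel. *)
Definition gauss_pos beta := forall u : R, 0 < u ->
  0 <= \int[mu]_y (gauss_rV u y * beta y).

(** Encodes multipliers with a nonnegative kernel without naming the kernel, which makes closure
    under sums, products and bounded limits direct. *)
Definition pos_mult f := [/\ measurable_fun setT f, exists K : R, forall y, `|f y| <= K &
  forall beta, intble mu beta -> gauss_pos beta -> gauss_pos (fun y => f y * beta y)].

Let lim_ge0 (u : nat -> R) (l : R) : u n @[n --> \oo] --> l -> (forall n, 0 <= u n) -> 0 <= l.
Proof.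
move=> ul u0; rewrite -(cvg_lim _ ul)//; apply: limr_ge; first exact: cvgP ul.
exact: nearW.
Qed.

Lemma intble_gaussM (u : R) beta : 0 < u -> intble mu beta ->
  intble mu (fun y => gauss_rV u y * beta y).
Proof.
move=> u0 ib; apply: (@intble_bdM _ _ _ mu 1) => //; first exact: measurable_gauss_rV.
by move=> y; rewrite ger0_norm ?(ltW (gauss_rV_gt0 _ _))// gauss_rV_le1// ltW.
Qed.

Lemma pos_mult_intble f beta : pos_mult f -> intble mu beta ->
  intble mu (fun y => f y * beta y).
Proof. by move=> [mf [K fK] _] ib; exact: intble_bdM mf fK ib. Qed.

Lemma pos_mult_cst (c : R) : 0 <= c -> pos_mult (fun=> c).
Proof.
move=> c0; split => //; first by exists `|c|.
move=> beta ib hb u u0; under eq_Rintegral do rewrite mulrCA.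
by rewrite RIZ ?mulr_ge0 ?hb//; exact: intble_gaussM.
Qed.

Lemma pos_mult_gauss (u : R) : 0 < u -> pos_mult (gauss_rV u).
Proof.
move=> u0; split; first exact: measurable_gauss_rV.
  exists 1 => y; rewrite ger0_norm ?(ltW (gauss_rV_gt0 _ _))//.
  by rewrite gauss_rV_le1// ltW.
move=> beta ib hb v v0; under eq_Rintegral => y _.
  rewrite mulrA /gauss_rV -expRD -opprD -mulrDl -/(gauss_rV (v + u) y); over.
by apply: hb; rewrite addr_gt0.
Qed.

Lemma pos_multD f g : pos_mult f -> pos_mult g -> pos_mult (fun y => f y + g y).
Proof.
move=> Mf Mg; have [mf [K fK] hf] := Mf; have [mg [L gL] hg] := Mg.
split; first exact: measurable_funD.
  by exists (K + L) => y; rewrite (le_trans (ler_normD _ _))// lerD.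
move=> beta ib hb u u0; under eq_Rintegral do rewrite mulrDl mulrDr.
rewrite RID; first by rewrite addr_ge0 ?hf ?hg.
- exact/intble_gaussM/pos_mult_intble.
- exact/intble_gaussM/pos_mult_intble.
Qed.

Lemma pos_multM f g : pos_mult f -> pos_mult g -> pos_mult (fun y => f y * g y).
Proof.
move=> Mf Mg; have [mf [K fK] hf] := Mf; have [mg [L gL] hg] := Mg.
split; first exact: measurable_funM.
  by exists (K * L) => y; rewrite normrM ler_pM.
move=> beta ib hb u u0; under eq_Rintegral do rewrite -[_ * _ * beta _]mulrA.
by apply: hf => //; [exact: pos_mult_intble|exact: hg].
Qed.

Lemma pos_mult_lim (F : nat -> 'rV[R]_d -> R) f K : (forall n, pos_mult (F n)) ->
  (forall n y, `|F n y| <= K) -> (forall y, F n y @[n --> \oo] --> f y) -> pos_mult f.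
Proof.
move=> MF FK Ff.
have mF n : measurable_fun setT (F n) by have [] := MF n.
have mf : measurable_fun setT f by apply: (measurable_fun_cvg (h := F)).
have fK y : `|f y| <= K.
  have h : `|F n y| @[n --> \oo] --> `|f y| by apply: cvg_norm; exact: Ff.
  rewrite -(cvg_lim _ h)//.
  apply: limr_le; first exact: cvgP h.
  by apply: nearW => n; exact: FK.
split => //; first by exists K.
move=> beta ib hb u u0; have ig := intble_gaussM u0 ib.
have mb := intble_meas ib.
have L : \int[mu]_y (gauss_rV u y * (F n y * beta y)) @[n --> \oo] -->
    \int[mu]_y (gauss_rV u y * (f y * beta y)).
  apply: (RI_dct _ _ (intbleZ K (intble_norm ig)) _ _).2.
  - move=> n; apply: measurable_funM; first exact: measurable_gauss_rV.
    exact: measurable_funM.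
  - by apply: measurable_funM; [exact: measurable_gauss_rV|exact: measurable_funM].
  - by move=> n y; rewrite mulrCA normrM ler_wpM2r.
  - by apply: aeW => y; apply: cvgMr; apply: cvgMl; exact: Ff.
apply: (lim_ge0 L) => n; have [_ _ h] := MF n; exact: h.
Qed.

Lemma pos_mult_sum (F : nat -> 'rV[R]_d -> R) n : (forall i, pos_mult (F i)) ->
  pos_mult (fun y => \sum_(0 <= i < n) F i y).
Proof.
move=> MF; elim: n => [|n IH].
  by under eq_fun do rewrite big_geq//; exact: pos_mult_cst.
by under eq_fun do rewrite big_nat_recr//=; exact: pos_multD.
Qed.

(** The exponential series has nonnegative coefficients, and its partial sums are bounded by exp K
    when |f| <= K. *)
Lemma pos_mult_exp f : pos_mult f -> pos_mult (fun y => expR (f y)).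
Proof.
move=> Mf; have [mf [K fK] _] := Mf.
have Mx i : pos_mult (fun y => f y ^+ i).
  elim: i => [|i IH]; first by under eq_fun do rewrite expr0; exact: pos_mult_cst.
  by under eq_fun do rewrite exprS; exact: pos_multM.
apply: (@pos_mult_lim (fun n y => series (exp_coeff (f y)) n) _ (expR K)).
- move=> n; rewrite /series /=; apply: pos_mult_sum => i; rewrite /exp_coeff /=.
  by apply: pos_multM; [exact: Mx|apply: pos_mult_cst; rewrite invr_ge0].
- move=> n y; have K0 : 0 <= K by exact: le_trans (fK y).
  apply: (@le_trans _ _ (series (exp_coeff K) n)).
    rewrite /series /= (le_trans (ler_norm_sum _ _ _))//; apply: ler_sum => i _.
    have e (x : R) : exp_coeff x i = x ^+ i / i`!%:R by [].
    rewrite !e normrM [X in _ * X]ger0_norm ?invr_ge0// ler_wpM2r ?invr_ge0//.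
    by rewrite normrX lerXn2r ?nnegrE.
  apply: (nondecreasing_cvgn_le _ (is_cvg_series_exp_coeff K)).
  by apply: nondecreasing_series => i _ _; exact: exp_coeff_ge0.
- by move=> y; exact: is_cvg_series_exp_coeff.
Qed.

(** The analogue of a negative definite function in Schoenberg's sense. Unlike [pos_mult], it allows
    unbounded f, because only the exponentials, bounded by 1, are multipliers. *)
Definition bernstein f := [/\ measurable_fun setT f, forall y, 0 <= f y &
  forall t : R, 0 <= t -> pos_mult (fun y => expR (- (t * f y)))].

(** exp(-t (1 - g)) = exp(-t) exp(t g), a nonnegative constant times the exponential of a positive
    multiplier. *)
Lemma bernstein_sub g : pos_mult g -> (forall y, 0 <= g y <= 1) ->
  bernstein (fun y => 1 - g y).
Proof.
move=> Mg g01; have [mg _ _] := Mg; split; first exact: measurable_funB.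
  by move=> y; have /andP[] := g01 y; rewrite subr_ge0.
move=> t t0; rewrite (_ : (fun y => _) = (fun y => expR (- t) * expR (t * g y))); last first.
  by apply/funext => y; rewrite -expRD; congr expR; ring.
apply: pos_multM; first by apply: pos_mult_cst; exact: expR_ge0.
by apply/pos_mult_exp/pos_multM => //; exact: pos_mult_cst.
Qed.

Lemma bernsteinD f g : bernstein f -> bernstein g -> bernstein (fun y => f y + g y).
Proof.
move=> [mf f0 Bf] [mg g0 Bg]; split; first exact: measurable_funD.
  by move=> y; rewrite addr_ge0.
move=> t t0; under eq_fun do rewrite mulrDr opprD expRD.
by apply: pos_multM; [exact: Bf|exact: Bg].
Qed.

Lemma bernsteinZ (c : R) f : 0 <= c -> bernstein f -> bernstein (fun y => c * f y).
Proof.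
move=> c0 [mf f0 Bf]; split; first exact: measurable_funM.
  by move=> y; rewrite mulr_ge0.
by move=> t t0; under eq_fun do rewrite mulrA; apply: Bf; rewrite mulr_ge0.
Qed.

Lemma bernstein_lim (F : nat -> 'rV[R]_d -> R) f : (forall n, bernstein (F n)) ->
  (forall y, F n y @[n --> \oo] --> f y) -> bernstein f.
Proof.
move=> BF Ff; have mF n : measurable_fun setT (F n) by have [] := BF n.
split; first exact: (measurable_fun_cvg (h := F)).
  move=> y; apply: (lim_ge0 (Ff y)) => n.
  by have [_ h _] := BF n; exact: h.
move=> t t0; apply: (@pos_mult_lim (fun n y => expR (- (t * F n y))) _ 1).
- by move=> n; have [_ _ h] := BF n; exact: h.
- move=> n y; rewrite ger0_norm ?expR_ge0// -expR0 ler_expR oppr_le0 mulr_ge0//.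
  by have [_ h _] := BF n; exact: h.
- move=> y; apply: continuous_cvg; first exact: continuous_expR.
  apply: cvgN; apply: cvgMr; exact: Ff.
Qed.

Lemma bernstein_sum (F : nat -> 'rV[R]_d -> R) n : (forall i, bernstein (F i)) ->
  bernstein (fun y => \sum_(0 <= i < n) F i y).
Proof.
move=> BF; elim: n => [|n IH].
  under eq_fun do rewrite big_geq//; have := bernsteinZ (lexx 0) (BF 0%N).
  by under eq_fun do rewrite mul0r.
by under eq_fun do rewrite big_nat_recr//=; exact: bernsteinD.
Qed.

(** Each 1 - exp(-u (|y|^2 + M)) is 1 minus a scaled Gaussian. Two successive pointwise limits reach
    the power: the partial sums of the series, then [power_approx]. *)
Theorem bernstein_power (g M : R) : 0 < g -> g < 1 -> 0 < M ->
  bernstein (fun y => (dotv y y + M) `^ g).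
Proof.
move=> g0 g1 M0.
have B1 (u : R) : 0 < u -> bernstein (fun y => 1 - expR (- (u * (dotv y y + M)))).
  move=> u0; apply: bernstein_sub; last first.
    move=> y; rewrite expR_ge0/= -expR0 ler_expR oppr_le0 mulr_ge0 ?(ltW u0)//.
    by rewrite addr_ge0 ?dotv_ge0// ltW.
  rewrite (_ : (fun y => _) = (fun y => expR (- (u * M)) * gauss_rV u y)); last first.
    by apply/funext => y; rewrite -expRD; congr expR; ring.
  by apply: pos_multM; [apply: pos_mult_cst; exact: expR_ge0|exact: pos_mult_gauss].
have S0 (y : 'rV[R]_d) : 0 <= dotv y y + M :> R by rewrite addr_ge0 ?dotv_ge0// ltW.
apply: (@bernstein_lim (fun n y => power_approx g M n (dotv y y + M))); last first.
  by move=> y; apply: power_approx_cvg => //; rewrite lerDr dotv_ge0.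
move=> n; rewrite /power_approx.
have q1 := power_base1 g0 n; have qb := power_base2 g1 n.
apply: bernsteinZ; first exact: powR_ge0.
under eq_fun do rewrite mulrC; apply: bernsteinZ.
  by rewrite invr_ge0 ltW// log_periodic_gt0.
apply: (@bernstein_lim (fun k y => log_periodic_partial (1 + n.+1%:R^-1)
  ((1 + n.+1%:R^-1) `^ g) (dotv y y + M) k)) => [k|y]; last exact: log_periodic_cvg.
have q0 := lt_trans ltr01 q1; have b0 := lt_trans q0 qb.
rewrite (_ : (fun y => _) = (fun y : 'rV[R]_d => \sum_(0 <= j < k)
  (((1 + n.+1%:R^-1) `^ g ^+ j)^-1 * (1 - expR (- ((1 + n.+1%:R^-1) ^+ j * (dotv y y + M)))) +
   (1 + n.+1%:R^-1) `^ g ^+ j.+1 *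
     (1 - expR (- (((1 + n.+1%:R^-1) ^+ j.+1)^-1 * (dotv y y + M))))))); last first.
  by apply/funext => y; rewrite log_periodicE.
apply: bernstein_sum => j; apply: bernsteinD; apply: bernsteinZ.
- by rewrite invr_ge0 exprn_ge0// ltW.
- by apply: B1; rewrite exprn_gt0.
- by rewrite exprn_ge0// ltW.
- by apply: B1; rewrite invr_gt0 exprn_gt0.
Qed.

Lemma gauss_pos_ge0 beta : intble mu beta -> gauss_pos beta -> 0 <= \int[mu]_y beta y.
Proof.
move=> ib hb; have mb := intble_meas ib.
have L : \int[mu]_y (gauss_rV (harm R n) y * beta y) @[n --> \oo] --> \int[mu]_y beta y.
  apply: (RI_dct _ mb (intble_norm ib) _ _).2.
  - by move=> n; apply: measurable_funM => //; exact: measurable_gauss_rV.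
  - move=> n y; rewrite normrM ler_piMl// ger0_norm ?(ltW (gauss_rV_gt0 _ _))//.
    by rewrite gauss_rV_le1// ltW// harm_gt0.
  - by apply: aeW => y; rewrite -[X in _ --> X]mul1r; apply: cvgMl; exact: gauss_rV_cvg.
by apply: (lim_ge0 L) => n; apply: hb; exact: harm_gt0.
Qed.

End gaussian_positivity.

(** * The symbol of L: decay and integrability of its exponentials *)

Section polynomial_decay.
Context (R : realType) (d : nat).
Notation mu := (lebesgue_rV R d).

Lemma intble_oneDsqrV : intble (@lebesgue_measure R) (fun s : R => (1 + s ^+ 2)^-1).
Proof.
have c0 : continuous (fun s : R => (1 + s ^+ 2)^-1) := @continuous_oneDsqrV R.
have p0 (x : R) : 0 <= (1 + x ^+ 2)^-1 by rewrite invr_ge0 addr_ge0 ?sqr_ge0.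
apply: intble_lty => //; first exact: continuous_measurable_fun.
rewrite ge0_symfun_integralT//; last by move=> x /=; rewrite sqrrN.
have -> : (\int[lebesgue_measure]_(x in [set x | (0 <= x)%R]) ((1 + x ^+ 2)^-1)%:E =
    (pi / 2)%:E :> \bar R)%E.
  rewrite -integral0y_oneDsqr; congr (integral _ _ _).
  by apply/seteqP; split=> x /=; rewrite in_itv/= andbT.
by rewrite -EFinM ltry.
Qed.

Lemma sqr_coord_le i (y : 'rV[R]_d) : rV_coord i y ^+ 2 <= dotv y y.
Proof.
rewrite /dotv (bigD1 i)//= -expr2.
by rewrite lerDl; apply: sumr_ge0 => j _; rewrite -expr2 sqr_ge0.
Qed.

Lemma coord_le_enorm i (y : 'rV[R]_d) : `|rV_coord i y| <= enorm y.
Proof. by rewrite -sqrtr_sqr ler_wsqrtr// sqr_coord_le. Qed.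

(** Since (1 + |y|^2)^d dominates the product of the 1 + y_i^2, a product of integrable one-variable
    functions bounds w. *)
Lemma intble_decay (w : 'rV[R]_d -> R) (K : R) : measurable_fun setT w ->
  (forall y, `|w y| * (1 + dotv y y) ^+ d <= K) -> intble mu w.
Proof.
move=> mw wK; have [iP _] := intble_rV_prod (fun _ : 'I_d => intble_oneDsqrV).
apply: (intble_le mw _ (intbleZ K iP)) => y.
have y0 i : 0 < 1 + rV_coord i y ^+ 2 by rewrite ltr_pwDl// sqr_ge0.
rewrite prodfV ler_pdivlMr ?prodr_gt0//; apply: le_trans (wK y).
rewrite ler_wpM2l// -[X in _ ^+ X](card_ord d) -prodr_const.
apply: ler_prod => i _; by rewrite (ltW (y0 i))/= lerD2l sqr_coord_le.
Qed.

End polynomial_decay.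

Section symbol.
Context (R : realType) (d : nat) (alpha m : R).
Hypotheses (alpha_gt0 : 0 < alpha) (alpha_lt2 : alpha < 2) (m_gt0 : 0 < m).
Notation mu := (lebesgue_rV R d).
Notation sigma := (@symbolL R d alpha m).
Implicit Types y : 'rV[R]_d.

Let M := m `^ (2 / alpha).
Let g := alpha / 2.

Let M0 : 0 < M. Proof. exact: powR_gt0. Qed.
Let g0 : 0 < g. Proof. exact: divr_gt0. Qed.
Let g1 : g < 1. Proof. by rewrite /g ltr_pdivrMr// mul1r. Qed.

Lemma symbolE y : sigma y = (dotv y y + M) `^ g - m.
Proof. by rewrite /symbolL sqr_enorm. Qed.

Let yM0 y : 0 < dotv y y + M. Proof. by rewrite ltr_wpDl ?dotv_ge0. Qed.

(** M is such that m = M^g, and s |-> s^g is increasing. *)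
Lemma symbol_ge0 y : 0 <= sigma y.
Proof.
rewrite symbolE subr_ge0; have : m = M `^ g.
  by rewrite /M /g -powRrM mulrA divfK ?gt_eqF// mulfV ?gt_eqF// powRr1// ltW.
move=> {1}->; apply: ge0_ler_powR; rewrite ?nnegrE ?(ltW g0) ?(ltW M0) ?(ltW (yM0 _))//.
by rewrite lerDr dotv_ge0.
Qed.

Lemma measurable_symbol : measurable_fun setT sigma.
Proof.
rewrite (_ : sigma = (fun y => (dotv y y + M) `^ g - m)); last exact/funext/symbolE.
apply: measurable_funB => //; apply: (measurableT_comp (measurable_powR g)).
by apply: measurable_funD => //; exact: measurable_dotv.
Qed.

Lemma symbol_decay (t : R) n : 0 < t ->
  exists K : R, forall y, expR (- t * sigma y) * (1 + dotv y y) ^+ n <= K.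
Proof.
(* A = 1 + 1/M makes 1 + |y|^2 <= A (|y|^2 + M). *)
move=> t0; pose A := 1 + M^-1; have A0 : 0 <= A by rewrite addr_ge0// invr_ge0 ltW.
(* With x = (|y|^2 + M)^g, the polynomial factor is x^(n/g) up to a constant; an exponent k+1 > n/g
   turns it into a natural power, controlled by one term of the exponential series. *)
pose k := Num.truncn (n%:R / g); have kn : n%:R / g < k.+1%:R by exact: truncnS_gt.
exists (expR (t * m) * (A ^+ n * (1 + k.+1`!%:R / t ^+ k.+1))) => y.
pose x := (dotv y y + M) `^ g; have x0 : 0 <= x by exact: powR_ge0.
rewrite symbolE -/x (_ : - t * (x - m) = t * m + - (t * x)); last by ring.
rewrite expRD -mulrA ler_pM2l ?expR_gt0//.
have P1 : (1 + dotv y y) ^+ n <= A ^+ n * (1 + x ^+ k.+1).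
  apply: (@le_trans _ _ (A ^+ n * (dotv y y + M) ^+ n)).
    rewrite -exprMn; apply: lerXn2r; rewrite ?nnegrE.
    - by rewrite addr_ge0 ?dotv_ge0.
    - by rewrite mulr_ge0// ltW.
    have := dotv_ge0 y; have := M0; rewrite /A mulrDl mul1r mulrDr mulVf ?gt_eqF// => h1 h2.
    have : 0 <= M^-1 * dotv y y by rewrite mulr_ge0 ?invr_ge0 ?(ltW M0)//.
    by move=> h3; lra.
  rewrite ler_wpM2l ?exprn_ge0//.
  have -> : (dotv y y + M) ^+ n = x `^ (n%:R / g).
    by rewrite /x -powRrM mulrCA divff ?gt_eqF// mulr1 powR_mulrn// ltW.
  have [x1|x1] := leP 1 x.
    apply: (@le_trans _ _ (x ^+ k.+1)); last by rewrite lerDr.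
    by rewrite -powR_mulrn//; apply: ler_powR => //; exact: ltW.
  apply: (@le_trans _ _ 1); last by rewrite lerDl exprn_ge0.
  have e0 : 0 <= n%:R / g by rewrite divr_ge0// ltW.
  have p1 : 1 `^ (n%:R / g) = 1 :> R by rewrite powR1.
  by rewrite -[leRHS]p1; apply: ge0_ler_powR; rewrite ?nnegrE// ltW.
apply: le_trans (ler_wpM2l (expR_ge0 _) P1) _.
rewrite mulrCA ler_wpM2l ?exprn_ge0//.
rewrite mulrDr mulr1; apply: lerD.
  by rewrite -expR0 ler_expR oppr_le0 mulr_ge0// ltW.
rewrite expRN mulrC ler_pdivrMr ?expR_gt0//.
have := expR_ge1Dxn k (mulr_ge0 (ltW t0) x0).
rewrite exprMn => h.
have f0 : 0 < k.+1`!%:R :> R by rewrite ltr0n fact_gt0.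
have tk0 : 0 < t ^+ k.+1 by rewrite exprn_gt0.
rewrite mulrAC ler_pdivlMr// mulrC -ler_pdivrMl// mulrC.
by rewrite [leLHS]mulrC (mulrC (x ^+ k.+1)); apply: le_trans h; rewrite lerDr.
Qed.

Lemma exp_symbol_le1 (t : R) y : 0 <= t -> expR (- t * sigma y) <= 1.
Proof. by move=> t0; rewrite -expR0 ler_expR mulNr oppr_le0 mulr_ge0// symbol_ge0. Qed.

Lemma measurable_exp_symbol (t : R) : measurable_fun setT (fun y => expR (- t * sigma y)).
Proof.
by apply: (measurableT_comp (@measurable_expR R)); apply: measurable_funM => //; exact: measurable_symbol.
Qed.

Lemma intble_exp_symbol (t : R) : 0 < t -> intble mu (fun y => expR (- t * sigma y)).
Proof.
move=> t0; have [K hK] := symbol_decay d t0.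
apply: (intble_decay (measurable_exp_symbol t)) => y.
by rewrite ger0_norm ?expR_ge0//; exact: hK.
Qed.

(** The first moments give a Lipschitz constant for the kernel; one more power of 1 + |y|^2 absorbs
    the coordinate. *)
Lemma intble_exp_symbolM (t : R) i : 0 < t ->
  intble mu (fun y => expR (- t * sigma y) * rV_coord i y).
Proof.
move=> t0; have [K hK] := symbol_decay d.+1 t0.
apply: intble_decay => [|y].
  by apply: measurable_funM; [exact: measurable_exp_symbol|exact: measurable_rV_coord].
rewrite normrM ger0_norm ?expR_ge0//; apply: le_trans (hK y).
rewrite exprS mulrA ler_wpM2r ?exprn_ge0 ?addr_ge0 ?dotv_ge0//.
rewrite ler_wpM2l ?expR_ge0//.
have h := sqr_coord_le i y.
have := sqr_ge0 (`|rV_coord i y| - 1); rewrite sqrrB expr1n mulr1 real_normK ?num_real//.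
have := normr_ge0 (rV_coord i y); lra.
Qed.

Lemma bernstein_symbolD : bernstein (fun y => sigma y + m).
Proof.
rewrite (_ : (fun y => _) = fun y => (dotv y y + M) `^ g); first exact: bernstein_power.
by apply/funext => y; rewrite symbolE subrK.
Qed.

Lemma pos_mult_exp_symbol (t : R) : 0 <= t -> pos_mult (fun y => expR (- t * sigma y)).
Proof.
move=> t0; have [_ _ h] := bernstein_symbolD.
rewrite (_ : (fun y => _) = fun y => expR (t * m) * expR (- (t * (sigma y + m)))); last first.
  by apply/funext => y; rewrite -expRD; congr expR; ring.
by apply: pos_multM; [apply: pos_mult_cst; exact: expR_ge0|exact: h].
Qed.

End symbol.

(** * Convolution kernels tested on bounded functions of bounded support *)

Section convolution_kernels.
Context (R : realType) (d : nat).
Notation mu := (lebesgue_rV R d).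
Notation mu2 := (lebesgue_rV R d \x lebesgue_rV R d)%E.
Implicit Types (f g : 'rV[R]_d -> R[i]) (k : 'rV[R]_d -> R).

(** Test functions against which any continuous kernel can be integrated, whatever its growth. *)
Definition bounded_cpt f := [/\ cmeasurable f,
  exists K : R, forall x, sqmod (f x) <= K &
  exists n : nat, forall x, n%:R < enorm x -> f x = 0].

Lemma bounded_cpt_cintegrable f : bounded_cpt f -> cintegrable setT f.
Proof.
move=> [[m1 m2] [K fK] [n f0]]; have iF := intbleZ (Num.sqrt K) (intble_cutoff R d n).
have H (p : R[i] -> R) x : p 0 = 0 -> p (f x) ^+ 2 <= sqmod (f x) ->
    `|p (f x)| <= Num.sqrt K * cutoff n x.
  move=> p0 pf; rewrite /cutoff; case: ifPn => [_|]; last first.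
    by rewrite -ltNge => /f0 ->; rewrite p0 normr0 mulr0.
  by rewrite mulr1 -sqrtr_sqr ler_wsqrtr// (le_trans pf).
by split; apply: (intble_le _ _ iF) => // x; apply: H; rewrite ?sqr_Re_le ?sqr_Im_le.
Qed.

Lemma bounded_cpt_L2 f : bounded_cpt f -> L2 f.
Proof.
move=> hf; have [_ [K fK] _] := hf.
exact: L1_bounded_L2 (bounded_cpt_cintegrable hf) fK.
Qed.

Lemma bounded_cpt_fourier f : bounded_cpt f -> is_fourier f (ft f).
Proof.
move=> hf; have [mf _ [n f0]] := hf.
exact: fourier_ft mf (bounded_cpt_L2 hf) f0.
Qed.

(** The differences stay in the compact cube of half-side 2N, where |k| attains a maximum. *)
Lemma kernel_bounded k N : continuous k -> exists K : R, forall x y,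
  enorm x <= N%:R -> enorm y <= N%:R -> `|k (x - y)| <= K.
Proof.
move=> ck; pose B : R := N%:R + N%:R.
pose A := [set v : 'rV[R]_d | forall i, `[- B, B]%classic (v ord0 i)].
have cA : compact A by apply: (@rV_compact R d (fun=> `[- B, B]%classic)) => i; exact: segment_compact.
have [|||c _ cmax] := @EVT_max_rV R d (fun x => `|k x|) A => //.
- exists 0 => i /=; rewrite mxE in_itv/=; apply/andP; split; rewrite ?oppr_le0 addr_ge0//.
- apply: continuous_subspaceT => x; apply: continuous_comp; first exact: ck.
  exact: norm_continuous.
exists `|k c| => x y xN yN; apply: cmax; apply/mem_set => i /=.
rewrite in_itv/= -ler_norml !mxE (le_trans (ler_normB _ _))//.
by apply: lerD; [apply: le_trans xN|apply: le_trans yN]; exact: coord_le_enorm.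
Qed.

Lemma measurable_kernel k : continuous k ->
  measurable_fun setT (fun z : 'rV[R]_d * 'rV[R]_d => k (z.1 - z.2)).
Proof.
move=> ck; exact: measurableT_comp (continuous_rV_measurable ck) (@measurable_subv R d).
Qed.

Lemma intble_kernel k f g : continuous k -> bounded_cpt f -> bounded_cpt g ->
  intble mu2 (fun z => k (z.1 - z.2) * rdot (f z.1) (g z.2)).
Proof.
move=> ck hf hg; have iF := cintegrable_rdot2 (bounded_cpt_cintegrable hf) (bounded_cpt_cintegrable hg).
have [_ _ [n f0]] := hf; have [_ _ [n' g0]] := hg.
have [K kK] := kernel_bounded (maxn n n') ck.
apply: (intble_le _ _ (intbleZ K (intble_norm iF))) => [|z].
  by apply: measurable_funM; [exact: measurable_kernel|exact: (intble_meas iF)].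
rewrite normrM; have [zn|zn] := leP (enorm z.1) (maxn n n')%:R; last first.
  rewrite f0 ?/rdot; last by apply: le_lt_trans zn; rewrite ler_nat leq_maxl.
  by rewrite /= !mul0r addr0 normr0 !mulr0.
have [zn'|zn'] := leP (enorm z.2) (maxn n n')%:R; last first.
  rewrite g0 ?/rdot; last by apply: le_lt_trans zn'; rewrite ler_nat leq_maxr.
  by rewrite /= !mulr0 addr0 normr0 !mulr0.
by rewrite ler_wpM2r// kK.
Qed.

Definition box_ind (c : 'rV[R]_d) (e : R) x : R :=
  \1_[set x : 'rV[R]_d | forall i, `]c ord0 i - e, c ord0 i + e[%classic (x ord0 i)] x.

Let mbox (c : 'rV[R]_d) (e : R) :
  measurable [set x : 'rV[R]_d | forall i, `]c ord0 i - e, c ord0 i + e[%classic (x ord0 i)].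
Proof. exact: (@measurable_rV_set R d (fun i => `]c ord0 i - e, c ord0 i + e[%classic)). Qed.

Lemma box_ind01 c e x : box_ind c e x = 0 \/
  (box_ind c e x = 1 /\ forall i, `|c ord0 i - x ord0 i| < e).
Proof.
rewrite /box_ind indicE; case: (boolP (x \in _)) => [/set_mem h|_]; [right|by left].
split => // i; have := h i; rewrite /= in_itv/= => /andP[h1 h2].
by rewrite ltr_norml; apply/andP; split; lra.
Qed.

Lemma bounded_cpt_box c (e : R) : bounded_cpt (fun x => (box_ind c e x)%:C%C).
Proof.
split; first by apply: cmeasurableR; exact: measurable_indic.
  by exists 1 => x; rewrite /sqmod /= expr0n addr0;
    case: (box_ind01 c e x) => [->|[-> _]]; rewrite ?expr0n ?expr1n.
pose B := \sum_i (`|c ord0 i| + e) ^+ 2.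
exists (Num.truncn (Num.sqrt B)).+1 => x; case: (box_ind01 c e x) => [-> //|[_ h]].
rewrite ltNge (_ : enorm x <= _)//; apply: le_trans (ltW (truncnS_gt _)).
apply: ler_wsqrtr; apply: ler_sum => i _; rewrite -expr2.
rewrite -[x _ _ ^+ 2]real_normK ?num_real//; apply: lerXn2r; rewrite ?nnegrE//.
  by rewrite addr_ge0// (le_trans _ (ltW (h i))).
have -> : x ord0 i = c ord0 i - (c ord0 i - x ord0 i) by ring.
by rewrite (le_trans (ler_normB _ _))// lerD2l ltW.
Qed.

Lemma box_ind_int c (e : R) : 0 < e -> intble mu (box_ind c e) /\ 0 < \int[mu]_x box_ind c e x.
Proof.
move=> e0; have iB : intble mu (box_ind c e).
  by have [] := bounded_cpt_cintegrable (bounded_cpt_box c e).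
split => //; rewrite -lte_fin EFin_RI// integral_indic// setIT.
have h := @lebesgue_rV_box R d (fun i => `]c ord0 i - e, c ord0 i + e[%classic)
  (fun i => measurable_itv _).
suff : (0%:E < \prod_(i < d) lebesgue_measure (`](c ord0 i - e)%R, (c ord0 i + e)%R[%classic : set R))%E.
  by rewrite -h.
rewrite (eq_bigr (fun=> (e + e)%:E)) => [|i _].
  by rewrite prodEFin lte_fin prodr_gt0// => i _; rewrite addr_gt0.
rewrite /= lebesgue_measure_itv/= lte_fin ifT; last by lra.
by rewrite -EFinB; congr EFin; lra.
Qed.

(** If k x < 0, then k stays below k x / 2 within distance e of x. Cubes of half-side e/2 around x
    and 0 have all their differences there, and their test integral would be negative. *)
Lemma kernel_ge0 k : continuous k ->
  (forall c e c' e', 0 <= \int[mu2]_z (k (z.1 - z.2) * (box_ind c e z.1 * box_ind c' e' z.2))) ->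
  forall x, 0 <= k x.
Proof.
move=> ck hk x; rewrite leNgt; apply/negP => kx.
have k2' : 0 < - (k x / 2) by rewrite oppr_gt0 pmulr_llt0.
have /cvgrPdist_lt/(_ _ k2') /nbhs_ballP[e /= e0 xe] : k t @[t --> x] --> k x by exact: ck.
have e20 : 0 < e / 2 by rewrite divr_gt0.
have [i1 p1] := box_ind_int x e20; have [i2 p2] := box_ind_int 0 e20.
have := hk x (e / 2) 0 (e / 2); rewrite leNgt => /negP; apply.
have iP := intble_prod i1 i2.
have iK : intble mu2 (fun z => k (z.1 - z.2) * (box_ind x (e / 2) z.1 * box_ind 0 (e / 2) z.2)).
  have := intble_kernel ck (bounded_cpt_box x (e / 2)) (bounded_cpt_box 0 (e / 2)).
  by rewrite /rdot /=; under eq_fun do rewrite mulr0 addr0.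
apply: (@le_lt_trans _ _ (\int[mu2]_z (k x / 2 * (box_ind x (e / 2) z.1 * box_ind 0 (e / 2) z.2)))).
  apply: RI_le => //; first exact: intbleZ.
  move=> z; case: (box_ind01 x (e / 2) z.1) => [->|[-> h1]]; first by rewrite !mul0r !mulr0.
  case: (box_ind01 0 (e / 2) z.2) => [->|[-> h2]]; first by rewrite !mulr0.
  rewrite !mulr1; suff : `|k x - k (z.1 - z.2)| < - (k x / 2).
    by rewrite ltr_norml => /andP[h3 h4]; lra.
  apply: xe; split => // j i; rewrite ord1 !mxE.
  rewrite -ball_normE/=; have := h1 i; have := h2 i; rewrite !mxE sub0r normrN => a b.
  rewrite (_ : _ - _ = (x ord0 i - z.1 ord0 i) + z.2 ord0 i); last by ring.
  by apply: le_lt_trans (ler_normD _ _) _; lra.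
rewrite (RIZ _ iP) -(RI_prodM i1 i2) pmulr_llt0 ?mulr_gt0//.
by rewrite pmulr_llt0.
Qed.

End convolution_kernels.

Section cos_lipschitz.
Context (R : realType).

Lemma cos_lipschitz (a b : R) : `|cos a - cos b| <= `|a - b|.
Proof.
wlog ab : a b / a <= b.
  by move=> H; case: (leP a b) => [/H//|/ltW/H]; rewrite distrC (distrC b).
have [|c _ h] := @MVT_segment R cos (fun x => - sin x) a b ab (fun x _ => is_derive_cos x).
  by apply: continuous_subspaceT; exact: continuous_cos.
by rewrite distrC h normrM normrN (distrC a) ler_piMl ?sin_max.
Qed.

End cos_lipschitz.

(** * The heat kernel: explicit formula, positivity, measurability *)

Section heat_kernel.
Context (R : realType) (d : nat) (alpha m : R) (p : R -> 'rV[R]_d -> R).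
Hypotheses (alpha_gt0 : 0 < alpha) (alpha_lt2 : alpha < 2) (m_gt0 : 0 < m).
Hypothesis pK : heat_kernel alpha m p.
Notation mu := (lebesgue_rV R d).
Notation mu2 := (lebesgue_rV R d \x lebesgue_rV R d)%E.
Notation sigma := (@symbolL R d alpha m).
Implicit Types (f g : 'rV[R]_d -> R[i]) (t : R).

Let w t (y : 'rV[R]_d) := expR (- t * sigma y).
Let wi t : 0 < t -> intble mu (w t).
Proof. by move=> t0; exact: intble_exp_symbol. Qed.
Let w0 t y : 0 <= w t y. Proof. exact: expR_ge0. Qed.
Let w1 t y : 0 < t -> w t y <= 1.
Proof. by move=> /ltW; exact: exp_symbol_le1. Qed.

(** The hypothesis on [p] concerns pairs related by the semigroup, so an image of g must be
    exhibited: the inverse transform of exp(-t sigma) times the transform of g, which is integrable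
    and bounded. *)
Let semigroup_kernel t g : 0 < t -> bounded_cpt g ->
  exists h, [/\ cmeasurable h, is_fourier h (fun y => (w t y)%:C%C * ft g y) &
    {ae mu, forall x, cintegrable setT (fun y => (p t (x - y))%:C%C * g y) /\
      h x = cintegral setT (fun y => (p t (x - y))%:C%C * g y)}].
Proof.
move=> t0 hg; have [_ hp] := pK t0.
have gi := bounded_cpt_cintegrable hg.
have [K gK] := ft_bounded gi.
have [mr mi] := ft_cmeasurable (cintegrable_cmeasurable gi).
have H (u : R) y : u ^+ 2 <= sqmod (ft g y) -> `|u| <= Num.sqrt K.
  by move=> h; rewrite -sqrtr_sqr ler_wsqrtr// (le_trans h).
have hi : cintegrable setT (fun y => (w t y)%:C%C * ft g y).
  split.
    under eq_fun do rewrite ReCM mulrC.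
    by apply: (intble_bdM mr _ (wi t0)) => y; exact: H (sqr_Re_le _).
  under eq_fun do rewrite ImCM mulrC.
  by apply: (intble_bdM mi _ (wi t0)) => y; exact: H (sqr_Im_le _).
have hK y : sqmod ((w t y)%:C%C * ft g y) <= K.
  rewrite sqmodCM; apply: le_trans (gK y); rewrite ler_piMl ?sqmod_ge0//.
  by rewrite expr_le1// w1.
have Fh := fourier_inversion hi hK; have [Lh _] := ift_L2 hi hK.
exists (ift (fun y => (w t y)%:C%C * ft g y)); split => //; first exact: Lh.1.
apply: (hp g (ift (fun y => (w t y)%:C%C * ft g y))).
exists (ft g), (fun y => (w t y)%:C%C * ft g y); split; [exact: bounded_cpt_fourier|exact: Fh|exact: aeW].
Qed.

Lemma heat_kernel_form t f g : 0 < t -> bounded_cpt f -> bounded_cpt g ->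
  \int[mu2]_z (p t (z.1 - z.2) * rdot (f z.1) (g z.2)) =
  \int[mu]_y (w t y * rdot (ft f y) (ft g y)).
Proof.
move=> t0 hf hg; have [ck _] := pK t0.
have [h [mh Fh ah]] := semigroup_kernel t0 hg.
have iK := intble_kernel ck hf hg.
rewrite -(RI_prod iK); transitivity (rip f h).
  apply: RI_ae => [||].
  - exact: (measurable_RI _ (intble_meas iK)).
  - exact: cmeasurable_rdot (cintegrable_cmeasurable (bounded_cpt_cintegrable hf)) mh.
  apply: filterS ah => x [[i1 i2] ->] /=.
  rewrite /rdot /= -(RIZ _ i1) -(RIZ _ i2) -RID; [|exact: intbleZ..].
  by apply: eq_Rintegral => y _; rewrite ReCM ImCM; ring.
rewrite -(parseval (bounded_cpt_fourier hf) Fh).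
by apply: eq_Rintegral => y _; rewrite rdotCMr.
Qed.

Let q t := cos_transform (w t).

(** Lipschitz in fact: the cosine is 1-Lipschitz, and the first moments of exp(-t sigma) are
    finite. *)
Let q_continuous t : 0 < t -> continuous (q t).
Proof.
move=> t0 x; pose D y := \sum_i `|w t y * rV_coord i y|.
have iD : intble mu D by apply: intble_sum => i; apply/intble_norm/intble_exp_symbolM.
have c0 := ltW (ft_const_gt0 R d).
pose B := ft_const R d ^+ 2 * \int[mu]_y D y.
have B0 : 0 <= B.
  rewrite mulr_ge0 ?exprn_ge0//; apply: Rintegral_ge0 => y _.
  by apply: sumr_ge0.
have L (x' : 'rV[R]_d) (r : R) : 0 <= r -> (forall i, `|x ord0 i - x' ord0 i| <= r) ->
    `|q t x - q t x'| <= r * B.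
  move=> r0 hr.
  rewrite /q /cos_transform -mulrBr normrM ger0_norm ?exprn_ge0//.
  rewrite mulrCA ler_wpM2l ?exprn_ge0//.
  have [i1 _] := intble_cos_transform x (wi t0); have [i2 _] := intble_cos_transform x' (wi t0).
  rewrite -(RIB i1 i2) -(RIZ _ iD).
  apply: le_trans (RI_norm (intbleB i1 i2)) _.
  apply: RI_le; [exact/intble_norm/intbleB|exact: intbleZ|move=> y].
  rewrite -mulrBr normrM (ger0_norm (w0 t y)) /D mulr_sumr.
  apply: (@le_trans _ _ (w t y * \sum_i `|(x - x') ord0 i * rV_coord i y|)).
    rewrite ler_wpM2l//; apply: le_trans (cos_lipschitz _ _) _.
    by rewrite -dotvBl; exact: ler_norm_sum.
  rewrite mulr_sumr; apply: ler_sum => i _.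
  rewrite !normrM (ger0_norm (w0 t y)) mulrCA ler_wpM2r ?mulr_ge0//.
  by rewrite !mxE.
have FF : Filter (nbhs x) by exact: nbhs_filter.
apply/(@cvgrPdist_le _ _ _ (nbhs x) FF) => e e0.
have Be : 0 < e / (B + 1) by rewrite divr_gt0// ltr_wpDl.
apply/nbhs_ballP; exists (e / (B + 1)) => //= x' [_ xx'].
apply: (@le_trans _ _ (e / (B + 1) * B)).
  apply: L => [|i]; first exact: ltW.
  by have := xx' ord0 i; rewrite -ball_normE /= => /ltW.
by rewrite mulrAC ler_pdivrMr ?ltr_wpDl// ler_wpM2l ?(ltW e0)// lerDl.
Qed.

Let p_q t (c : 'rV[R]_d) e c' e' : 0 < t ->
  \int[mu2]_z (p t (z.1 - z.2) * (box_ind c e z.1 * box_ind c' e' z.2)) =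
  \int[mu2]_z (q t (z.1 - z.2) * (box_ind c e z.1 * box_ind c' e' z.2)).
Proof.
move=> t0; have [i1 _] := bounded_cpt_cintegrable (bounded_cpt_box c e).
have [i2 _] := bounded_cpt_cintegrable (bounded_cpt_box c' e').
rewrite -(ft_weight_real (wi t0) i1 i2).
rewrite -(heat_kernel_form t0 (bounded_cpt_box c e) (bounded_cpt_box c' e')).
by apply: eq_Rintegral => z _; rewrite /rdot /= mulr0 addr0.
Qed.

Let iker (k : 'rV[R]_d -> R) (c : 'rV[R]_d) e c' e' : continuous k ->
  intble mu2 (fun z => k (z.1 - z.2) * (box_ind c e z.1 * box_ind c' e' z.2)).
Proof.
move=> ck; have := intble_kernel ck (bounded_cpt_box c e) (bounded_cpt_box c' e').
by rewrite /rdot /=; under eq_fun do rewrite mulr0 addr0.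
Qed.

(** Two continuous kernels with the same integrals against cubes coincide, by [kernel_ge0] applied
    to both differences. *)
Lemma heat_kernelE t x : 0 < t -> p t x = cos_transform (w t) x.
Proof.
move=> t0; have [ck _] := pK t0; have cq := q_continuous t0.
have H (k1 k2 : 'rV[R]_d -> R) : continuous k1 -> continuous k2 ->
    (forall c e c' e', \int[mu2]_z (k1 (z.1 - z.2) * (box_ind c e z.1 * box_ind c' e' z.2)) =
      \int[mu2]_z (k2 (z.1 - z.2) * (box_ind c e z.1 * box_ind c' e' z.2))) -> k1 x <= k2 x.
  move=> c1 c2 E; rewrite -subr_ge0; apply: (@kernel_ge0 R d (fun z => k2 z - k1 z)).
    by move=> z; exact: (@continuousB _ _ _ k2 k1 z (c2 z) (c1 z)).
  move=> c e c' e'; under eq_Rintegral do rewrite mulrBl.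
  by rewrite (RIB (iker _ _ _ _ c2) (iker _ _ _ _ c1)) E subrr.
apply/eqP; rewrite eq_le; apply/andP; split; apply: H => // *; first exact: p_q.
by rewrite p_q.
Qed.

(** Tested on two cubes, the kernel gives the Fourier integral of exp(-t sigma) against a
    [gauss_pos] function; being a positive multiplier, exp(-t sigma) preserves that property. *)
Lemma heat_kernel_ge0 t x : 0 < t -> 0 <= p t x.
Proof.
move=> t0; have [ck _] := pK t0; apply: (kernel_ge0 ck) => c e c' e'.
have h1 := bounded_cpt_box c e; have h2 := bounded_cpt_box c' e'.
have [Lf _] := plancherel (bounded_cpt_cintegrable h1) (bounded_cpt_L2 h1).
have [Lg _] := plancherel (bounded_cpt_cintegrable h2) (bounded_cpt_L2 h2).
have ib := L2_rdot Lf Lg.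
rewrite (_ : \int[mu2]_z _ = \int[mu]_y (w t y * rdot (ft (fun x => (box_ind c e x)%:C%C) y)
    (ft (fun x => (box_ind c' e' x)%:C%C) y))); last first.
  rewrite -(heat_kernel_form t0 h1 h2).
  by apply: eq_Rintegral => z _; rewrite /rdot /= mulr0 addr0.
have Mw : pos_mult (w t) by apply: pos_mult_exp_symbol => //; exact: ltW.
apply: gauss_pos_ge0; first exact: (pos_mult_intble Mw ib).
have [_ _ hw] := Mw; apply: hw => // u u0.
rewrite (ft_gauss u0 (bounded_cpt_cintegrable h1) (bounded_cpt_cintegrable h2)).
apply: Rintegral_ge0 => z _; rewrite mulr_ge0 ?heat_rV_ge0//.
rewrite /rdot /= mulr0 addr0 mulr_ge0// /box_ind indicE; exact: ler0n.
Qed.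

(** The hypothesis on [p] gives regularity in x for each t > 0; joint measurability comes from the
    explicit formula, and the value 0 replaces the unspecified [p t] for t <= 0. *)
Lemma measurable_heat_kernel : measurable_fun setT
  (fun z : measurableTypeR R * 'rV[R]_d => if 0 < z.1 then p z.1 z.2 else 0).
Proof.
pose F (z : (measurableTypeR R * 'rV[R]_d) * 'rV[R]_d) : R :=
  expR (- z.1.1 * sigma z.2) * cos (dotv z.1.2 z.2).
have mF : measurable_fun setT F.
  have ms : measurable_fun setT (fun z : (measurableTypeR R * 'rV[R]_d) * 'rV[R]_d => sigma z.2).
    exact: measurableT_comp (@measurable_symbol R d alpha m) measurable_snd.
  have m1 : measurable_fun setT (fun z : (measurableTypeR R * 'rV[R]_d) * 'rV[R]_d => z.1.1).
    exact: measurableT_comp measurable_fst measurable_fst.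
  have m2 : measurable_fun setT (fun z : (measurableTypeR R * 'rV[R]_d) * 'rV[R]_d => z.1.2).
    exact: measurableT_comp measurable_snd measurable_fst.
  apply: measurable_funM.
    apply: (measurableT_comp (@measurable_expR R)); apply: measurable_funM => //.
    exact: measurableT_comp (@oppr_measurable R _) m1.
  apply: (measurableT_comp (@measurable_cosR R)).
  by apply: measurable_dotv => //; exact: measurable_snd.
have mq : measurable_fun setT (fun z : measurableTypeR R * 'rV[R]_d => cos_transform (w z.1) z.2).
  apply: measurable_funM => //.
  exact: (@measurable_RI _ _ _ _ R mu F mF).
rewrite (_ : (fun z => _) = (fun z : measurableTypeR R * 'rV[R]_d =>
    if 0 < z.1 then cos_transform (w z.1) z.2 else 0)); last first.
  by apply/funext => z; case: ifP => // z0; rewrite heat_kernelE.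
apply: measurable_fun_ifT => //; apply: measurable_fun_ltr => //.
Qed.

End heat_kernel.

(** * Resolvent kernel *)

Section resolvent.
Context (R : realType) (d : nat).
Notation mu := (lebesgue_rV R d).
Notation mu2 := (lebesgue_rV R d \x lebesgue_rV R d)%E.
Notation leb := (@lebesgue_measure R).

(** Extended by zero so that integrals in t run over the whole line and fit the product-measure
    lemmas. *)
Definition exp_line (c t : R) : R := if 0 < t then expR (- c * t) else 0.

Lemma exp_line_ge0 c t : 0 <= exp_line c t.
Proof. by rewrite /exp_line; case: ifP. Qed.

Lemma measurable_exp_line c : measurable_fun setT (exp_line c).
Proof.
apply: measurable_fun_ifT => //; first exact: measurable_fun_ltr.
by apply: (measurableT_comp (@measurable_expR R)); exact: measurable_funM.
Qed.

Lemma exp_line_int c : 0 < c ->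
  intble leb (exp_line c) /\ \int[leb]_t exp_line c t = c^-1.
Proof.
move=> c0; have ie := intbleZ c^-1 (integrable_exponential_pdf c0).
have ae : {ae leb, forall t, c^-1 * exponential_pdf c t = exp_line c t}.
  exists [set 0]; split; [exact: measurable_set1|exact: lebesgue_measure_set1|].
  move=> t /=; apply: contra_notP => /eqP t0.
  rewrite /exp_line; case: ltgtP t0 => // t0 _; last first.
    by rewrite lt0_exponential_pdf// mulr0.
  by rewrite exponential_pdfE ?(ltW t0)// mulKf// gt_eqF.
have me : measurable_fun [set: measurableTypeR R] (exp_line c) := measurable_exp_line c.
split; first exact: (intble_ae me ae ie).
rewrite -(RI_ae (intble_meas ie) me ae) RIZ; last exact: integrable_exponential_pdf.
by rewrite /Rintegral integral_exponential_pdf// mulr1.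
Qed.

(** The resolvent is controlled only off the origin, hence the double integrals only off the
    diagonal; its sections are points, null in positive dimension. *)
Lemma ae_off_diagonal : (0 < d)%N -> {ae mu2, forall z, z.1 != z.2}.
Proof.
move=> d0; exists [set z : 'rV[R]_d * 'rV[R]_d | z.1 - z.2 = 0]; split.
- have := @measurable_subv R d measurableT _ (measurable_rV_set1 0).
  by rewrite setTI.
- rewrite /= /product_measure1 /=; apply: integral0_eq => x _ /=.
  rewrite (_ : xsection _ x = [set x]) ?lebesgue_rV_set1//.
  apply/seteqP; split=> y; rewrite /xsection /= inE /=.
    by move=> /eqP; rewrite subr_eq0 => /eqP ->.
  by move=> ->; rewrite subrr.
- by move=> z /= /negP; rewrite negbK => /eqP ->; rewrite subrr.
Qed.

Context (alpha m : R) (p : R -> 'rV[R]_d -> R).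
Hypotheses (alpha_gt0 : 0 < alpha) (alpha_lt2 : alpha < 2) (m_gt0 : 0 < m).
Hypothesis pK : heat_kernel alpha m p.
Notation sigma := (@symbolL R d alpha m).

Context (lambda : R).
Hypothesis lambda_gt0 : 0 < lambda.

Let pt (z : measurableTypeR R * 'rV[R]_d) : R := if 0 < z.1 then p z.1 z.2 else 0.

Let mpt : measurable_fun setT pt.
Proof. exact: (measurable_heat_kernel alpha_gt0 m_gt0 pK). Qed.

Let pt0 z : 0 <= pt z.
Proof.
by rewrite /pt; case: ifP => // /(heat_kernel_ge0 alpha_gt0 alpha_lt2 m_gt0 pK); exact.
Qed.

(** Real-valued version of [resolvent_kernel]; where the latter is infinite, as may happen at the
    origin, it takes the default value 0. *)
Definition resolvent x : R :=
  \int[leb]_t (exp_line lambda t * (if 0 < t then p t x else 0)).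

Lemma resolvent_kernelE x : resolvent_kernel p lambda x =
  (\int[leb]_t (exp_line lambda t * (if 0 < t then p t x else 0))%:E)%E.
Proof.
rewrite /resolvent_kernel integral_mkcond; apply: eq_integral => t _.
rewrite patchE mem_setE in_itv/= andbT /exp_line; case: ifP => // _.
by rewrite mul0r.
Qed.

Lemma resolvent_ge0 x : 0 <= resolvent x.
Proof.
by apply: Rintegral_ge0 => t _; rewrite mulr_ge0 ?exp_line_ge0//; exact: (pt0 (t, x)).
Qed.

Lemma measurable_resolvent : measurable_fun setT resolvent.
Proof.
apply: (@measurable_RI _ _ _ _ R leb (fun z : 'rV[R]_d * measurableTypeR R =>
  exp_line lambda z.2 * pt (z.2, z.1))).
apply: measurable_funM.
  have me : measurable_fun [set: measurableTypeR R] (exp_line lambda) := measurable_exp_line _.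
  exact: measurableT_comp me measurable_snd.
exact: (measurable_swap_fun mpt).
Qed.

Let mt x : measurable_fun [set: measurableTypeR R] (fun t => exp_line lambda t * pt (t, x)).
Proof.
have me : measurable_fun [set: measurableTypeR R] (exp_line lambda) := measurable_exp_line _.
apply: measurable_funM => //.
by apply: (measurableT_comp mpt); apply/measurable_fun_pair.
Qed.

Lemma resolvent_kernel_fin x : (resolvent_kernel p lambda x < +oo)%E ->
  intble leb (fun t => exp_line lambda t * (if 0 < t then p t x else 0)) /\
  resolvent_kernel p lambda x = (resolvent x)%:E.
Proof.
move=> foo; have i : intble leb (fun t => exp_line lambda t * pt (t, x)).
  apply: (intble_lty (mt x)); last by rewrite -resolvent_kernelE.
  by move=> t; rewrite mulr_ge0 ?exp_line_ge0.
by split => //; rewrite resolvent_kernelE EFin_RI.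
Qed.

Hypothesis fin_res : forall x, x != 0 -> (resolvent_kernel p lambda x < +oo)%E.
Hypothesis d_gt0 : (0 < d)%N.

Let el := exp_line lambda.
Let mel : measurable_fun [set: measurableTypeR R] el := measurable_exp_line lambda.

(** The Laplace transform in t of exp(-t sigma) at lambda is 1/(sigma + lambda), and Fubini brings
    it inside the y-integral. *)
Let laplace_symbol (g : 'rV[R]_d -> R[i]) : bounded_cpt g ->
  intble leb (fun t => el t * \int[mu]_y (expR (- t * sigma y) * sqmod (ft g y))) /\
  \int[leb]_t (el t * \int[mu]_y (expR (- t * sigma y) * sqmod (ft g y))) =
  \int[mu]_y ((sigma y + lambda)^-1 * sqmod (ft g y)).
Proof.
move=> hg; have [Lg _] := plancherel (bounded_cpt_cintegrable hg) (bounded_cpt_L2 hg).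
have ig := L2_intble Lg; have [ie _] := exp_line_int lambda_gt0.
have mg := intble_meas ig.
pose F (z : measurableTypeR R * 'rV[R]_d) : R :=
  el z.1 * (expR (- z.1 * sigma z.2) * sqmod (ft g z.2)).
have mF : measurable_fun setT F.
  apply: measurable_funM; first exact: measurableT_comp mel measurable_fst.
  apply: measurable_funM; last exact: measurableT_comp mg measurable_snd.
  apply: (measurableT_comp (@measurable_expR R)); apply: measurable_funM.
    exact: measurableT_comp (@oppr_measurable R _) measurable_fst.
  exact: measurableT_comp (@measurable_symbol R d alpha m) measurable_snd.
have iF : intble (leb \x mu)%E F.
  apply: (intble_le mF _ (intble_prod ie ig)) => z /=.
  rewrite /F /el /exp_line; case: ifP => z0; last by rewrite !mul0r normr0.
  rewrite ger0_norm; last by rewrite !mulr_ge0 ?expR_ge0 ?sqmod_ge0.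
  rewrite ler_wpM2l ?expR_ge0// ler_piMl ?sqmod_ge0//.
  by apply: exp_symbol_le1 => //; exact: ltW.
have E t : el t * \int[mu]_y (expR (- t * sigma y) * sqmod (ft g y)) = \int[mu]_y F (t, y).
  rewrite /F /el /exp_line /=; case: ifP => t0; last first.
    by rewrite mul0r; under [RHS]eq_Rintegral do rewrite mul0r; rewrite RI0.
  rewrite RIZ//; apply: (intble_le _ _ ig) => [|y].
    by apply: measurable_funM => //; exact: measurable_exp_symbol.
  rewrite ger0_norm ?mulr_ge0 ?expR_ge0 ?sqmod_ge0// ler_piMl ?sqmod_ge0//.
  by apply: exp_symbol_le1 => //; exact: ltW.
under eq_fun do rewrite E; under eq_Rintegral do rewrite E.
split; first exact: (intble_RI iF).
rewrite (RI_fubini iF); apply: eq_Rintegral => y _.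
have s0 : 0 < sigma y + lambda by rewrite ltr_wpDl// symbol_ge0.
have [i1 <-] := exp_line_int s0.
rewrite mulrC -RIZ//; apply: eq_Rintegral => t _; rewrite /F /el /exp_line/=.
case: ifP => _; rewrite ?mul0r ?mulr0// mulrA -expRD mulrC; congr (_ * expR _).
by ring.
Qed.

Let G (g : 'rV[R]_d -> R[i]) (z : measurableTypeR R * ('rV[R]_d * 'rV[R]_d)) : R :=
  (el z.1 * pt (z.1, z.2.1 - z.2.2)) * rdot (g z.2.1) (g z.2.2).

Let mG g : bounded_cpt g -> measurable_fun setT (G g).
Proof.
move=> hg; have gi := bounded_cpt_cintegrable hg.
apply: measurable_funM; first apply: measurable_funM.
- exact: measurableT_comp mel measurable_fst.
- apply: (measurableT_comp mpt); apply/measurable_fun_pair; first exact: measurable_fst.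
  exact: measurableT_comp (@measurable_subv R d) measurable_snd.
- exact: measurableT_comp (intble_meas (cintegrable_rdot2 gi gi)) measurable_snd.
Qed.

Let inner g t : bounded_cpt g ->
  intble mu2 (fun z => G g (t, z)) /\
  \int[mu2]_z G g (t, z) = el t * \int[mu]_y (expR (- t * sigma y) * sqmod (ft g y)).
Proof.
move=> hg; rewrite /G /el /exp_line /pt /=; case: ifP => t0; last first.
  under eq_fun do rewrite !mul0r.
  by under eq_Rintegral do rewrite !mul0r; rewrite RI0 mul0r; split => //; exact: intble0.
have [ck _] := pK t0; have iK := intble_kernel ck hg hg.
under eq_fun do rewrite -mulrA; under eq_Rintegral do rewrite -mulrA.
split; first exact: intbleZ.
by rewrite (RIZ _ iK) (heat_kernel_form alpha_gt0 m_gt0 pK t0 hg hg).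
Qed.

(** All factors being nonnegative, Tonelli reduces integrability to the finite Laplace integral of
    [laplace_symbol]. *)
Let iG_ge0 g : bounded_cpt g -> (forall x y, 0 <= rdot (g x) (g y)) ->
  intble (leb \x prod_sf mu mu)%E (G g).
Proof.
move=> hg g0; have [iL _] := laplace_symbol hg.
have G0 z : 0 <= G g z by rewrite !mulr_ge0 ?exp_line_ge0.
apply/integrable12ltyP; first by apply/measurable_EFinP; exact: mG.
apply: (@le_lt_trans _ _ (\int[leb]_t (el t *
    \int[mu]_y (expR (- t * sigma y) * sqmod (ft g y)))%:E)%E); last by rewrite -EFin_RI// ltry.
rewrite le_eqVlt; apply/orP; left; apply/eqP; apply: eq_integral => t _.
have [i1 <-] := inner t hg; rewrite EFin_RI//; apply: eq_integral => z _.
by rewrite /= ger0_norm.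
Qed.

(** Domination by the nonnegative case of the indicator of a ball outside which g vanishes; [K + K]
    bounds |rdot (g x) (g y)| by [rdot_le]. *)
Let iG g : bounded_cpt g -> intble (leb \x prod_sf mu mu)%E (G g).
Proof.
move=> hg; have [mg [K gK] [n g0]] := hg.
have K0 : 0 <= K by exact: le_trans (sqmod_ge0 _) (gK 0).
pose a (x : 'rV[R]_d) : R[i] := (cutoff n x)%:C%C.
have ha : bounded_cpt a.
  split; first by apply: cmeasurableR; exact: measurable_cutoff.
    exists 1 => x; rewrite /a /sqmod /cutoff /= expr0n addr0.
    by case: ifP; rewrite ?expr1n ?expr0n.
  by exists n => x nx; rewrite /a /cutoff leNgt nx.
have ia := iG_ge0 ha (fun x y => _).
apply: (intble_le (mG hg) _ (intbleZ (K + K) (ia _))); last first.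
  by move=> x y; rewrite /rdot /= mulr0 addr0 mulr_ge0 ?cutoff_ge0.
move=> z; rewrite /G normrM ger0_norm; last by rewrite mulr_ge0 ?exp_line_ge0.
rewrite mulrCA ler_wpM2l ?mulr_ge0 ?exp_line_ge0//.
rewrite /rdot /= mulr0 addr0 /cutoff.
case: ifPn => [_|]; last first.
  by rewrite -ltNge => /g0 ->; rewrite /= !mul0r addr0 normr0 mulr0.
case: ifPn => [_|]; last first.
  by rewrite -ltNge => /g0 ->; rewrite /= !mulr0 addr0 normr0.
by rewrite !mulr1; apply: le_trans (rdot_le _ _) _; apply: lerD.
Qed.

(** Both sides are the triple integral of [G]. Integrating in t first produces the resolvent kernel
    off the diagonal; integrating in space first produces the Fourier form of <g, (L + lambda)^{-1}
    g>. *)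
Theorem resolvent_form g : bounded_cpt g ->
  intble mu2 (fun z => resolvent (z.1 - z.2) * rdot (g z.1) (g z.2)) /\
  \int[mu2]_z (resolvent (z.1 - z.2) * rdot (g z.1) (g z.2)) =
  \int[mu]_y ((sigma y + lambda)^-1 * sqmod (ft g y)).
Proof.
move=> hg; have [_ <-] := laplace_symbol hg.
have gi := bounded_cpt_cintegrable hg.
have iGg := iG hg.
have iS := intble_RI (intble_swap iGg).
have mR : measurable_fun setT (fun z : 'rV[R]_d * 'rV[R]_d =>
    resolvent (z.1 - z.2) * rdot (g z.1) (g z.2)).
  apply: measurable_funM; last exact: (intble_meas (cintegrable_rdot2 gi gi)).
  exact: measurableT_comp measurable_resolvent (@measurable_subv R d).
have ae : {ae mu2, forall z, \int[leb]_t G g (t, z) =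
    resolvent (z.1 - z.2) * rdot (g z.1) (g z.2)}.
  apply: filterS (ae_off_diagonal d_gt0) => z z12.
  have z0 : z.1 - z.2 != 0 by rewrite subr_eq0.
  have [i _] := resolvent_kernel_fin (fin_res z0).
  rewrite /resolvent mulrC -RIZ//.
  by apply: eq_Rintegral => t _; rewrite /G mulrC.
split; first exact: (intble_ae mR ae iS).
rewrite -(RI_ae (intble_meas iS) mR ae) -(RI_fubini iGg).
by apply: eq_Rintegral => t _; have [_ ->] := inner t hg.
Qed.

End resolvent.

(** * Birman-Schwinger bound *)

Section rdot_inequalities.
Context (R : realType).

Lemma sqr_rdot_le (z w : R[i]) : rdot z w ^+ 2 <= sqmod z * sqmod w.
Proof.
rewrite -subr_ge0 (_ : _ - _ = (Re z * Im w - Im z * Re w) ^+ 2) ?sqr_ge0//.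
by rewrite /sqmod /rdot; ring.
Qed.

(* 2 is the dimension of R[i] over R: the left-hand side is the square of a trace *)
Lemma sqr_sum_rdot_le n (z w : 'I_n -> R[i]) :
  (\sum_i rdot (z i) (w i)) ^+ 2 <=
  2 * \sum_i \sum_j rdot (z i) (z j) * rdot (w i) (w j).
Proof.
pose re (c : R[i]) := Re c; pose im (c : R[i]) := Im c.
pose T (a b : R[i] -> R) : R := \sum_i a (z i) * b (w i).
have TT a b : T a b ^+ 2 = \sum_i \sum_j (a (z i) * a (z j)) * (b (w i) * b (w j)).
  rewrite /T expr2 mulr_suml; apply: eq_bigr => i _.
  by rewrite mulr_sumr; apply: eq_bigr => j _; ring.
have -> : \sum_i rdot (z i) (w i) = T re re + T im im by rewrite /T -big_split.
have -> : \sum_i \sum_j rdot (z i) (z j) * rdot (w i) (w j) =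
    T re re ^+ 2 + T re im ^+ 2 + T im re ^+ 2 + T im im ^+ 2.
  rewrite !TT -!big_split; apply: eq_bigr => i _; rewrite -!big_split.
  by apply: eq_bigr => j _; rewrite /rdot /re /im /=; ring.
move: (T re re) (T im im) (T re im) (T im re) => a b c e.
have := sqr_ge0 (a - b); have := sqr_ge0 c; have := sqr_ge0 e; rewrite !expr2; lra.
Qed.

End rdot_inequalities.

(** * The form domain seen in Fourier space *)

Section form_domain.
Context (R : realType) (d : nat) (alpha m : R).
Hypotheses (alpha_gt0 : 0 < alpha) (m_gt0 : 0 < m).
Notation mu := (lebesgue_rV R d).
Notation sigma := (@symbolL R d alpha m).
Implicit Types (phi psi g h k : 'rV[R]_d -> R[i]).

(* g = L^{1/2} phi, and h, k are the transforms of phi, g *)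
Definition in_form_domain phi h g k := [/\ is_fourier phi h, is_fourier g k &
  {ae mu, forall y, k y = (Num.sqrt (sigma y))%:C%C * h y}].

Lemma form_domain_L2 phi h g k : in_form_domain phi h g k ->
  [/\ L2 phi, L2 h, L2 g & L2 k].
Proof. by move=> [[Lp Lh _] [Lg Lk _] _]. Qed.

Lemma form_domainD phi1 h1 g1 k1 phi2 h2 g2 k2 :
  in_form_domain phi1 h1 g1 k1 -> in_form_domain phi2 h2 g2 k2 ->
  in_form_domain (fun x => phi1 x + phi2 x) (fun x => h1 x + h2 x)
    (fun x => g1 x + g2 x) (fun x => k1 x + k2 x).
Proof.
move=> [F1 G1 A1] [F2 G2 A2]; split; [exact: fourierD|exact: fourierD|].
by apply: filterS2 A1 A2 => y -> ->; rewrite mulrDr.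
Qed.

Lemma form_domainZ (c : R[i]) phi h g k : in_form_domain phi h g k ->
  in_form_domain (fun x => c * phi x) (fun x => c * h x)
    (fun x => c * g x) (fun x => c * k x).
Proof.
move=> [F1 G1 A1]; split; [exact: fourierZ|exact: fourierZ|].
by apply: filterS A1 => y ->; rewrite mulrCA.
Qed.

Lemma form_domain0 :
  in_form_domain (fun=> 0) (fun=> 0) (fun=> 0) (fun=> 0).
Proof.
have F0 : is_fourier (fun _ : 'rV[R]_d => 0) (fun=> 0 : R[i]).
  have := fourierZ 0 (bounded_cpt_fourier (bounded_cpt_box (0 : 'rV[R]_d) 1)).
  by under eq_fun do rewrite mul0r; under [X in is_fourier _ X]eq_fun do rewrite mul0r.
by split => //; apply: aeW => y; rewrite mulr0.
Qed.

Lemma form_domain_sum I (s : seq I) (c : I -> R[i]) (phi h g k : I -> 'rV[R]_d -> R[i]) :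
  (forall i, in_form_domain (phi i) (h i) (g i) (k i)) ->
  in_form_domain (fun x => \sum_(i <- s) c i * phi i x) (fun x => \sum_(i <- s) c i * h i x)
    (fun x => \sum_(i <- s) c i * g i x) (fun x => \sum_(i <- s) c i * k i x).
Proof.
move=> H; elim: s => [|i s IH].
  have E (f : I -> 'rV[R]_d -> R[i]) : (fun x => \sum_(j <- [::]) c j * f j x) = (fun=> 0).
    by apply/funext => x; rewrite big_nil.
  by rewrite !E; exact: form_domain0.
have E (f : I -> 'rV[R]_d -> R[i]) : (fun x => \sum_(j <- i :: s) c j * f j x) =
    (fun x => c i * f i x + \sum_(j <- s) c j * f j x).
  by apply/funext => x; rewrite big_cons.
by rewrite !E; apply: form_domainD => //; exact: form_domainZ.
Qed.

Lemma form_domain_rip phi1 h1 g1 k1 phi2 h2 g2 k2 :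
  in_form_domain phi1 h1 g1 k1 -> in_form_domain phi2 h2 g2 k2 ->
  intble mu (fun y => sigma y * rdot (h1 y) (h2 y)) /\
  \int[mu]_y (sigma y * rdot (h1 y) (h2 y)) = rip g1 g2.
Proof.
move=> D1 D2; have [_ Lh1 _ Lk1] := form_domain_L2 D1; have [_ Lh2 _ Lk2] := form_domain_L2 D2.
have [_ G1 A1] := D1; have [_ G2 A2] := D2; have ik := L2_rdot Lk1 Lk2.
have ms : measurable_fun setT (fun y => sigma y * rdot (h1 y) (h2 y)).
  apply: measurable_funM; first exact: measurable_symbol.
  exact: (intble_meas (L2_rdot Lh1 Lh2)).
have E : {ae mu, forall y, rdot (k1 y) (k2 y) = sigma y * rdot (h1 y) (h2 y)}.
  apply: filterS2 A1 A2 => y -> ->; rewrite rdotCMl rdotCMr mulrA -expr2 sqr_sqrtr//.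
  exact: symbol_ge0.
split; first exact: (intble_ae ms E ik).
by rewrite -(RI_ae (intble_meas ik) ms E) -(parseval G1 G2).
Qed.

Lemma form_domain_weighted phi h g k (lambda : R) : in_form_domain phi h g k ->
  intble mu (fun y => (sigma y + lambda) * sqmod (h y)) /\
  \int[mu]_y ((sigma y + lambda) * sqmod (h y)) = rip g g + lambda * rip phi phi.
Proof.
move=> D; have [Lphi Lh _ _] := form_domain_L2 D; have [F _ _] := D.
have [i1 <-] := form_domain_rip D D.
rewrite -(parseval F F) -(RIZ lambda (L2_rdot Lh Lh)).
have i2 := intbleZ lambda (L2_rdot Lh Lh).
rewrite -(RID i1 i2); under eq_fun do rewrite mulrDl sqmodE.
by split; [exact: (intbleD i1 i2)|apply: eq_Rintegral => y _; rewrite mulrDl].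
Qed.

(* the Cauchy-Schwarz inequality for the pairing of the form domain with its dual,
   in additive form *)
Lemma form_domain_pairing phi h g k (lambda s : R) u : 0 < lambda -> 0 < s ->
  in_form_domain phi h g k -> bounded_cpt u ->
  2 * rip phi u <= s * (rip g g + lambda * rip phi phi) +
    s^-1 * \int[mu]_y ((sigma y + lambda)^-1 * sqmod (ft u y)).
Proof.
move=> l0 s0 D hu; have [F _ _] := D; have [_ Lh _ _] := form_domain_L2 D.
rewrite -(parseval F (bounded_cpt_fourier hu)).
have [Lu _] := plancherel (bounded_cpt_cintegrable hu) (bounded_cpt_L2 hu).
have [i1 <-] := form_domain_weighted lambda D.
have sl y : 0 < sigma y + lambda by rewrite ltr_wpDl// symbol_ge0.
have i2 : intble mu (fun y => (sigma y + lambda)^-1 * sqmod (ft u y)).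
  apply: (@intble_bdM _ _ _ mu lambda^-1) (L2_intble Lu).
    have ms := @measurable_symbol R d alpha m.
    have msl : measurable_fun setT (fun y => sigma y + lambda) by exact: measurable_funD.
    rewrite (_ : (fun y => _) = (fun y => (sigma y + lambda) `^ (-1))).
      exact: measurableT_comp (measurable_powR (-1)) msl.
    by apply/funext => y; rewrite powR_inv1// ltW.
  by move=> y; rewrite ger0_norm ?invr_ge0 ?(ltW (sl y))// lef_pV2 ?posrE// lerDr symbol_ge0.
rewrite /rip -(RIZ _ (L2_rdot Lh Lu)) -(RIZ _ i1) -(RIZ _ i2) -RID; [|exact: intbleZ..].
apply: RI_le.
- exact/intbleZ/L2_rdot.
- by apply: intbleD; exact: intbleZ.
move=> y; set a := sigma y + lambda; have a0 : 0 < a := sl y.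
have sa : 0 < s * a by rewrite mulr_gt0.
(* With a = sigma + lambda, the claim is |s a h - u^|^2 >= 0 divided by s a, u^ being the transform
   of u. *)
have := sqmod_ge0 ((s * a)%:C%C * h y - ft u y).
rewrite sqmodD sqmodN rdotNr rdotCMl sqmodCM => H.
rewrite -(ler_pM2l sa).
rewrite (_ : s * a * (s * (a * sqmod (h y)) + s^-1 * (a^-1 * sqmod (ft u y))) =
  (s * a) ^+ 2 * sqmod (h y) + sqmod (ft u y)); first lra.
by field; rewrite !gt_eqF.
Qed.

End form_domain.

(** * The weighted resolvent and its Hilbert-Schmidt norm *)

Section birman_schwinger.
Context (R : realType) (d : nat) (alpha m : R) (p : R -> 'rV[R]_d -> R) (lambda : R).
Hypotheses (alpha_gt0 : 0 < alpha) (alpha_lt2 : alpha < 2) (m_gt0 : 0 < m).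
Hypotheses (pK : heat_kernel alpha m p) (lambda_gt0 : 0 < lambda) (d_gt0 : (0 < d)%N).
Hypothesis fin_res : forall x, x != 0 -> (resolvent_kernel p lambda x < +oo)%E.
Notation mu := (lebesgue_rV R d).
Notation mu2 := (lebesgue_rV R d \x lebesgue_rV R d)%E.
Notation sigma := (@symbolL R d alpha m).
Notation res := (resolvent p lambda).
Implicit Types (phi h g k : 'rV[R]_d -> R[i]) (U : 'rV[R]_d -> R).

Let mres2 : measurable_fun setT (fun z : 'rV[R]_d * 'rV[R]_d => res (z.1 - z.2)).
Proof.
exact: measurableT_comp (measurable_resolvent alpha_gt0 m_gt0 pK lambda)
  (@measurable_subv R d).
Qed.

(** For nonnegative U, the squared Hilbert-Schmidt norm of U^{1/2} (L + lambda)^{-1} U^{1/2}. *)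
Definition res_sq U : R :=
  \int[mu2]_z (res (z.1 - z.2) ^+ 2 * (U z.1 * U z.2)).

Definition res_sq_intble U :=
  intble mu2 (fun z => res (z.1 - z.2) ^+ 2 * (U z.1 * U z.2)).

Section weight.
Context (U : 'rV[R]_d -> R).
Hypotheses (mU : measurable_fun setT U) (U0 : forall x, 0 <= U x).
Hypothesis iU : res_sq_intble U.

Let Q0 : 0 <= res_sq U.
Proof.
by apply: Rintegral_ge0 => z _; rewrite mulr_ge0 ?sqr_ge0 ?mulr_ge0.
Qed.

Section one_function.
Context (phi h g k : 'rV[R]_d -> R[i]).
Hypothesis D : in_form_domain alpha m phi h g k.

Let N := rip g g + lambda * rip phi phi.

Let N0 : 0 <= N.
Proof. by rewrite addr_ge0 ?rip_ge0// mulr_ge0 ?rip_ge0// ltW. Qed.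

Let mphi : cmeasurable phi. Proof. by have [[]] := form_domain_L2 D. Qed.

(** Cuts position, weight and function value at once, which makes cut U phi a [bounded_cpt] test
    function, as [resolvent_form] demands. *)
Let cut j x : R :=
  cutoff j x * ((if U x <= j%:R then 1 else 0) * (if sqmod (phi x) <= j%:R then 1 else 0)).

Let mcut j : measurable_fun setT (cut j).
Proof.
apply: measurable_funM; first exact: measurable_cutoff.
apply: measurable_funM; apply: measurable_fun_ifT => //; apply: measurable_fun_ler => //.
exact: cmeasurable_sqmod.
Qed.

Let cut01 j x : cut j x = 0 \/ [/\ cut j x = 1, enorm x <= j%:R, U x <= j%:R &
  sqmod (phi x) <= j%:R].
Proof.
rewrite /cut /cutoff; case: ifP => a; last by left; rewrite mul0r.
case: ifP => b; last by left; rewrite mul0r mulr0.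
case: ifP => c; last by left; rewrite !mulr0.
by right; rewrite !mulr1.
Qed.

Let cut_ge0 j x : 0 <= cut j x.
Proof. by case: (cut01 j x) => [->|[->]]. Qed.

Let cut_le1 j x : cut j x <= 1.
Proof. by case: (cut01 j x) => [->|[->]]. Qed.

Let cut_near x : \forall j \near \oo, cut j x = 1.
Proof.
exists (Num.truncn (enorm x + U x + sqmod (phi x))).+1 => // j /= h1.
have h2 : enorm x + U x + sqmod (phi x) <= j%:R.
  by rewrite (le_trans (ltW (truncnS_gt _)))// ler_nat.
have e0 : 0 <= enorm x by exact: sqrtr_ge0.
have s0 := sqmod_ge0 (phi x); have u0 := U0 x.
by rewrite /cut /cutoff !ifT ?mulr1//; lra.
Qed.

Let u j x : R[i] := (cut j x * U x)%:C%C * phi x.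

Let u_cpt j : bounded_cpt (u j).
Proof.
split.
- apply: cmeasurableM => //; apply: cmeasurableR; exact: measurable_funM.
- exists (j%:R ^+ 2 * j%:R) => x; rewrite /u sqmodCM.
  case: (cut01 j x) => [->|[-> _ b c]].
    by rewrite mul0r expr0n mul0r mulr_ge0 ?sqr_ge0.
  by rewrite mul1r ler_pM ?sqr_ge0 ?sqmod_ge0// lerXn2r ?nnegrE.
- exists j => x; case: (cut01 j x) => [e|[_ a _ _]] b.
    by rewrite /u e mul0r mul0r.
  by rewrite leNgt b in a.
Qed.

Let X j := rip phi (u j).

Let XE j x : rdot (phi x) (u j x) = cut j x * (U x * sqmod (phi x)).
Proof. by rewrite /u rdotCMr -mulrA. Qed.

Let iX j : intble mu (fun x => cut j x * (U x * sqmod (phi x))).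
Proof.
have [Lp _ _ _] := form_domain_L2 D.
by have := L2_rdot Lp (bounded_cpt_L2 (u_cpt j)); under eq_fun do rewrite XE.
Qed.

Let XE' j : X j = \int[mu]_x (cut j x * (U x * sqmod (phi x))).
Proof. by apply: eq_Rintegral => x _; rewrite XE. Qed.

Let truncated_ineq (s : R) j : 0 < s ->
  2 * X j <= s * N + s^-1 * \int[mu2]_z (res (z.1 - z.2) * rdot (u j z.1) (u j z.2)).
Proof.
move=> s0; have := form_domain_pairing alpha_gt0 m_gt0 lambda_gt0 s0 D (u_cpt j).
have [_ ->//] := resolvent_form alpha_gt0 alpha_lt2 m_gt0 pK lambda_gt0 fin_res d_gt0 (u_cpt j).
Qed.

(** Young's inequality for r and rdot (phi x) (phi y), weighted by U x U y. It separates the squared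
    kernel from a product of densities in x and y. *)
Let res_young (tau : R) x y : 0 < tau ->
  2 * (res (x - y) * (U x * U y * rdot (phi x) (phi y))) <=
  tau * (res (x - y) ^+ 2 * (U x * U y)) +
  tau^-1 * ((U x * sqmod (phi x)) * (U y * sqmod (phi y))).
Proof.
move=> t0; set r := res (x - y); set q := rdot _ _.
have UU : 0 <= U x * U y by rewrite mulr_ge0.
have q2 : q ^+ 2 <= sqmod (phi x) * sqmod (phi y) := sqr_rdot_le _ _.
have h1 : 2 * (r * q) <= tau * r ^+ 2 + tau^-1 * q ^+ 2.
  rewrite -(ler_pM2l t0) [leRHS]mulrDr (mulrA tau tau^-1) mulfV ?gt_eqF// mul1r.
  by have := sqr_ge0 (tau * r - q); rewrite sqrrB; nra.
have h2 : tau^-1 * q ^+ 2 <= tau^-1 * (sqmod (phi x) * sqmod (phi y)).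
  by rewrite ler_pM2l// invr_gt0.
have := ler_wpM2l UU (le_trans h1 (lerD (lexx _) h2)); lra.
Qed.

Let X_ge0 j : 0 <= X j.
Proof.
rewrite XE'; apply: Rintegral_ge0 => x _.
exact: (mulr_ge0 (cut_ge0 j x) (mulr_ge0 (U0 x) (sqmod_ge0 _))).
Qed.

(** Bootstrap, uniform in j. With Q = [res_sq U], Young's inequality with tau = X j bounds the
    truncated double integral by X j (Q + 1)/2. The pairing inequality with s = (Q + 1)/2 then reads
    2 X j <= s N + X j, and the finite X j is absorbed. *)
Let X_bound j : X j <= (res_sq U + 1) / 2 * N.
Proof.
have := X_ge0 j; rewrite le_eqVlt => /predU1P[<-|X0].
  by rewrite mulr_ge0// divr_ge0// addr_ge0.
have [s [s0 sE ->]] : exists s : R, [/\ 0 < s, res_sq U + 1 = 2 * s & (res_sq U + 1) / 2 = s].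
  exists ((res_sq U + 1) / 2); split => //; first by rewrite divr_gt0// ltr_wpDl.
  by rewrite mulrC divfK.
have [i1 _] := resolvent_form alpha_gt0 alpha_lt2 m_gt0 pK lambda_gt0 fin_res d_gt0 (u_cpt j).
have iXX := intble_prod (iX j) (iX j).
have B : 2 * \int[mu2]_z (res (z.1 - z.2) * rdot (u j z.1) (u j z.2)) <=
    X j * res_sq U + (X j)^-1 * (X j * X j).
  rewrite {3 4}XE' (RI_prodM (iX j) (iX j)) /res_sq -(RIZ _ i1) -(RIZ _ iU) -(RIZ _ iXX).
  rewrite -(RID (intbleZ _ iU) (intbleZ _ iXX)).
  apply: RI_le; [exact: intbleZ|by apply: intbleD; exact: intbleZ|move=> z].
  have H := res_young z.1 z.2 X0.
  have c1 := cut_ge0 j z.1; have c2 := cut_ge0 j z.2.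
  have cc : 0 <= cut j z.1 * cut j z.2 by rewrite mulr_ge0.
  have cc1 : cut j z.1 * cut j z.2 <= 1 by rewrite mulr_ile1.
  rewrite /u rdotCMl rdotCMr.
  have q0 : 0 <= X j * (res (z.1 - z.2) ^+ 2 * (U z.1 * U z.2)).
    by apply: mulr_ge0; [exact: ltW|apply: mulr_ge0; [exact: sqr_ge0|exact: mulr_ge0]].
  have := ler_wpM2l cc H; have := ler_piMl q0 cc1; lra.
have := truncated_ineq j s0; rewrite mulKf ?gt_eqF// in B => T.
have B' : \int[mu2]_z (res (z.1 - z.2) * rdot (u j z.1) (u j z.2)) <= X j * s.
  have : X j * res_sq U + X j = 2 * (X j * s).
    by rewrite -{2}(mulr1 (X j)) -mulrDr sE; ring.
  by move: B => /[swap] ->; rewrite ler_pM2l.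
have : s^-1 * \int[mu2]_z (res (z.1 - z.2) * rdot (u j z.1) (u j z.2)) <= X j.
  by rewrite ler_pdivrMl// mulrC.
move=> h3; move: T; rewrite mulr2n mulrDl !mul1r => T; rewrite -(lerD2r (X j)).
by apply: le_trans T _; rewrite lerD2l.
Qed.

(** Fatou's lemma applied to the uniform bound [X_bound]: the weight is form-bounded, so its
    integrals over the form domain are finite. *)
Lemma form_domain_intble : intble mu (fun x => U x * sqmod (phi x)).
Proof.
have mF : measurable_fun setT (fun x => U x * sqmod (phi x)).
  by apply: measurable_funM => //; exact: cmeasurable_sqmod.
apply: intble_lty => //; first by move=> x; rewrite mulr_ge0 ?sqmod_ge0.
apply: (@le_lt_trans _ _ ((res_sq U + 1) / 2 * N)%:E); last exact: ltry.
have -> : (\int[mu]_x (U x * sqmod (phi x))%:E = \int[mu]_x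
    limn_einf (fun j => (cut j x * (U x * sqmod (phi x)))%:E))%E.
  apply: eq_integral => x _; apply/esym; apply: (cvg_limn_einf_sup _).1.
  have hc : cut j x * (U x * sqmod (phi x)) @[j --> \oo] --> U x * sqmod (phi x).
    by apply: cvg_near_cst; apply: filterS (cut_near x) => j ->; rewrite mul1r.
  by apply: cvg_EFin hc; exact: nearW.
apply: le_trans (fatou _ _ _ _) _ => //.
- by move=> j; apply/measurable_EFinP; exact: (intble_meas (iX j)).
- move=> j x _; rewrite lee_fin.
  exact: (mulr_ge0 (cut_ge0 j x) (mulr_ge0 (U0 x) (sqmod_ge0 _))).
rewrite limn_einf_lim; apply: lime_le; first exact: is_cvg_einfs.
apply: nearW => j; apply: (@le_trans _ _ (X j)%:E); last by rewrite lee_fin.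
rewrite XE' EFin_RI//; apply: ereal_inf_lbound; exists j => //=.
Qed.

(** The kernel expression for <U phi, (L + lambda)^{-1} U phi>. *)
Definition birman_schwinger_form : R :=
  \int[mu2]_z (res (z.1 - z.2) * (U z.1 * U z.2 * rdot (phi z.1) (phi z.2))).

Lemma birman_schwinger_intble :
  intble mu2 (fun z => res (z.1 - z.2) * (U z.1 * U z.2 * rdot (phi z.1) (phi z.2))).
Proof.
have i0 := form_domain_intble; have iXX := intble_prod i0 i0.
apply: (intble_le _ _ (intbleD iU iXX)) => [|z].
  apply: measurable_funM => //; apply: measurable_funM.
    by apply: measurable_funM; [exact: measurableT_comp mU measurable_fst|
      exact: measurableT_comp mU measurable_snd].
  have [m1 m2] := mphi.
  by apply: measurable_funD; apply: measurable_funM;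
    [exact: measurableT_comp m1 measurable_fst|exact: measurableT_comp m1 measurable_snd|
     exact: measurableT_comp m2 measurable_fst|exact: measurableT_comp m2 measurable_snd].
set r := res _; set q := rdot _ _.
have UU : 0 <= U z.1 * U z.2 by rewrite mulr_ge0.
have q2 : q ^+ 2 <= sqmod (phi z.1) * sqmod (phi z.2) := sqr_rdot_le _ _.
rewrite mulrCA normrM (ger0_norm UU) (_ : _ + _ = U z.1 * U z.2 *
  (r ^+ 2 + sqmod (phi z.1) * sqmod (phi z.2))); last by ring.
rewrite ler_wpM2l// ler_norml; apply/andP; split.
  move: q2; have := sqr_ge0 (r + q); have := sqr_ge0 r; have := sqr_ge0 q; rewrite !expr2; lra.
move: q2; have := sqr_ge0 (r - q); have := sqr_ge0 r; have := sqr_ge0 q; rewrite !expr2; lra.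
Qed.

(** The limit of [truncated_ineq]; integrability of U |phi|^2 and of the kernel expression supplies
    the dominating functions. *)
Lemma birman_schwinger_ineq (s : R) : 0 < s ->
  2 * \int[mu]_x (U x * sqmod (phi x)) <= s * N + s^-1 * birman_schwinger_form.
Proof.
move=> s0; have i0 := form_domain_intble; have i1 := birman_schwinger_intble.
have L1 : X j @[j --> \oo] --> \int[mu]_x (U x * sqmod (phi x)).
  rewrite (_ : X = fun j => \int[mu]_x (cut j x * (U x * sqmod (phi x)))); last first.
    by apply/funext => j; exact: XE'.
  apply: (RI_dct _ (intble_meas i0) i0 _ _).2.
  - by move=> j; exact: (intble_meas (iX j)).
  - move=> j x; have n0 : 0 <= U x * sqmod (phi x) by rewrite mulr_ge0 ?sqmod_ge0.
    by rewrite (ger0_norm (mulr_ge0 (cut_ge0 j x) n0)) ler_piMl.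
  - apply: aeW => x; apply: cvg_near_cst; apply: filterS (cut_near x) => j ->.
    by rewrite mul1r.
have uE j z : res (z.1 - z.2) * rdot (u j z.1) (u j z.2) = cut j z.1 * cut j z.2 *
    (res (z.1 - z.2) * (U z.1 * U z.2 * rdot (phi z.1) (phi z.2))).
  by rewrite /u rdotCMl rdotCMr; ring.
have L2 : \int[mu2]_z (res (z.1 - z.2) * rdot (u j z.1) (u j z.2)) @[j --> \oo] -->
    birman_schwinger_form.
  apply: (RI_dct _ (intble_meas i1) (intble_norm i1) _ _).2.
  - move=> j; have [i2 _] := resolvent_form alpha_gt0 alpha_lt2 m_gt0 pK lambda_gt0 fin_res d_gt0 (u_cpt j).
    exact: (intble_meas i2).
  - move=> j z; rewrite uE normrM ler_piMl//.
    by rewrite (ger0_norm (mulr_ge0 (cut_ge0 j z.1) (cut_ge0 j z.2))) mulr_ile1.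
  - apply: aeW => z; apply: cvg_near_cst.
    apply: filterS2 (cut_near z.1) (cut_near z.2) => j c1 c2.
    by rewrite uE c1 c2 !mul1r.
have L1' : 2 * X j @[j --> \oo] --> 2 * \int[mu]_x (U x * sqmod (phi x)) by exact: cvgMr.
have L2' : s * N + s^-1 * \int[mu2]_z (res (z.1 - z.2) * rdot (u j z.1) (u j z.2))
    @[j --> \oo] --> s * N + s^-1 * birman_schwinger_form.
  by apply: cvgD; [exact: cvg_cst|exact: cvgMr].
rewrite -(cvg_lim _ L1')// -(cvg_lim _ L2')//.
apply: ler_lim; [exact: cvgP L1'|exact: cvgP L2'|].
by apply: nearW => j; exact: truncated_ineq.
Qed.

End one_function.

Lemma form_domain_intble_rdot phi1 h1 g1 k1 phi2 h2 g2 k2 :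
  in_form_domain alpha m phi1 h1 g1 k1 -> in_form_domain alpha m phi2 h2 g2 k2 ->
  intble mu (fun x => U x * rdot (phi1 x) (phi2 x)).
Proof.
move=> D1 D2; have i1 := form_domain_intble D1; have i2 := form_domain_intble D2.
have [[m1 _] _ _ _] := form_domain_L2 D1; have [[m2 _] _ _ _] := form_domain_L2 D2.
apply: (intble_le _ _ (intbleD i1 i2)) => [|x].
  by apply: measurable_funM => //; exact: cmeasurable_rdot.
by rewrite normrM (ger0_norm (U0 x)) -mulrDr ler_wpM2l// rdot_le.
Qed.

(* the Hilbert-Schmidt bound for the Birman-Schwinger kernel, tested on a
   family that is orthonormal for the weight U *)
Lemma birman_schwinger_trace n (chi h g k : 'I_n -> 'rV[R]_d -> R[i]) (tau : R) : 0 < tau ->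
  (forall i, in_form_domain alpha m (chi i) (h i) (g i) (k i)) ->
  (forall i j, \int[mu]_x (U x * rdot (chi i x) (chi j x)) = (i == j)%:R) ->
  \sum_i birman_schwinger_form (chi i) <= tau * res_sq U + n%:R / (2 * tau).
Proof.
move=> t0 D orth.
have iij i j := form_domain_intble_rdot (D i) (D j).
have iK i := birman_schwinger_intble (D i).
pose T (z : 'rV[R]_d * 'rV[R]_d) := \sum_i \sum_j
  (U z.1 * rdot (chi i z.1) (chi j z.1)) * (U z.2 * rdot (chi i z.2) (chi j z.2)).
have iT : intble mu2 T.
  by apply: intble_sum => i; apply: intble_sum => j; exact: (intble_prod (iij i j) (iij i j)).
(* By orthonormality the (i, j) term integrates to the square of a Kronecker delta, so the double
   sum gives n. *)
have IT : \int[mu2]_z T z = n%:R.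
  rewrite RI_sum; last first.
    by move=> i; apply: intble_sum => j; exact: (intble_prod (iij i j) (iij i j)).
  rewrite (eq_bigr (fun=> 1)) ?sumr_const ?card_ord// => i _.
  rewrite RI_sum; last by move=> j; exact: (intble_prod (iij i j) (iij i j)).
  rewrite (bigD1 i)//= big1 => [|j /negPf ji].
    by rewrite -(RI_prodM (iij i i) (iij i i)) orth eqxx mulr1 addr0.
  by rewrite -(RI_prodM (iij i j) (iij i j)) orth eq_sym ji mulr0.
rewrite /birman_schwinger_form -RI_sum// -IT.
rewrite [X in _ + X]mulrC -(RIZ _ iT) -(RIZ _ iU).
rewrite -RID; [|exact: intbleZ..].
apply: RI_le.
- exact: intble_sum.
- by apply: intbleD; exact: intbleZ.
move=> z; set r := res _; have UU : 0 <= U z.1 * U z.2 by rewrite mulr_ge0.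
(* Pointwise, r S <= tau r^2 + S^2/(4 tau), and S^2 <= 2 S2 turns the last term into S2/(2 tau). *)
pose S := \sum_i rdot (chi i z.1) (chi i z.2).
pose S2 := \sum_i \sum_j rdot (chi i z.1) (chi j z.1) * rdot (chi i z.2) (chi j z.2).
have -> : \sum_i r * (U z.1 * U z.2 * rdot (chi i z.1) (chi i z.2)) = U z.1 * U z.2 * (r * S).
  by rewrite /S !mulr_sumr; apply: eq_bigr => i _; ring.
have -> : T z = U z.1 * U z.2 * S2.
  rewrite /T /S2 mulr_sumr; apply: eq_bigr => i _; rewrite mulr_sumr.
  by apply: eq_bigr => j _; ring.
have SS2 : S ^+ 2 <= 2 * S2 := sqr_sum_rdot_le _ _.
rewrite (_ : _ + _ = U z.1 * U z.2 * (tau * r ^+ 2 + (2 * tau)^-1 * S2)); last by ring.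
rewrite ler_wpM2l//.
have t4 : 0 < 4 * tau by rewrite mulr_gt0.
rewrite -(ler_pM2l t4) (_ : 4 * tau * (tau * r ^+ 2 + (2 * tau)^-1 * S2) =
  (2 * tau * r) ^+ 2 + 2 * S2); last by field; rewrite gt_eqF.
have := sqr_ge0 (2 * tau * r - S); rewrite sqrrB; lra.
Qed.

End weight.

End birman_schwinger.

(** * Orthonormalising a positive definite Gram matrix *)

Section cholesky.
Context (R : realType).

(** One elimination step: L clears the first row and column outside the pivot a, leaving the Schur
    complement S to the induction; the first vector is scaled by a^{-1/2}. *)
Lemma orthonormalising_matrix n (G : 'M[R]_n) : G^T = G ->
  (forall c : 'rV_n, c != 0 -> 0 < (c *m G *m c^T) ord0 ord0) ->
  exists P : 'M[R]_n, P *m G *m P^T = 1%:M.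
Proof.
elim: n G => [|n IH] G Gsym Gpos; first by exists 0; apply/matrixP => -[].
rewrite -[n.+1]/(1 + n)%N in G Gsym Gpos *.
pose a := G ord0 ord0; pose b := ursubmx G; pose D := drsubmx G.
have aE : ulsubmx G = a%:M.
  apply/matrixP => i j; rewrite !ord1 !mxE eqxx mulr1n /a.
  by congr (G _ _); apply/val_inj.
have dE : dlsubmx G = b^T by rewrite /b trmx_ursub Gsym.
have Dsym : D^T = D by rewrite /D trmx_drsub Gsym.
have GE : G = block_mx a%:M b b^T D by rewrite -aE -dE submxK.
have a0 : 0 < a.
  have e0 : delta_mx ord0 ord0 != 0 :> 'rV[R]_(1 + n).
    by apply/eqP => /rowP/(_ ord0)/eqP; rewrite !mxE eqxx oner_eq0.
  have := Gpos _ e0; rewrite -rowE.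
  rewrite (_ : (_ *m _) ord0 ord0 = a)// trmx_delta -colE !mxE /a.
  by [].
pose S := D - a^-1 *: (b^T *m b).
pose L : 'M[R]_(1 + n) := block_mx 1%:M 0 (- a^-1 *: b^T) 1%:M.
have LG : L *m G *m L^T = block_mx a%:M 0 0 S.
  rewrite GE /L tr_block_mx !mulmx_block !trmx1 !trmx0 !mul0mx !mul1mx !mulmx0 !mulmx1 !addr0 ?add0r.
  rewrite linearZ /= trmxK mul_mx_scalar mul_scalar_mx -!scalemxAl !scalerA.
  rewrite mulrN mulfV ?gt_eqF// !scaleN1r !addNr mul0mx add0r.
  by rewrite /S addrC scaleNr.
have Ssym : S^T = S by rewrite /S linearB /= linearZ /= trmx_mul trmxK Dsym.
have Spos (c : 'rV_n) : c != 0 -> 0 < (c *m S *m c^T) ord0 ord0.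
  (* The Schur complement inherits positivity because its form at c is that of G at (0, c) L, a
     nonzero vector. *)
  move=> c0; pose c' := row_mx 0 c *m L.
  have c'0 : c' != 0.
    apply: contraNneq c0 => c'E; have : rsubmx c' = 0 by rewrite c'E linear0.
    by rewrite /c' /L mul_row_block row_mxKr mulmx0 add0r mulmx1 => ->.
  have := Gpos _ c'0; rewrite /c' trmx_mul !mulmxA -[_ *m L *m G *m L^T]mulmxA.
  rewrite -[_ *m L *m (_ *m _)]mulmxA (mulmxA L) LG mul_row_block.
  by rewrite !mul0mx !mulmx0 !add0r tr_row_mx mul_row_col mul0mx add0r.
have [P SP] := IH S Ssym Spos.
pose r := (Num.sqrt a)^-1; have rr : r * a * r = 1.
  have s0 : Num.sqrt a != 0 by rewrite gt_eqF// sqrtr_gt0.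
  by rewrite /r -{2}(sqr_sqrtr (ltW a0)) expr2 mulKf// mulfV.
exists (block_mx r%:M 0 0 P *m L).
rewrite trmx_mul !mulmxA -[_ *m L *m G *m L^T]mulmxA -[_ *m L *m (_ *m _)]mulmxA (mulmxA L) LG.
rewrite tr_block_mx !mulmx_block !trmx0 !mul0mx !mulmx0 !addr0 !add0r SP tr_scalar_mx.
by rewrite -!scalar_mxM rr !mul0mx -scalar_mx_block.
Qed.

End cholesky.

(** * Counting eigenvalues *)

Section eigenpairs.
Context (R : realType) (d : nat) (alpha m : R) (V : 'rV[R]_d -> R).
Notation mu := (lebesgue_rV R d).
Implicit Types (phi psi h g k : 'rV[R]_d -> R[i]) (E : R) (c : R[i]).

(** The real part of <psi, H phi> = E <psi, phi>, tested on the form domain. Replacing psi by its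
    complex multiples recovers the imaginary part. *)
Definition weak_eigen phi E g := forall psi hpsi gpsi kpsi,
  in_form_domain alpha m psi hpsi gpsi kpsi ->
  rip gpsi g + \int[mu]_x (V x * rdot (psi x) (phi x)) = E * rip psi phi.

Lemma opH_weak_eigen phi E : opH alpha m V phi (fun x => E%:C%C * phi x) ->
  exists h g k, in_form_domain alpha m phi h g k /\ weak_eigen phi E g.
Proof.
move=> [[g [h [k [F G A]]]] Leta H]; exists h, g, k; split; first by split.
move=> psi hpsi gpsi kpsi D.
have [Fp Gp Ap] := D.
have /(congr1 (@complex.Re R)) := H psi _ (ex_intro _ gpsi (ex_intro _ g (And3
  (ex_intro _ hpsi (ex_intro _ kpsi (And3 Fp Gp Ap)))
  (ex_intro _ h (ex_intro _ k (And3 F G A))) erefl))).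
rewrite ReD /L2inner /cintegral /=.
have E1 (a b : 'rV[R]_d -> R[i]) : \int[mu]_x Re (conjc (a x) * b x) = rip a b.
  by apply: eq_Rintegral => x _; rewrite rdotE.
rewrite !E1 => e; transitivity (rip psi (fun x => E%:C%C * phi x)).
  by rewrite -e; congr (_ + _); apply: eq_Rintegral => x _; rewrite ReCM rdotE.
have [Lp _ _ _] := form_domain_L2 D.
have [Lphi _ _] := F.
by rewrite ripC (ripZl E Lphi Lp) ripC.
Qed.

Lemma rdotMr c (z w : R[i]) : rdot z (c * w) = rdot (conjc c * z) w.
Proof. by rewrite /rdot cReM cImM [Re (_ * z)]cReM [Im (_ * z)]cImM ReJ ImJ; ring. Qed.

(** The factor c moves onto the test function as its conjugate, and the form domain is stable under
    complex multiples. *)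
Lemma weak_eigenZ c phi E g : weak_eigen phi E g ->
  weak_eigen (fun x => c * phi x) E (fun x => c * g x).
Proof.
move=> H psi hpsi gpsi kpsi /(form_domainZ (conjc c))/H => e.
rewrite /rip; under eq_Rintegral do rewrite rdotMr.
under [X in _ + X]eq_Rintegral do rewrite rdotMr.
by under [X in _ = _ * X]eq_Rintegral do rewrite rdotMr.
Qed.

Lemma weak_eigen_orthogonal phi1 h1 g1 k1 E1 phi2 h2 g2 k2 E2 :
  in_form_domain alpha m phi1 h1 g1 k1 -> weak_eigen phi1 E1 g1 ->
  in_form_domain alpha m phi2 h2 g2 k2 -> weak_eigen phi2 E2 g2 ->
  E1 != E2 -> rip phi1 phi2 = 0.
Proof.
move=> D1 W1 D2 W2 E12; have e1 := W2 _ _ _ _ D1; have e2 := W1 _ _ _ _ D2.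
have eV : \int[mu]_x (V x * rdot (phi2 x) (phi1 x)) =
    \int[mu]_x (V x * rdot (phi1 x) (phi2 x)).
  by apply: eq_Rintegral => x _; rewrite rdotC.
rewrite (ripC g2) (ripC phi2) eV e1 in e2.
have /eqP : (E2 - E1) * rip phi1 phi2 = 0 by rewrite mulrBl e2 subrr.
by rewrite mulf_eq0 subr_eq0 eq_sym (negPf E12) => /eqP.
Qed.

Lemma rip_eq0 phi : L2 phi -> rip phi phi = 0 -> {ae mu, forall x, phi x = 0}.
Proof.
move=> L e; have := RI_eq0 (fun x => sqmod_ge0 (phi x)) (L2_rdot L L) e.
by apply: filterS => x /sqmod_eq0.
Qed.

Lemma ae_rip0 phi psi : cmeasurable phi -> cmeasurable psi ->
  {ae mu, forall x, psi x = 0} -> rip phi psi = 0.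
Proof.
move=> mphi mpsi e; rewrite -[RHS](@RI0 _ _ R mu); apply: RI_ae.
- exact: cmeasurable_rdot.
- exact: measurable_cst.
by apply: filterS e => x ->; rewrite /rdot /= !mulr0 addr0.
Qed.

Lemma L2_sum I (s : seq I) (f : I -> 'rV[R]_d -> R[i]) : (forall i, L2 (f i)) ->
  L2 (fun x => \sum_(i <- s) f i x).
Proof.
move=> Lf; elim: s => [|i s IH].
  by under eq_fun do rewrite big_nil; exact: L20.
by under eq_fun do rewrite big_cons; exact: L2D.
Qed.

Lemma rip_suml I (s : seq I) (f : I -> 'rV[R]_d -> R[i]) psi : (forall i, L2 (f i)) ->
  L2 psi -> rip (fun x => \sum_(i <- s) f i x) psi = \sum_(i <- s) rip (f i) psi.
Proof.
move=> Lf Lp; rewrite /rip; under eq_Rintegral do rewrite rdot_suml.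
by rewrite RI_sum// => i; exact: L2_rdot.
Qed.

End eigenpairs.

(** * Counting eigenfunctions independent over R *)

Section counting.
Context (R : realType) (d : nat) (alpha m : R) (p : R -> 'rV[R]_d -> R) (lambda a : R).
Hypotheses (alpha_gt0 : 0 < alpha) (alpha_lt2 : alpha < 2) (m_gt0 : 0 < m).
Hypotheses (pK : heat_kernel alpha m p) (d_gt0 : (0 < d)%N).
Hypotheses (a_gt0 : 0 < a) (a_le : a <= lambda).
Hypothesis fin_res : forall x, x != 0 -> (resolvent_kernel p lambda x < +oo)%E.
Notation mu := (lebesgue_rV R d).
Notation res := (resolvent p lambda).

Let lambda_gt0 : 0 < lambda := lt_le_trans a_gt0 a_le.

Context (V : 'rV[R]_d -> R).
Hypotheses (mV : measurable_fun setT V).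
Hypothesis iV : res_sq_intble p lambda (fun x => `|V x|).

Let W x := Num.max (- V x) 0.

Let mW : measurable_fun setT W.
Proof. by apply: measurable_maxr => //; exact: measurableT_comp. Qed.

Let W0 x : 0 <= W x. Proof. by rewrite /W le_max lexx orbT. Qed.

Let WV x : W x <= `|V x|.
Proof. by rewrite /W ge_max normr_ge0 andbT -normrN ler_norm. Qed.

Let mnV : measurable_fun setT (fun x => `|V x|).
Proof. exact: measurableT_comp. Qed.

Lemma res_sq_intble_neg : res_sq_intble p lambda W.
Proof.
have mr : measurable_fun setT (fun z : 'rV[R]_d * 'rV[R]_d => res (z.1 - z.2)).
  exact: measurableT_comp (measurable_resolvent alpha_gt0 m_gt0 pK lambda) (@measurable_subv R d).
apply: (intble_le _ _ iV) => [|z].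
  apply: measurable_funM; first exact: measurable_funX.
  apply: measurable_funM.
    exact: measurableT_comp mW measurable_fst.
  exact: measurableT_comp mW measurable_snd.
rewrite ger0_norm; last by rewrite mulr_ge0 ?sqr_ge0 ?mulr_ge0.
by rewrite ler_wpM2l ?sqr_ge0// ler_pM.
Qed.

Let iW := res_sq_intble_neg.

(** Makes the term with V in [weak_eigen] a genuine integral, linear in the functions. *)
Lemma potential_intble phi1 h1 g1 k1 phi2 h2 g2 k2 :
  in_form_domain alpha m phi1 h1 g1 k1 -> in_form_domain alpha m phi2 h2 g2 k2 ->
  intble mu (fun x => V x * rdot (phi1 x) (phi2 x)).
Proof.
move=> D1 D2.
have i := form_domain_intble_rdot alpha_gt0 alpha_lt2 m_gt0 pK lambda_gt0 d_gt0 fin_res mnV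
  (fun x => normr_ge0 _) iV D1 D2.
have [[m1 _] _ _ _] := form_domain_L2 D1; have [[m2 _] _ _ _] := form_domain_L2 D2.
apply: (intble_le _ _ (intble_norm i)) => [|x].
  by apply: measurable_funM => //; exact: cmeasurable_rdot.
by rewrite !normrM normr_id.
Qed.

Context (n : nat) (phi h g k : 'I_n -> 'rV[R]_d -> R[i]) (E : 'I_n -> R).
Hypothesis D : forall i, in_form_domain alpha m (phi i) (h i) (g i) (k i).
Hypothesis eigen : forall i, weak_eigen alpha m V (phi i) (E i) (g i).

Hypothesis E_le : forall i, E i <= - a.

Let comb (f : 'I_n -> 'rV[R]_d -> R[i]) (c : 'I_n -> R) x : R[i] := \sum_i (c i)%:C%C * f i x.

Let Dc c : in_form_domain alpha m (comb phi c) (comb h c) (comb g c) (comb k c).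
Proof. exact: (form_domain_sum _ (fun i => (c i)%:C%C) D). Qed.

Hypothesis free : forall c, rip (comb phi c) (comb phi c) = 0 -> forall i, c i = 0.

Let rdot_comb (f : 'I_n -> 'rV[R]_d -> R[i]) c z x :
  rdot z (comb f c x) = \sum_i c i * rdot z (f i x).
Proof. by rewrite rdot_sumr; apply: eq_bigr => i _; rewrite rdotCMr. Qed.

Let rip_comb (f : 'I_n -> 'rV[R]_d -> R[i]) c psi : L2 psi -> (forall i, L2 (f i)) ->
  rip psi (comb f c) = \sum_i c i * rip psi (f i).
Proof.
move=> Lp Lf; rewrite /rip; under eq_Rintegral do rewrite rdot_comb.
rewrite RI_sum => [|i]; last exact/intbleZ/L2_rdot.
by apply: eq_bigr => i _; rewrite RIZ//; exact: L2_rdot.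
Qed.

Let weight_comb (w : 'rV[R]_d -> R) c psi :
  (forall i, intble mu (fun x => w x * rdot (psi x) (phi i x))) ->
  \int[mu]_x (w x * rdot (psi x) (comb phi c x)) =
  \sum_i c i * \int[mu]_x (w x * rdot (psi x) (phi i x)).
Proof.
move=> iw; under eq_Rintegral do rewrite rdot_comb mulr_sumr.
rewrite (_ : \int[mu]_x _ = \int[mu]_x \sum_i (c i * (w x * rdot (psi x) (phi i x)))).
  rewrite RI_sum => [|i]; last exact: intbleZ.
  by apply: eq_bigr => i _; rewrite RIZ.
by apply: eq_Rintegral => x _; apply: eq_bigr => i _; rewrite mulrCA.
Qed.

(** The equations are tested on the combination itself, and -V <= W. What remains is that the sum of
    c_i c_j (E_i + a) <phi_i, phi_j> is nonpositive. *)
Let span_ineq c : rip (comb g c) (comb g c) + a * rip (comb phi c) (comb phi c) <=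
  \int[mu]_x (W x * sqmod (comb phi c x)).
Proof.
have [Lp _ Lg _] := form_domain_L2 (Dc c).
have L i := form_domain_L2 (D i).
have Lpi i : L2 (phi i) by have [] := L i.
have Lgi i : L2 (g i) by have [] := L i.
have iVc := potential_intble (Dc c) (Dc c).
have iWc := form_domain_intble alpha_gt0 alpha_lt2 m_gt0 pK lambda_gt0 d_gt0 fin_res mW W0 iW (Dc c).
have H1 : rip (comb g c) (comb g c) + \int[mu]_x (V x * rdot (comb phi c x) (comb phi c x)) =
    \sum_i c i * (E i * rip (comb phi c) (phi i)).
  rewrite (rip_comb c Lg Lgi) (weight_comb c (fun i => potential_intble (Dc c) (D i))).
  rewrite -big_split; apply: eq_bigr => i _ /=; rewrite -mulrDr.
  by rewrite (eigen i (Dc c)).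
(* Eigenfunctions of the same eigenvalue need not be orthogonal. Since those of different ones are,
   the sum equals minus the squared norm of the combination with coefficients c_i s_i. *)
pose s i := Num.sqrt (- E i - a).
have s2 i : s i * s i = - E i - a.
  by rewrite -expr2 sqr_sqrtr// subr_ge0 lerNr.
have H2 : \sum_i c i * (E i * rip (comb phi c) (phi i)) + a * rip (comb phi c) (comb phi c) =
    - rip (comb phi (fun i => c i * s i)) (comb phi (fun i => c i * s i)).
  have Lps := form_domain_L2 (Dc (fun i => c i * s i)).
  have [Lcs _ _ _] := Lps.
  rewrite (rip_comb c Lp Lpi) (rip_comb _ Lcs Lpi) mulr_sumr -big_split -sumrN.
  apply: eq_bigr => i _ /=.
  rewrite ripC (rip_comb c (Lpi i) Lpi) (ripC (comb phi _)) (rip_comb _ (Lpi i) Lpi).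
  rewrite !mulr_sumr -big_split -sumrN; apply: eq_bigr => j _ /=.
  have [Eij|Eij] := eqVneq (E i) (E j); last by rewrite (weak_eigen_orthogonal (D i) (@eigen i) (D j) (@eigen j))// !mulr0 addr0 oppr0.
  have -> : s j = s i by rewrite /s Eij.
  rewrite (_ : - _ = - (c i * c j * rip (phi i) (phi j)) * (s i * s i)); last by ring.
  by rewrite s2; ring.
have H3 : - (\int[mu]_x (V x * rdot (comb phi c x) (comb phi c x))) <=
    \int[mu]_x (W x * sqmod (comb phi c x)).
  rewrite -mulN1r -(RIZ _ iVc); apply: RI_le => //; first exact: intbleZ.
  move=> x; rewrite mulrA mulN1r -sqmodE ler_wpM2r ?sqmod_ge0//.
  by rewrite /W le_max lexx.
have := rip_ge0 (comb phi (fun i => c i * s i)); lra.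
Qed.

(** The Gram matrix for the weight W is positive definite on the span, by [span_ineq]. After
    orthonormalisation each function contributes at least a/lambda to the trace; comparison with the
    Hilbert-Schmidt bound gives the count, with a factor 2 because independence is over R. *)
Theorem real_eigenfunction_count : n%:R <= 2 * ((lambda / a) ^+ 2 * res_sq p lambda W).
Proof.
have ii := form_domain_intble_rdot alpha_gt0 alpha_lt2 m_gt0 pK lambda_gt0 d_gt0 fin_res mW W0 iW.
pose G : 'M[R]_n := \matrix_(i, j) \int[mu]_x (W x * rdot (phi i x) (phi j x)).
have comb2 c c' : \int[mu]_x (W x * rdot (comb phi c x) (comb phi c' x)) =
    \sum_i c' i * \sum_j c j * \int[mu]_x (W x * rdot (phi j x) (phi i x)).
  rewrite (weight_comb c' (fun i => ii _ _ _ _ _ _ _ _ (Dc c) (D i))).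
  apply: eq_bigr => i _; congr (_ * _); under eq_Rintegral do rewrite rdotC.
  rewrite (weight_comb c (fun j => ii _ _ _ _ _ _ _ _ (D i) (D j))).
  by apply: eq_bigr => j _; congr (_ * _); apply: eq_Rintegral => x _; rewrite rdotC.
have bilin (c c' : 'rV_n) : (c *m G *m c'^T) ord0 ord0 =
    \int[mu]_x (W x * rdot (comb phi (c ord0) x) (comb phi (c' ord0) x)).
  rewrite comb2 mxE; apply: eq_bigr => i _; rewrite mulrC !mxE; congr (_ * _).
  by apply: eq_bigr => j _; rewrite mxE.
have Gsym : G^T = G.
  by apply/matrixP => i j; rewrite !mxE; apply: eq_Rintegral => x _; rewrite rdotC.
have Gpos (c : 'rV_n) : c != 0 -> 0 < (c *m G *m c^T) ord0 ord0.
  move=> c0; rewrite bilin; apply: lt_le_trans (span_ineq (c ord0)).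
  rewrite ltr_wpDl ?rip_ge0// mulr_gt0// lt_def rip_ge0 andbT.
  apply: contra c0 => /eqP/free c0; apply/eqP/rowP => i; by rewrite c0 mxE.
have [P GP] := orthonormalising_matrix Gsym Gpos.
pose chi i := comb phi (P i).
have orth i j : \int[mu]_x (W x * rdot (chi i x) (chi j x)) = (i == j)%:R.
  have := congr1 (fun A : 'M[R]_n => A i j) GP; rewrite !mxE => <-.
  rewrite comb2; apply: eq_bigr => l _; rewrite mulrC !mxE; congr (_ * _).
  by apply: eq_bigr => l' _; rewrite mxE.
(* With this tau, n/tau <= tau Q + n/(2 tau), that is n <= 2 tau^2 Q. *)
pose tau := lambda / a; have tau0 : 0 < tau by rewrite divr_gt0.
have tau1 : 1 <= tau by rewrite ler_pdivlMr// mul1r.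
(* The weighted norm of chi i being 1, [span_ineq] gives X + lambda Y <= tau (X + a Y) <= tau.
   [birman_schwinger_ineq] with s = 1/tau then reads 2 <= 1 + tau K. *)
have kappa i : tau^-1 <= birman_schwinger_form p lambda W (chi i).
  have T0 : 0 < tau^-1 by rewrite invr_gt0.
  have := birman_schwinger_ineq alpha_gt0 alpha_lt2 m_gt0 pK lambda_gt0 d_gt0 fin_res mW W0 iW
    (Dc (P i)) T0.
  have := span_ineq (P i); rewrite -/(chi i).
  have -> : \int[mu]_x (W x * sqmod (chi i x)) = 1 by have := orth i i; rewrite eqxx.
  rewrite invrK; set X := rip _ _; set Y := rip (chi i) _; set K := birman_schwinger_form _ _ _ _.
  have X0 : 0 <= X := rip_ge0 _; have Y0 : 0 <= Y := rip_ge0 _.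
  move=> h1 h2; rewrite -(ler_pM2l tau0) mulfV ?gt_eqF//.
  have h3 : X + lambda * Y <= tau * (X + a * Y).
    rewrite mulrDr mulrA /tau divfK ?gt_eqF// lerD2r ler_peMl//.
  have h4 : tau^-1 * (X + lambda * Y) <= 1.
    by rewrite ler_pdivrMl// mulr1; apply: le_trans h3 _; rewrite ler_piMr// ltW.
  lra.
have := birman_schwinger_trace alpha_gt0 alpha_lt2 m_gt0 pK lambda_gt0 d_gt0 fin_res mW W0 iW
  tau0 (fun i => Dc (P i)) orth.
have : \sum_(i < n) tau^-1 <= \sum_i birman_schwinger_form p lambda W (chi i) by exact: ler_sum.
have -> : \sum_(i < n) tau^-1 = n%:R / tau by rewrite sumr_const card_ord mulr_natl.
move=> h1 h2; have := le_trans h1 h2; set Q := res_sq _ _ _ => h3.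
have e1 : n%:R / (2 * tau) = n%:R / tau / 2 by rewrite invfM mulrA mulrAC.
have h4 : n%:R / tau <= 2 * (tau * Q) by rewrite e1 in h3; lra.
rewrite ler_pdivrMr// in h4; apply: le_trans h4 _.
by rewrite -/tau (_ : 2 * (tau * Q) * tau = 2 * (tau ^+ 2 * Q))//; ring.
Qed.

End counting.

(** * From real to complex multiplicities, and several eigenvalues together *)

Section complex_count.
Context (R : realType) (d : nat) (alpha m : R) (p : R -> 'rV[R]_d -> R) (lambda a : R).
Hypotheses (alpha_gt0 : 0 < alpha) (alpha_lt2 : alpha < 2) (m_gt0 : 0 < m).
Hypotheses (pK : heat_kernel alpha m p) (d_gt0 : (0 < d)%N).
Hypotheses (a_gt0 : 0 < a) (a_le : a <= lambda).
Hypothesis fin_res : forall x, x != 0 -> (resolvent_kernel p lambda x < +oo)%E.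
Notation mu := (lebesgue_rV R d).
Context (V : 'rV[R]_d -> R).
Hypotheses (mV : measurable_fun setT V).
Hypothesis iV : res_sq_intble p lambda (fun x => `|V x|).

(** The functions phi and i phi form a family twice as large and independent over R, so the factor 2
    of the real count cancels. *)
Theorem complex_eigenfunction_count (I : finType) (phi : I -> 'rV[R]_d -> R[i]) (E : I -> R) :
  (forall i, opH alpha m V (phi i) (fun x => (E i)%:C%C * phi i x)) ->
  (forall i, E i <= - a) ->
  (forall z : I -> R[i], {ae mu, forall x, \sum_i z i * phi i x = 0} -> forall i, z i = 0) ->
  #|I|%:R <= (lambda / a) ^+ 2 * res_sq p lambda (fun x => Num.max (- V x) 0).
Proof.
move=> opE Ea freeC.
have /choice[t tP] : forall i, exists t : ('rV[R]_d -> R[i]) * ('rV[R]_d -> R[i]) * ('rV[R]_d -> R[i]),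
    in_form_domain alpha m (phi i) t.1.1 t.1.2 t.2 /\ weak_eigen alpha m V (phi i) (E i) t.1.2.
  by move=> i; have [h [g [k H]]] := opH_weak_eigen (opE i); exists (h, g, k).
pose J : finType := (I * bool)%type; pose iu (b : bool) : R[i] := if b then (0 +i* 1)%C else 1.
pose lift (f : I -> 'rV[R]_d -> R[i]) (j : 'I_#|J|) x : R[i] :=
  iu (enum_val j).2 * f (enum_val j).1 x.
have D j : in_form_domain alpha m (lift phi j) (lift (fun i => (t i).1.1) j)
    (lift (fun i => (t i).1.2) j) (lift (fun i => (t i).2) j).
  exact/form_domainZ/(tP _).1.
have W j : weak_eigen alpha m V (lift phi j) (E (enum_val j).1) (lift (fun i => (t i).1.2) j).
  exact/weak_eigenZ/(tP _).2.
have free c : rip (fun x => \sum_j (c j)%:C%C * lift phi j x)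
    (fun x => \sum_j (c j)%:C%C * lift phi j x) = 0 -> forall j, c j = 0.
  pose z i : R[i] := (c (enum_rank (i, false)) +i* c (enum_rank (i, true)))%C.
  have E1 x : \sum_j (c j)%:C%C * lift phi j x = \sum_i z i * phi i x.
    pose F (u : J) : R[i] := (c (enum_rank u))%:C%C * (iu u.2 * phi u.1 x).
    transitivity (\sum_(u : J) F u).
      rewrite [RHS](reindex (@enum_val J J)) /=; last first.
        by apply: onW_bij; exact: enum_val_bij.
      by apply: eq_bigr => j _; rewrite /F enum_valK.
    rewrite (eq_bigr (fun u => F (u.1, u.2))) => [|[]//].
    rewrite -(pair_bigA _ (fun i b => F (i, b)))/=; apply: eq_bigr => i _.
    rewrite big_bool /F /z /iu /=; apply: complexP.
      by rewrite !(ReD, cReM, cImM) /=; ring.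
    by rewrite !(ImD, cReM, cImM) /=; ring.
  move=> r0; have L : L2 (fun x => \sum_j (c j)%:C%C * lift phi j x).
    by apply: L2_sum => j; apply: L2Z; have [] := form_domain_L2 (D j).
  have z0 : forall i, z i = 0.
    by apply: freeC; apply: filterS (rip_eq0 L r0) => x; rewrite E1.
  move=> j.
  have := z0 (enum_val j).1; rewrite /z => -[e1 e2].
  by rewrite -(enum_valK j); case: (enum_val j) e1 e2 => i [].
have := real_eigenfunction_count alpha_gt0 alpha_lt2 m_gt0 pK d_gt0 a_gt0 a_le fin_res mV iV
  D W (fun j => Ea _) free.
rewrite card_prod card_bool natrM mulrC ler_pM2l//.
Qed.

(** Bases of different eigenspaces are jointly independent: in a vanishing combination the
    components are orthogonal, so each vanishes and freeness applies within its eigenspace. *)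
Lemma eigenspaces_count (es : seq R) (n : R -> nat) : uniq es ->
  (forall E, E \in es -> E <= - a) ->
  (forall E, E \in es -> exists phi : 'I_(n E) -> 'rV[R]_d -> R[i], ae_free phi /\
    forall i, opH alpha m V (phi i) (fun x => E%:C%C * phi i x)) ->
  (\sum_(E <- es) n E)%:R <= (lambda / a) ^+ 2 * res_sq p lambda (fun x => Num.max (- V x) 0).
Proof.
move=> ues Ea H; pose e (k : 'I_(size es)) := nth 0 es k.
have ein k : e k \in es by exact: mem_nth.
have einj k k' : e k = e k' -> k = k'.
  by move=> /eqP; rewrite nth_uniq// => /eqP/val_inj.
pose f k : 'I_(n (e k)) -> 'rV[R]_d -> R[i] := projT1 (cid (H _ (ein k))).
have fP k : ae_free (f k) /\ forall i, opH alpha m V (f k i) (fun x => (e k)%:C%C * f k i x).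
  exact: projT2 (cid (H _ (ein k))).
pose I := {k : 'I_(size es) & 'I_(n (e k))}.
pose phi (u : I) := f (tag u) (tagged u).
have opE u : opH alpha m V (phi u) (fun x => (e (tag u))%:C%C * phi u x) by exact: (fP _).2.
have /choice[t tP] : forall u, exists t : ('rV[R]_d -> R[i]) * ('rV[R]_d -> R[i]) * ('rV[R]_d -> R[i]),
    in_form_domain alpha m (phi u) t.1.1 t.1.2 t.2 /\
    weak_eigen alpha m V (phi u) (e (tag u)) t.1.2.
  by move=> u; have [h [g [k Hu]]] := opH_weak_eigen (opE u); exists (h, g, k).
have Lphi u : L2 (phi u) by have [] := form_domain_L2 (tP u).1.
have free (z : I -> R[i]) : {ae mu, forall x, \sum_u z u * phi u x = 0} -> forall u, z u = 0.
  pose T k (i : 'I_(n (e k))) : I := Tagged (fun k => 'I_(n (e k))) i.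
  pose psi k x := \sum_(i < n (e k)) z (T k i) * phi (T k i) x.
  have Lpsi k : L2 (psi k) by apply: L2_sum => i; exact: L2Z.
  have E1 x : \sum_u z u * phi u x = \sum_k psi k x.
    by rewrite /psi (sig_big_dep _ (fun _ _ => true)
      (fun k (i : 'I_(n (e k))) => z (T k i) * phi (T k i) x))/=; apply: eq_bigr => -[].
  move=> z0; have psi0 : {ae mu, forall x, \sum_k psi k x = 0}.
    by apply: filterS z0 => x; rewrite E1.
  move=> [k i].
  have orth k' : k' != k -> rip (psi k') (psi k) = 0.
    move=> kk'; rewrite rip_suml// => [|j]; last exact: L2Z.
    rewrite big1// => j _; rewrite ripC (rip_suml _ (fun i => L2Z _ (Lphi _)) (L2Z _ (Lphi _))).
    rewrite big1// => j' _.
    have [D1 W1] := tP (T _ j'); have [D2 W2] := tP (T _ j).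
    apply: (weak_eigen_orthogonal (form_domainZ _ D1) (weak_eigenZ _ W1)
      (form_domainZ _ D2) (weak_eigenZ _ W2)).
    by apply: contra_neq kk' => /einj.
  have r0 : rip (psi k) (psi k) = 0.
    have LS : L2 (fun x => \sum_k' psi k' x) by exact: L2_sum.
    have := ae_rip0 (Lpsi k).1 LS.1 psi0.
    by rewrite ripC rip_suml// (bigD1 k)//= big1 ?addr0.
  exact: (fP k).1 (fun i => z (T k i)) (rip_eq0 (Lpsi k) r0) i.
have := complex_eigenfunction_count opE (fun u => Ea _ (ein (tag u))) free.
rewrite card_tagged sumnE big_map big_enum /=.
under eq_bigr do rewrite card_ord.
by rewrite (big_nth 0) big_mkord.
Qed.

End complex_count.

(* Unlike its library counterpart, this needs no measurability of the functions. *)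
Lemma ge0_le_integral_sup (d : measure_display) (T : measurableType d) (R : realType)
    (mu : {measure set T -> \bar R}) (f1 f2 : T -> \bar R) :
  (forall x, 0 <= f1 x)%E -> (forall x, f1 x <= f2 x)%E ->
  (\int[mu]_x f1 x <= \int[mu]_x f2 x)%E.
Proof.
move=> f10 f12; have f20 x : (0 <= f2 x)%E by exact: le_trans (f12 x).
rewrite !ge0_integralTE//; apply: ereal_sup_le => _ [h hf <-].
by exists h => // x; exact: le_trans (hf x) (f12 x).
Qed.

(** * Comparing the resolvent kernel with the Rollnik norm *)

Section rollnik_monotone.
Context (R : realType) (d : nat) (alpha m : R).

Lemma rollnik_integrand_ge0 (U : 'rV[R]_d -> R) x y :
  0 <= rollnik_H d alpha m (enorm (x - y)) ^+ 2 * `|U x| * `|U y|.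
Proof. exact: (mulr_ge0 (mulr_ge0 (sqr_ge0 _) (normr_ge0 _)) (normr_ge0 _)). Qed.

Lemma rollnik_sq_ge0 (U : 'rV[R]_d -> R) : (0 <= rollnik_sq alpha m U)%E.
Proof.
apply: integral_ge0 => x _; apply: integral_ge0 => y _.
by rewrite lee_fin rollnik_integrand_ge0.
Qed.

Lemma rollnik_sq_le (U1 U2 : 'rV[R]_d -> R) : (forall x, `|U1 x| <= `|U2 x|) ->
  (rollnik_sq alpha m U1 <= rollnik_sq alpha m U2)%E.
Proof.
move=> U12; apply: ge0_le_integral_sup => x.
  by apply: integral_ge0 => y _; rewrite lee_fin rollnik_integrand_ge0.
apply: ge0_le_integral_sup => y; first by rewrite lee_fin rollnik_integrand_ge0.
rewrite lee_fin; apply: ler_pM => //; first exact: (mulr_ge0 (sqr_ge0 _) (normr_ge0 _)).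
by apply: ler_wpM2l => //; exact: sqr_ge0.
Qed.

End rollnik_monotone.

Section rollnik_bound.
Context (R : realType) (d : nat) (alpha m : R) (p : R -> 'rV[R]_d -> R) (lambda C : R).
Hypotheses (alpha_gt0 : 0 < alpha) (alpha_lt2 : alpha < 2) (m_gt0 : 0 < m).
Hypotheses (pK : heat_kernel alpha m p) (d_gt0 : (0 < d)%N) (C_gt0 : 0 < C).
Hypothesis res_le : forall x, x != 0 ->
  (resolvent_kernel p lambda x <= (C * rollnik_H d alpha m (enorm x))%:E)%E.
Notation mu := (lebesgue_rV R d).
Notation mu2 := (lebesgue_rV R d \x lebesgue_rV R d)%E.

Lemma resolvent_kernel_lty x : x != 0 -> (resolvent_kernel p lambda x < +oo)%E.
Proof. by move=> /res_le/le_lt_trans; apply; rewrite ltry. Qed.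

(** The kernel bound is squared, the resolvent being nonnegative. Tonelli is applied only to the
    measurable minorant [G] of the Rollnik integrand, which is set to 0 on the diagonal, where the
    kernel bound says nothing; the iterated integrals are then compared by monotonicity alone. *)
Lemma res_sq_le_rollnik (U : 'rV[R]_d -> R) : measurable_fun setT U -> (forall x, 0 <= U x) ->
  (rollnik_sq alpha m U < +oo)%E ->
  res_sq_intble p lambda U /\
  res_sq p lambda U <= C ^+ 2 * fine (rollnik_sq alpha m U).
Proof.
move=> mU U0 Uoo.
pose F (z : 'rV[R]_d * 'rV[R]_d) : R := resolvent p lambda (z.1 - z.2) ^+ 2 * (U z.1 * U z.2).
pose off (z : 'rV[R]_d * 'rV[R]_d) : R := if enorm (z.1 - z.2) <= 0 then 0 else 1.
pose G z := C ^- 2 * (off z * F z).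
have mF : measurable_fun setT F.
  apply: measurable_funM.
    apply: measurable_funX.
    exact: measurableT_comp (measurable_resolvent alpha_gt0 m_gt0 pK lambda) (@measurable_subv R d).
  apply: measurable_funM.
    exact: measurableT_comp mU measurable_fst.
  exact: measurableT_comp mU measurable_snd.
have mG : measurable_fun setT G.
  apply: measurable_funM => //; apply: measurable_funM => //.
  apply: measurable_fun_ifT => //; apply: measurable_fun_ler => //.
  exact: measurableT_comp (@measurable_enorm R d) (@measurable_subv R d).
have F0 z : 0 <= F z by rewrite mulr_ge0 ?sqr_ge0 ?mulr_ge0.
have G0 z : 0 <= G z.
  rewrite /G mulr_ge0 ?invr_ge0 ?sqr_ge0// mulr_ge0// /off; by case: ifP.
have GH x y : G (x, y) <= rollnik_H d alpha m (enorm (x - y)) ^+ 2 * `|U x| * `|U y|.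
  rewrite /G /off /F /=; case: ifPn => xy.
    by rewrite mul0r mulr0 rollnik_integrand_ge0.
  have xy0 : x - y != 0.
    apply: contraNneq xy => ->; rewrite /enorm /dotv big1 ?sqrtr0// => i _.
    by rewrite mxE mul0r.
  have [_ rE] := resolvent_kernel_fin alpha_gt0 alpha_lt2 m_gt0 pK (resolvent_kernel_lty xy0).
  have := res_le xy0; rewrite rE lee_fin => rH.
  rewrite mul1r !ger0_norm// [leLHS]mulrA -[leRHS]mulrA; apply: ler_wpM2r; first exact: mulr_ge0.
  rewrite ler_pdivrMl ?exprn_gt0// -exprMn lerXn2r ?nnegrE//.
    exact: (resolvent_ge0 alpha_gt0 alpha_lt2 m_gt0 pK).
  by apply: le_trans rH; exact: (resolvent_ge0 alpha_gt0 alpha_lt2 m_gt0 pK).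
have IG : (\int[mu]_x \int[mu]_y (G (x, y))%:E <= rollnik_sq alpha m U)%E.
  apply: ge0_le_integral_sup => x.
    by apply: integral_ge0 => y _; rewrite lee_fin.
  by apply: ge0_le_integral_sup => y; rewrite lee_fin.
have iG : intble mu2 G.
  apply/integrable12ltyP; first exact/measurable_EFinP.
  apply: le_lt_trans Uoo; apply: le_trans IG.
  rewrite le_eqVlt; apply/orP; left; apply/eqP; apply: eq_integral => x _.
  by apply: eq_integral => y _; rewrite /= ger0_norm.
have aeFG : {ae mu2, forall z, C ^+ 2 * G z = F z}.
  apply: filterS (@ae_off_diagonal R d d_gt0) => z z12.
  rewrite /G mulrA mulfV ?gt_eqF ?exprn_gt0// mul1r /off ifF ?mul1r//.
  apply: contraNF z12 => h; rewrite -subr_eq0; apply/eqP/enorm_eq0/eqP.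
  by rewrite eq_le h sqrtr_ge0.
have iCG := intbleZ (C ^+ 2) iG.
split; first exact: (intble_ae mF aeFG iCG).
rewrite /res_sq -(RI_ae (intble_meas iCG) mF aeFG) (RIZ _ iG).
have Ufin : rollnik_sq alpha m U \is a fin_num by rewrite ge0_fin_numE ?rollnik_sq_ge0.
rewrite ler_pM2l ?exprn_gt0// -lee_fin (fineK Ufin).
apply: le_trans IG; rewrite EFin_RI// le_eqVlt; apply/orP; left; apply/eqP.
by rewrite fubini_tonelli1//; exact/measurable_EFinP.
Qed.

End rollnik_bound.

(** * Finiteness below -m and the choice of lambda0 *)

(** Turns a multiplicity, defined as a possibly infinite supremum, into an attained natural number
    once a count bounds it. *)
Lemma bounded_nat_sup (R : realType) (S : set nat) (K : R) : S 0%N ->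
  (forall n, S n -> n%:R <= K) ->
  exists2 n, S n & ereal_sup [set n%:R%:E | n in S] = n%:R%:E :> \bar R.
Proof.
move=> S0 SK.
have [n [Sn nmax]] : exists n, S n /\ forall k, S k -> (k <= n)%N.
  apply: contrapT => H.
  have grow : forall N, exists2 n, S n & (N <= n)%N.
    elim=> [|N [n Sn Nn]]; first by exists 0%N.
    have [k [Sk nk]] : exists k, S k /\ (n < k)%N.
      apply: contrapT => h; apply: H; exists n; split => // k Sk.
      by rewrite leqNgt; apply/negP => nk; apply: h; exists k.
    by exists k => //; exact: leq_ltn_trans Nn nk.
  have [n Sn Kn] := grow (Num.truncn K).+1.
  have := SK _ Sn; rewrite leNgt => /negP; apply.
  by apply: lt_le_trans (truncnS_gt K) _; rewrite ler_nat.
exists n => //; apply/eqP; rewrite eq_le; apply/andP; split.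
  by apply: ge_ereal_sup => _ [k Sk <-]; rewrite lee_fin ler_nat nmax.
by apply: ereal_sup_ubound; exists n.
Qed.

Lemma seq_gap (R : realType) (m : R) (s : seq R) : (forall E, E \in s -> E < - m) ->
  exists2 l, m < l & forall E, E \in s -> E <= - l.
Proof.
(* For the empty list any number above m serves; m + 1 is taken. *)
elim: s => [|E s IH] H; first by exists (m + 1) => //; rewrite ltrDl.
have [F Fs|l ml sl] := IH; first by apply: H; rewrite inE Fs orbT.
have Em : E < - m by apply: H; rewrite mem_head.
exists (Num.min l (- E)); first by rewrite lt_min ml/= ltrNr.
move=> F; rewrite inE lerNr => /predU1P[->|/sl]; first by rewrite ge_min lexx orbT.
by rewrite ge_min lerNr => ->.
Qed.

Theorem theorem4p10 (R : realType) (d : nat) (alpha m : R)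
    (alpha_gt0 : 0 < alpha) (alpha_lt2 : alpha < 2) (d_ge1 : (1 <= d)%N)
    (m_gt0 : 0 < m) (d_lt2alpha : d%:R < 2 * alpha)
    (V : 'rV[R]_d -> R) (VR : ext_rollnik alpha m V)
    (p : R -> 'rV[R]_d -> R) (pK : heat_kernel alpha m p)
    (C : R -> R)
    (hC : forall lambda : R, m < lambda ->
      0 < C lambda /\
      forall x : 'rV[R]_d, x != 0 ->
        (resolvent_kernel p lambda x <=
           (C lambda * rollnik_H d alpha m (enorm x))%:E)%E) :
  exists lambda0 : R, m < lambda0 /\
    (nb_eigenvalues_below alpha m V (- m) <=
       (C lambda0 ^+ 2)%:E * rollnik_sq alpha m (V^\-)%R)%E.
Proof.
have [mV Voo] := VR.
have mW : measurable_fun setT (V^\-)%R by exact: measurable_funrneg.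
have W0 x : 0 <= (V^\-)%R x by exact: funrneg_ge0.
have Wfin : (rollnik_sq alpha m (V^\-)%R < +oo)%E.
  apply: le_lt_trans Voo; apply: rollnik_sq_le => x.
  by rewrite ger0_norm// /funrneg ge_max normr_ge0 andbT -normrN ler_norm.
pose B := fine (rollnik_sq alpha m (V^\-)%R).
pose S E : set nat := [set n : nat | exists phi : 'I_n -> 'rV[R]_d -> R[i],
  ae_free phi /\ forall i, opH alpha m V (phi i) (fun x => E%:C%C * phi i x)].
(* Here n E is the size of any free family of eigenfunctions, so the bound is usable before
   multiplicities are known to be finite. *)
have count (lambda a : R) (es : seq R) (n : R -> nat) : m < lambda -> 0 < a -> a <= lambda ->
    uniq es -> (forall E, E \in es -> E <= - a) -> (forall E, E \in es -> S E (n E)) ->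
    (\sum_(E <- es) n E)%:R <= (lambda / a) ^+ 2 * (C lambda ^+ 2 * B).
  move=> ml a0 al ues Ea SE; have [C0 hR] := hC _ ml.
  have l0 : 0 < lambda by exact: lt_trans ml.
  have lty := resolvent_kernel_lty hR.
  have [iV _] : res_sq_intble p lambda (fun x => `|V x|) /\
      res_sq p lambda (fun x => `|V x|) <= C lambda ^+ 2 * fine (rollnik_sq alpha m (fun x => `|V x|)).
    have mA : measurable_fun setT (fun x => `|V x|) by exact: measurableT_comp.
    have AV x : `| `|V x| | <= `|V x| by rewrite normr_id.
    exact: (res_sq_le_rollnik alpha_gt0 alpha_lt2 m_gt0 pK d_ge1 C0 hR mA
      (fun x => normr_ge0 _) (le_lt_trans (rollnik_sq_le alpha m AV) Voo)).
  apply: le_trans (eigenspaces_count alpha_gt0 alpha_lt2 m_gt0 pK d_ge1 a0 al lty mV iV ues Ea SE) _.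
  rewrite ler_wpM2l ?sqr_ge0//.
  exact: (res_sq_le_rollnik alpha_gt0 alpha_lt2 m_gt0 pK d_ge1 C0 hR mW W0 Wfin).2.
pose K := ((m + 1) / m) ^+ 2 * (C (m + 1) ^+ 2 * B).
have m1 : m < m + 1 by rewrite ltrDl.
have countK (es : seq R) (n : R -> nat) : uniq es -> (forall E, E \in es -> E < - m) ->
    (forall E, E \in es -> S E (n E)) -> (\sum_(E <- es) n E)%:R <= K.
  by move=> ues Em SE; apply: count => //; [exact: ltW|move=> E /Em/ltW].
have /choice[n nP] : forall E, exists n, E < - m -> S E n /\ multiplicityH alpha m V E = n%:R%:E.
  move=> E; have [Em|_] := ltP E (- m); last by exists 0%N.
  have [||n Sn nE] := @bounded_nat_sup R (S E) K; last by exists n.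
  (* The empty family puts 0 in [S E]. *)
  - by exists (fun _ _ => 0); split => [c _|] [].
  - move=> n Sn; have := countK [:: E] (fun=> n); rewrite big_seq1; apply => //.
      by move=> F; rewrite inE => /eqP ->.
    by move=> F; rewrite inE => /eqP ->.
(* The eigenvalues below -m. Each adds at least 1 to a sum bounded by K, so more than K of them
   cannot exist. *)
pose P := [set E : R | E < - m /\ (0 < n E)%N].
have finP : finite_set P.
  apply: contrapT => /(infinite_set_fset (Num.truncn K).+1)[X XP].
  rewrite leqNgt => /negP; apply; rewrite ltnS.
  have : (\sum_(E <- finmap.enum_fset X) n E)%:R <= K.
    apply: countK; first exact: finmap.fset_uniq.
      by move=> E EX; have [] := XP E EX.
    by move=> E EX; have [Em _] := XP E EX; have [] := nP E Em.
  have sn : (size (finmap.enum_fset X) <= \sum_(E <- finmap.enum_fset X) n E)%N.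
    rewrite -sum1_size big_seq [leqRHS]big_seq; apply: leq_sum => E EX.
    by have [] := XP E EX.
  by move=> h; rewrite -ltnS; rewrite -(ltr_nat R); apply: le_lt_trans (truncnS_gt K);
    apply: le_trans h; rewrite ler_nat.
have [l ml lP] : exists2 l, m < l & forall E, P E -> E <= - l.
  have [|l ml lP] := @seq_gap R m (finmap.enum_fset (fset_set P)).
    by move=> E; rewrite in_fset_set// inE => -[].
  by exists l => // E PE; apply: lP; rewrite in_fset_set// inE.
(* [\esum] is a supremum over finite sets X of reals below -m, so each such X is bounded
   separately. *)
exists l; split => //; apply: ge_ereal_sup => _ [X [finX Xm] <-].
have -> : ((C l ^+ 2)%:E * rollnik_sq alpha m (V^\-)%R = (C l ^+ 2 * B)%:E)%E.
  by rewrite (EFinM (C l ^+ 2)) /B fineK// ge0_fin_numE// rollnik_sq_ge0.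
rewrite fsbig_finite//= big_seq.
rewrite (eq_bigr (fun E => (n E)%:R%:E)) => [|E]; last first.
  by rewrite in_fset_set// inE => /Xm/nP[].
rewrite -big_seq sumEFin lee_fin -natr_sum.
(* Members of X that are not eigenvalues are dropped: they contribute 0 and may lie between -l and
   -m. *)
pose es := [seq E <- finmap.enum_fset (fset_set X) | (0 < n E)%N].
have -> : (\sum_(E <- finmap.enum_fset (fset_set X)) n E = \sum_(E <- es) n E)%N.
  rewrite big_filter [RHS]big_mkcond; apply: eq_bigr => E _.
  by case: posnP => // ->.
have l0 : 0 < l by exact: lt_trans ml.
have esP E : E \in es -> P E.
  by rewrite mem_filter => /andP[nE]; rewrite in_fset_set// inE => /Xm.
have := @count l l es n ml l0 (lexx _); rewrite divff ?gt_eqF// expr1n mul1r; apply.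
- exact/filter_uniq/finmap.fset_uniq.
- by move=> E /esP/lP.
- by move=> E /esP[Em _]; have [] := nP E Em.
Qed.
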